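(* A curve $\gamma=(\gamma_1,\gamma_2):\mathbb{R}\to\mathbb{H}$ is a wavelike elastica parametrized by hyperbolic arclength if and only if there are $k\in(\frac{1}{\sqrt2},1)$ and $s_*\in\mathbb{R}$ such that, with the associated $\kappa,\mu,\hat W_1,\hat W_2$ defined in the context, for all $s\in\mathbb{R}$ $$\gamma_1(s)=\frac{b_1\hat W_1(s)+b_2\hat W_2(s)+b_3\kappa(s)}{a_1\hat W_1(s)+a_2\hat W_2(s)+a_3\kappa(s)},\qquad \gamma_2(s)=\frac{1}{a_1\hat W_1(s)+a_2\hat W_2(s)+a_3\kappa(s)}$$ for some $a_1,a_2,a_3,b_1,b_2,b_3\in\mathbb{R}$ such that either $$a_3\neq0,\quad a_2=\sqrt{a_1^2+a_3^2},\quad \begin{pmatrix} b_1 \\ b_2 \end{pmatrix}=\frac{b_3}{a_3}\begin{pmatrix} a_1 \\ a_2 \end{pmatrix}-\frac{1}{\sqrt{|\mu|}\,a_3}\begin{pmatrix} a_2 \\ a_1 \end{pmatrix}$$ or $$a_3=0,\quad a_2=|a_1|,\quad b_1=\operatorname{sign}(a_1)b_2,\quad |b_3|=\frac{1}{\sqrt{|\mu|}}.$$ (For a wavelike elastica whose hyperbolic curvature function is $\kappa$, the formulas hold with the $k,s_*$ belonging to this $\kappa$.) In this case, where $\kappa$ is the hyperbolic curvature function of $\gamma$ and $\phi$ its angle function, the identities $$\gamma_2(s)(a_1,a_2)^T=\xi^1(s),\qquad \gamma_2(s)(b_1,b_2)^T=\gamma_1(s)\xi^1(s)+\gamma_2(s)\xi^3(s)$$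 hold on $\mathbb{R}\setminus\{\kappa=0\}$, and for all $s\in\mathbb{R}$ \begin{align*} a_3\gamma_1(s)&=b_3+\frac{1}{2\mu}\big(\kappa(s)^2\sin(\phi(s))+2\kappa'(s)\cos(\phi(s))\big), \\ a_3\gamma_2(s)&=\frac{\kappa(s)}{\mu}+\frac{1}{2\mu}\big(2\kappa'(s)\sin(\phi(s))-\kappa(s)^2\cos(\phi(s))\big). \end{align*}
   Context: Let $\mathbb{H}=\{(x_1,x_2)\in\mathbb{R}^2: x_2>0\}$ be the hyperbolic plane. A smooth curve $\gamma=(\gamma_1,\gamma_2)$ in $\mathbb{H}$ is parametrized by hyperbolic arclength if $(\gamma_1')^2+(\gamma_2')^2=\gamma_2^2$; its angle function $\phi$ (unique up to $2\pi\mathbb{Z}$) is the smooth function with $\gamma_1'=\gamma_2\cos\phi$, $\gamma_2'=\gamma_2\sin\phi$, and its hyperbolic curvature function is $\phi'+\cos\phi$. For $k\in(\frac1{\sqrt2},1)$, $s_*\in\mathbb{R}$ put $$\kappa(s)=\frac{2k}{\sqrt{2k^2-1}}\,\mathrm{cn}\Big(\frac{s+s_*}{\sqrt{2k^2-1}},k\Big),\qquad \mu=-\frac{4k^2(1-k^2)}{(2k^2-1)^2}.$$ A wavelike elastica is a curve parametrized by hyperbolic arclength whose hyperbolic curvature function is of this form for some $k\in(\frac1{\sqrt2},1)$, $s_*\in\mathbb{R}$. Here $\mathrm{sn},\mathrm{cn},\mathrm{dn}$ are Jacobi's elliptic functions with modulus $k$. Definition of $W_j,\hat W_j$. Let $F(l,k)=\int_0^l\frac{dt}{\sqrt{1-t^2}\sqrt{1-k^2t^2}}$,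 $K(k)=F(1,k)$, $k'=\sqrt{1-k^2}$, $q_k=\exp(-\pi K(k')/K(k))$ and $$\Theta(z,k)=1+2\sum_{n\ge1}(-1)^nq_k^{n^2}\cos\Big(\frac{n\pi z}{K(k)}\Big),\quad \Theta_1(z,k)=1+2\sum_{n\ge1}q_k^{n^2}\cos\Big(\frac{n\pi z}{K(k)}\Big),\quad \zeta(z,k)=\frac{\partial_z\Theta(z,k)}{\Theta(z,k)}.$$ With $\alpha_k=F(k'/k,k)$ put $w_\pm(s)=\frac{\Theta_1(s\pm\alpha_k,k)}{\Theta(s,k)}e^{\mp s\zeta(\alpha_k,k)}$ and $$\hat w_1=\frac{k(w_+-w_-)}{w_+(0)+w_-(0)},\qquad \hat w_2=\frac{k(w_++w_-)}{w_+(0)+w_-(0)},\qquad w_j=\frac{\hat w_j}{\mathrm{cn}(\cdot,k)}\ \text{ where } \mathrm{cn}(\cdot,k)\ne0.$$ Then $$W_j(s)=\frac{1}{\sqrt{2k^2-1}}\,w_j\Big(\frac{s+s_*}{\sqrt{2k^2-1}}\Big),\qquad \hat W_j(s)=\frac{2k}{2k^2-1}\,\hat w_j\Big(\frac{s+s_*}{\sqrt{2k^2-1}}\Big)\qquad (j=1,2),$$ so $\hat W_j$ is smooth on $\mathbb{R}$ and $\hat W_j=\kappa W_j$ where $\kappa\neq0$. Definition of $\xi^1,\xi^3$ (at points $s$ with $\kappa(s)\ne0$, all functions evaluated at $s$): $$\xi^1=\begin{pmatrix} W_1 & W_2 \\ W_1' & W_2' \end{pmatrix}^{-1}\begin{pmatrix}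 \frac1\kappa-\frac{\kappa}{\mu}-\frac{\kappa'}{\mu}\sin\phi+\frac{\kappa^2}{2\mu}\cos\phi \\ -\frac1\kappa\sin\phi-\frac{\kappa'}{\kappa^2} \end{pmatrix},\qquad \xi^3=\begin{pmatrix} W_1 & W_2 \\ W_1' & W_2' \end{pmatrix}^{-1}\begin{pmatrix} \frac{\kappa^2}{2\mu}\sin\phi+\frac{\kappa'}{\mu}\cos\phi \\ \frac1\kappa\cos\phi \end{pmatrix}.$$ *)

(* Defs.v *)
From Stdlib Require Import Reals.
From Coquelicot Require Import Coquelicot.
Open Scope R_scope.

(* Throughout, k is the modulus (not the parameter m = k^2), 0 < k < 1.
   The integrand of F(1,k) is unbounded at 1, hence the improper integral.
   For -1 < l < 1 the limit from the left is the ordinary integral. *)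
Definition ellF (l k : R) : R :=
  RInt_gen (fun t => / (sqrt (1 - t ^ 2) * sqrt (1 - k ^ 2 * t ^ 2)))
    (at_point 0) (at_left l).

Definition ellK (k : R) : R := ellF 1 k.

Definition compl_modulus (k : R) : R := sqrt (1 - k ^ 2).

(* [iota P] is the element satisfying [P] when it is unique.  For |k| < 1 the
   integrand lies between 1 and (1 - k^2)^(-1/2), so for every z there is
   exactly one such p. *)
Definition jacobi_am (z k : R) : R :=
  iota (fun p : R => is_RInt (fun t => / sqrt (1 - k ^ 2 * sin t ^ 2)) 0 p z).

Definition jacobi_cn (z k : R) : R := cos (jacobi_am z k).

Definition nome (k : R) : R := exp (- PI * ellK (compl_modulus k) / ellK k).

(* [Series] starts at 0, so the summation index of the mathematics is [S n]. *)
Definition Theta (z k : R) : R :=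
  1 + 2 * Series (fun n =>
    (-1) ^ S n * nome k ^ (S n ^ 2) * cos (INR (S n) * PI * z / ellK k)).

Definition Theta1 (z k : R) : R :=
  1 + 2 * Series (fun n =>
    nome k ^ (S n ^ 2) * cos (INR (S n) * PI * z / ellK k)).

Definition zeta (z k : R) : R := Derive (fun x => Theta x k) z / Theta z k.

Definition alpha (k : R) : R := ellF (compl_modulus k / k) k.

Definition w_plus (k s : R) : R :=
  Theta1 (s + alpha k) k / Theta s k * exp (- (s * zeta (alpha k) k)).

Definition w_minus (k s : R) : R :=
  Theta1 (s - alpha k) k / Theta s k * exp (s * zeta (alpha k) k).

Definition w1_hat (k s : R) : R :=
  k * (w_plus k s - w_minus k s) / (w_plus k 0 + w_minus k 0).

Definition w2_hat (k s : R) : R :=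
  k * (w_plus k s + w_minus k s) / (w_plus k 0 + w_minus k 0).

(* Meaningful only where [jacobi_cn s k <> 0]. *)
Definition w1 (k s : R) : R := w1_hat k s / jacobi_cn s k.
Definition w2 (k s : R) : R := w2_hat k s / jacobi_cn s k.

Definition rescale (k s_star s : R) : R := (s + s_star) / sqrt (2 * k ^ 2 - 1).

Definition W1 (k s_star s : R) : R :=
  1 / sqrt (2 * k ^ 2 - 1) * w1 k (rescale k s_star s).
Definition W2 (k s_star s : R) : R :=
  1 / sqrt (2 * k ^ 2 - 1) * w2 k (rescale k s_star s).

Definition W1_hat (k s_star s : R) : R :=
  2 * k / (2 * k ^ 2 - 1) * w1_hat k (rescale k s_star s).
Definition W2_hat (k s_star s : R) : R :=
  2 * k / (2 * k ^ 2 - 1) * w2_hat k (rescale k s_star s).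

Definition in_H (x1 x2 : R) : Prop := 0 < x2.

Definition smooth (f : R -> R) : Prop := forall (n : nat) (s : R), ex_derive_n f n s.

Definition hyp_arclength (g1 g2 : R -> R) : Prop :=
  (forall s, in_H (g1 s) (g2 s)) /\ smooth g1 /\ smooth g2 /\
  (forall s, Derive g1 s ^ 2 + Derive g2 s ^ 2 = g2 s ^ 2).

Definition angle_function (g1 g2 phi : R -> R) : Prop :=
  smooth phi /\
  (forall s, Derive g1 s = g2 s * cos (phi s) /\ Derive g2 s = g2 s * sin (phi s)).

(* Depends on the curve only through its angle function, and is unchanged when
   a multiple of 2 PI is added to that function. *)
Definition hyp_curvature (phi : R -> R) (s : R) : R := Derive phi s + cos (phi s).

Definition wavelike_modulus (k : R) : Prop := 1 / sqrt 2 < k < 1.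

Definition kappa (k s_star s : R) : R :=
  2 * k / sqrt (2 * k ^ 2 - 1) * jacobi_cn (rescale k s_star s) k.

Definition mu (k : R) : R := - (4 * k ^ 2 * (1 - k ^ 2)) / (2 * k ^ 2 - 1) ^ 2.

Definition elastica_with (k s_star : R) (g1 g2 phi : R -> R) : Prop :=
  hyp_arclength g1 g2 /\ angle_function g1 g2 phi /\
  (forall s, hyp_curvature phi s = kappa k s_star s).

Definition wavelike_elastica (g1 g2 : R -> R) : Prop :=
  exists k s_star : R, wavelike_modulus k /\
    exists phi : R -> R, elastica_with k s_star g1 g2 phi.

Definition denom (k s_star a1 a2 a3 s : R) : R :=
  a1 * W1_hat k s_star s + a2 * W2_hat k s_star s + a3 * kappa k s_star s.

(* The two quotients are required to be genuine ones. *)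
Definition represented (k s_star : R) (g1 g2 : R -> R) (a1 a2 a3 b1 b2 b3 : R) : Prop :=
  forall s,
    denom k s_star a1 a2 a3 s <> 0 /\
    g1 s = (b1 * W1_hat k s_star s + b2 * W2_hat k s_star s + b3 * kappa k s_star s)
           / denom k s_star a1 a2 a3 s /\
    g2 s = 1 / denom k s_star a1 a2 a3 s.

Definition admissible (k a1 a2 a3 b1 b2 b3 : R) : Prop :=
  (a3 <> 0 /\ a2 = sqrt (a1 ^ 2 + a3 ^ 2) /\
   b1 = b3 / a3 * a1 - 1 / (sqrt (Rabs (mu k)) * a3) * a2 /\
   b2 = b3 / a3 * a2 - 1 / (sqrt (Rabs (mu k)) * a3) * a1)
  \/
  (a3 = 0 /\ a2 = Rabs a1 /\ b1 = sign a1 * b2 /\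
   Rabs b3 = 1 / sqrt (Rabs (mu k))).

Definition det2 (m11 m12 m21 m22 : R) : R := m11 * m22 - m12 * m21.

(* The inverse of [[m11, m12], [m21, m22]] applied to the column (v1, v2);
   meaningful only when the determinant is nonzero. *)
Definition inv2_mul (m11 m12 m21 m22 v1 v2 : R) : R * R :=
  ((m22 * v1 - m12 * v2) / det2 m11 m12 m21 m22,
   (m11 * v2 - m21 * v1) / det2 m11 m12 m21 m22).

Definition wronskian (k s_star s : R) : R :=
  det2 (W1 k s_star s) (W2 k s_star s)
       (Derive (W1 k s_star) s) (Derive (W2 k s_star) s).

Definition W_inv_mul (k s_star s v1 v2 : R) : R * R :=
  inv2_mul (W1 k s_star s) (W2 k s_star s)
           (Derive (W1 k s_star) s) (Derive (W2 k s_star) s) v1 v2.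

Definition xi1 (k s_star : R) (phi : R -> R) (s : R) : R * R :=
  let kap := kappa k s_star s in
  let dkap := Derive (kappa k s_star) s in
  W_inv_mul k s_star s
    (1 / kap - kap / mu k - dkap / mu k * sin (phi s)
       + kap ^ 2 / (2 * mu k) * cos (phi s))
    (- (1 / kap * sin (phi s)) - dkap / kap ^ 2).

Definition xi3 (k s_star : R) (phi : R -> R) (s : R) : R * R :=
  let kap := kappa k s_star s in
  let dkap := Derive (kappa k s_star) s in
  W_inv_mul k s_star s
    (kap ^ 2 / (2 * mu k) * sin (phi s) + dkap / mu k * cos (phi s))
    (1 / kap * cos (phi s)).

(* Main.v *)
(* In the hyperboloid model the coordinates of a curve along a fixed Minkowski vector satisfy the linear
   frame equations [u' = t], [t' = u + kappa n], [n' = - kappa t]. For a wavelike elastica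
   [kappa'' = kappa - kappa^3/2], so the vector with coordinates [(kappa, kappa', - kappa^2/2)] is constant
   and spacelike, and the coordinates along the two null directions orthogonal to it satisfy
   [P' = (kappa kappa' -+ (r/2) kappa^2) / (kappa^2 + r^2) P] with [r = sqrt |mu|]. These are
   [W2_hat +- W1_hat], so [1/gamma2] and [gamma1/gamma2] are combinations of [W1_hat], [W2_hat], [kappa];
   the relations between the coefficients say that the first vector is null and equals its cross product
   with the second.

   The equation for [P] is the logarithmic derivative of [Theta1 (x + alpha) / Theta x], which follows from
   [th3^2 th3(x+y) th3(x-y) = th4(x)^2 th4(y)^2 + th2(x)^2 th2(y)^2] by differentiating along [x] and [y].
   Theta identities come from splitting sums over Z^2 by the parity of [m + n], which turns the nome [q]
   into [q^2]. The same doubling excludes zeros of theta functions (they would persist as [q -> 0]) and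
   gives Landen's transformation, by which [q -> k] is onto (0, 1). Theta quotients of real and of
   imaginary argument solve the differential equations of the elliptic integrals of modulus [k] and
   [sqrt (1 - k^2)] with one common constant, whence [q = exp (- PI K' / K)]. *)
Require Import Defs.
From Stdlib Require Import Reals Lra Lia ZArith.
From Coquelicot Require Import Coquelicot.
Open Scope R_scope.

(** * Sums over the integers *)

(** The argument stays on the real line, so zeros and periods of theta functions are reached through
    identities between double sums instead of contour integrals. A modulus determines its nome
    through elliptic integrals, while theta identities are natural in t = - ln q. Statements about k
    are therefore proved for k = [modk t] and argument [nu t * v], and surjectivity of [modk]
    carries them back.

    The shift alpha, defined by sn(alpha) = k'/k, is the one for which k'^2 + k^2 cn(x)^2
    cn(alpha)^2 is a constant multiple of kappa^2 + |mu|; the addition theorem makes this the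
    product of the two null coordinates.

    W_1 and W_2 are singular where kappa vanishes. The geometric argument runs with [null_plus] and
    [null_minus], which are smooth and positive everywhere, and divides by kappa only to reach xi^1
    and xi^3. The normal coordinate, too, is visible in the frame equations only where kappa is
    nonzero, but it is determined up to a constant, so a single such point fixes it. *)

Lemma exp_opp1_bounds : 0 < exp (-1) < 1.
Proof.
  split; [apply exp_pos|].
  rewrite <- exp_0. apply exp_increasing. lra.
Qed.

Lemma exp_opp_INR (n : nat) : exp (- INR n) = exp (-1) ^ n.
Proof.
  induction n as [|n IH].
  - simpl. rewrite Ropp_0. apply exp_0.
  - rewrite S_INR, <- tech_pow_Rmult, <- IH, <- exp_plus. f_equal. ring.
Qed.

(** One fixed ratio is enough: Gaussian terms beat every geometric rate, so all dependence on
    parameters goes into [C]. *)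
Definition geometric (C : R) (a : nat -> R) : Prop :=
  forall n, Rabs (a n) <= C * exp (-1) ^ n.

Lemma geometric_const_ge0 (C : R) (a : nat -> R) : geometric C a -> 0 <= C.
Proof.
  intros H. specialize (H 0%nat). simpl in H.
  pose proof (Rabs_pos (a 0%nat)). lra.
Qed.

Lemma is_series_geometric (C : R) :
  is_series (fun n => C * exp (-1) ^ n) (C * / (1 - exp (-1))).
Proof.
  apply (is_series_scal (V := R_NormedModule) C (fun n => exp (-1) ^ n)), is_series_geom.
  pose proof exp_opp1_bounds. rewrite Rabs_pos_eq; lra.
Qed.

Lemma geometric_ex_series_Rabs (C : R) (a : nat -> R) :
  geometric C a -> ex_series (fun n => Rabs (a n)).
Proof.
  intros H. apply (@ex_series_le R_AbsRing R_CompleteNormedModule) with (b := fun n => C * exp (-1) ^ n).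
  - intros n. change (Rabs (Rabs (a n)) <= C * exp (-1) ^ n). rewrite Rabs_Rabsolu. apply H.
  - eexists. apply is_series_geometric.
Qed.

Lemma geometric_ex_series (C : R) (a : nat -> R) : geometric C a -> ex_series a.
Proof. intros H. apply ex_series_Rabs. now apply (geometric_ex_series_Rabs C). Qed.

Lemma geometric_Series_le (C : R) (a : nat -> R) :
  geometric C a -> Rabs (Series a) <= C * / (1 - exp (-1)).
Proof.
  intros H. eapply Rle_trans. { apply Series_Rabs. now apply (geometric_ex_series_Rabs C). }
  rewrite <- (is_series_unique _ _ (is_series_geometric C)).
  apply Series_le. { intros n. split; [apply Rabs_pos | apply H]. }
  eexists. apply is_series_geometric.
Qed.

Lemma Series_sum_n (f : nat -> nat -> R) (M : nat) :
  (forall m, ex_series (f m)) ->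
  ex_series (fun n => sum_n (fun m => f m n) M) /\
  Series (fun n => sum_n (fun m => f m n) M) = sum_n (fun m => Series (f m)) M.
Proof.
  intros H. induction M as [|M [E IH]].
  - split. { eapply ex_series_ext; [|apply (H 0%nat)]. intros n. now rewrite sum_O. }
    rewrite sum_O. apply Series_ext. intros n. now rewrite sum_O.
  - split.
    + eapply ex_series_ext; [|apply (ex_series_plus _ _ E (H (S M)))].
      intros n. now rewrite sum_Sn.
    + rewrite sum_Sn, <- IH. change plus with Rplus. rewrite <- Series_plus by auto.
      apply Series_ext. intros n. now rewrite sum_Sn.
Qed.

(** Finitely many rows commute with the column sums, and after M + 1 rows the rest of the double sum
    is at most C r^(M+1) / (1 - r)^2 with r = e^(-1). *)
Lemma Series_swap (C : R) (f : nat -> nat -> R) :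
  (forall m n, Rabs (f m n) <= C * exp (-1) ^ m * exp (-1) ^ n) ->
  Series (fun m => Series (f m)) = Series (fun n => Series (fun m => f m n)).
Proof.
  intros H. pose proof exp_opp1_bounds as Hr. set (r := exp (-1)) in *.
  assert (Hrow : forall m, geometric (C * r ^ m) (f m)) by (intros m n; apply H).
  assert (Hcol : forall n, geometric (C * r ^ n) (fun m => f m n)).
  { intros n m. fold r. specialize (H m n). fold r in H. lra. }
  assert (HC : 0 <= C). { pose proof (geometric_const_ge0 _ _ (Hrow 0%nat)). simpl in *; lra. }
  apply is_series_unique.
  set (L := Series (fun n => Series (fun m => f m n))).
  change (is_lim_seq (sum_n (fun m => Series (f m))) L).
  assert (Hex : ex_series (fun n => Series (fun m => f m n))).
  { apply (geometric_ex_series (C * / (1 - r))). intros n.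
    eapply Rle_trans; [apply (geometric_Series_le _ _ (Hcol n))|]. fold r. right; ring. }
  apply is_lim_seq_spec. intros eps.
  assert (Hlim : is_lim_seq (fun M => C * / (1 - r) * / (1 - r) * r ^ S M) 0).
  { replace (Finite 0) with (Rbar_mult (C * / (1 - r) * / (1 - r)) 0) by (simpl; f_equal; ring).
    apply (is_lim_seq_scal_l (fun M => r ^ S M)).
    apply (is_lim_seq_incr_1 (fun n => r ^ n)). apply is_lim_seq_geom.
    rewrite Rabs_pos_eq; lra. }
  apply is_lim_seq_spec in Hlim. destruct (Hlim eps) as [N HN]. exists N. intros M HM.
  specialize (HN M HM). rewrite Rminus_0_r in HN.
  eapply Rle_lt_trans; [|eapply Rle_lt_trans; [apply Rle_abs|apply HN]].
  destruct (Series_sum_n f M) as [Es Eq]. { intros m. eapply geometric_ex_series, Hrow. }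
  rewrite <- Eq, Rabs_minus_sym. unfold L. rewrite <- Series_minus by assumption.
  replace (C * / (1 - r) * / (1 - r) * r ^ S M)
    with (C * / (1 - r) * r ^ S M * / (1 - r)) by ring.
  apply geometric_Series_le. intros n. fold r.
  rewrite (Series_incr_n _ (S M)); [|lia|eapply geometric_ex_series, Hcol].
  simpl pred. rewrite <- sum_n_Reals.
  replace (sum_n (fun m => f m n) M + Series (fun k => f (S M + k)%nat n) - sum_n (fun m => f m n) M)
    with (Series (fun k => f (S M + k)%nat n)) by ring.
  replace (C * / (1 - r) * r ^ S M * r ^ n) with (C * r ^ n * r ^ S M * / (1 - r)) by ring.
  apply geometric_Series_le. intros k. fold r.
  specialize (H (S M + k)%nat n). fold r in H. rewrite pow_add in H. lra.
Qed.

(** The partial sums of the paired series are those of [a] at the odd indices, a subsequence. *)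
Lemma Series_even_odd (C : R) (a : nat -> R) :
  geometric C a ->
  Series a = Series (fun n => a (2 * n)%nat) + Series (fun n => a (2 * n + 1)%nat).
Proof.
  intros H. pose proof exp_opp1_bounds as Hr. set (r := exp (-1)) in *.
  pose proof (geometric_const_ge0 _ _ H) as HC.
  assert (Hle : forall n j, (n <= j)%nat -> C * r ^ j <= C * r ^ n).
  { intros n j Hnj. apply Rmult_le_compat_l; [lra|].
    replace j with (n + (j - n))%nat by lia. rewrite pow_add.
    rewrite <- (Rmult_1_r (r ^ n)) at 2. apply Rmult_le_compat_l.
    - apply pow_le; lra.
    - rewrite <- (pow1 (j - n)). apply pow_incr. lra. }
  assert (He : ex_series (fun n => a (2 * n)%nat)).
  { apply (geometric_ex_series C). intros n. eapply Rle_trans; [apply H|]. apply Hle; lia. }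
  assert (Ho : ex_series (fun n => a (2 * n + 1)%nat)).
  { apply (geometric_ex_series C). intros n. eapply Rle_trans; [apply H|]. apply Hle; lia. }
  rewrite <- Series_plus by assumption.
  symmetry. apply is_series_unique.
  change (is_lim_seq (sum_n (fun n => a (2 * n)%nat + a (2 * n + 1)%nat)) (Series a)).
  assert (Hs : is_lim_seq (sum_n a) (Series a)) by (apply Series_correct; eapply geometric_ex_series, H).
  apply (is_lim_seq_subseq _ _ (fun n => (2 * n + 1)%nat)) in Hs.
  - eapply is_lim_seq_ext; [|apply Hs]. intros n. simpl.
    induction n as [|n IH].
    + simpl. rewrite sum_Sn, !sum_O. reflexivity.
    + rewrite (sum_Sn _ n), <- IH.
      replace (S n + (S n + 0) + 1)%nat with (S (S (n + (n + 0) + 1))) by lia.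
      rewrite !sum_Sn. change plus with Rplus. rewrite Rplus_assoc.
      repeat f_equal; lia.
  - apply eventually_subseq. intros n. lia.
Qed.

(** The second half starts at -1, so the reflection n -> -n-1, the symmetry of the characteristic
    1/2, exchanges the two halves. *)
Definition bsum (u : Z -> R) : R :=
  Series (fun n => u (Z.of_nat n)) + Series (fun n => u (- Z.of_nat n - 1)%Z).

Definition edecay (C : R) (u : Z -> R) : Prop :=
  forall n, Rabs (u n) <= C * exp (- IZR (Z.abs n)).

Lemma edecay_const_ge0 (C : R) (u : Z -> R) : edecay C u -> 0 <= C.
Proof.
  intros H. specialize (H 0%Z). simpl in H. rewrite Ropp_0, exp_0 in H.
  pose proof (Rabs_pos (u 0%Z)). lra.
Qed.

Lemma exp_abs_of_nat (n : nat) : exp (- IZR (Z.abs (Z.of_nat n))) = exp (-1) ^ n.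
Proof. rewrite Z.abs_eq, <- INR_IZR_INZ, exp_opp_INR by lia. reflexivity. Qed.

Lemma exp_abs_neg_le (n : nat) : exp (- IZR (Z.abs (- Z.of_nat n - 1))) <= exp (-1) ^ n.
Proof.
  rewrite <- exp_abs_of_nat. apply Rlt_le, exp_increasing, Ropp_lt_contravar, IZR_lt. lia.
Qed.

Lemma edecay_geometric_pos (C : R) (u : Z -> R) :
  edecay C u -> geometric C (fun n => u (Z.of_nat n)).
Proof. intros H n. rewrite <- exp_abs_of_nat. apply H. Qed.

Lemma edecay_geometric_neg (C : R) (u : Z -> R) :
  edecay C u -> geometric C (fun n => u (- Z.of_nat n - 1)%Z).
Proof.
  intros H n. eapply Rle_trans; [apply H|].
  apply Rmult_le_compat_l; [eapply edecay_const_ge0, H | apply exp_abs_neg_le].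
Qed.

Lemma bsum_ext (u v : Z -> R) : (forall n, u n = v n) -> bsum u = bsum v.
Proof. intros H. unfold bsum. f_equal; apply Series_ext; intros; apply H. Qed.

Lemma bsum_plus (Cu Cv : R) (u v : Z -> R) :
  edecay Cu u -> edecay Cv v -> bsum (fun n => u n + v n) = bsum u + bsum v.
Proof.
  intros Hu Hv. unfold bsum. rewrite !Series_plus; [ring|..];
    eapply geometric_ex_series;
    (apply edecay_geometric_pos || apply edecay_geometric_neg); eassumption.
Qed.

Lemma bsum_scal (c : R) (u : Z -> R) : bsum (fun n => c * u n) = c * bsum u.
Proof. unfold bsum. rewrite !Series_scal_l. ring. Qed.

Lemma bsum_minus (Cu Cv : R) (u v : Z -> R) :
  edecay Cu u -> edecay Cv v -> bsum (fun n => u n - v n) = bsum u - bsum v.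
Proof.
  intros Hu Hv.
  rewrite (bsum_ext (fun n => u n - v n) (fun n => u n + -1 * v n)) by (intros; ring).
  rewrite (bsum_plus Cu Cv); [rewrite bsum_scal; ring | assumption |].
  intros n. specialize (Hv n). rewrite Rabs_mult, (Rabs_left (-1)) by lra. lra.
Qed.

Lemma bsum_Rabs_le (C : R) (u : Z -> R) :
  edecay C u -> Rabs (bsum u) <= C * (2 / (1 - exp (-1))).
Proof.
  intros H. unfold bsum. eapply Rle_trans; [apply Rabs_triang|].
  pose proof (geometric_Series_le _ _ (edecay_geometric_pos _ _ H)).
  pose proof (geometric_Series_le _ _ (edecay_geometric_neg _ _ H)). lra.
Qed.

Lemma bsum_succ (C : R) (u : Z -> R) : edecay C u -> bsum (fun n => u (n + 1)%Z) = bsum u.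
Proof.
  intros H. unfold bsum.
  rewrite (Series_incr_1 (fun n => u (Z.of_nat n))) by (eapply geometric_ex_series, edecay_geometric_pos, H).
  rewrite (Series_incr_1 (fun n => u (- Z.of_nat n - 1 + 1)%Z)).
  - rewrite (Series_ext (fun n => u (Z.of_nat n + 1)%Z) (fun n => u (Z.of_nat (S n))))
      by (intros; f_equal; lia).
    rewrite (Series_ext (fun n => u (- Z.of_nat (S n) - 1 + 1)%Z) (fun n => u (- Z.of_nat n - 1)%Z))
      by (intros; f_equal; lia).
    simpl. ring.
  - apply ex_series_incr_1.
    eapply ex_series_ext; [|eapply geometric_ex_series, edecay_geometric_neg, H].
    intros n. cbv beta. f_equal. lia.
Qed.

Lemma edecay_comp (C : R) (u : Z -> R) (p : Z -> Z) (d : Z) :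
  edecay C u -> (forall n, (Z.abs n <= Z.abs (p n) + d)%Z) ->
  edecay (C * exp (IZR d)) (fun n => u (p n)).
Proof.
  intros H Hp n. eapply Rle_trans; [apply H|].
  rewrite Rmult_assoc, <- exp_plus. apply Rmult_le_compat_l; [eapply edecay_const_ge0, H|].
  assert (Hle : - IZR (Z.abs (p n)) <= IZR d + - IZR (Z.abs n)).
  { specialize (Hp n). apply IZR_le in Hp. rewrite plus_IZR in Hp. lra. }
  destruct Hle as [Hlt | ->]; [apply Rlt_le, exp_increasing, Hlt | lra].
Qed.

Lemma bsum_shift (C : R) (u : Z -> R) (k : Z) : edecay C u -> bsum (fun n => u (n + k)%Z) = bsum u.
Proof.
  intros H. pattern k. apply Z.bi_induction.
  - now intros x y ->.
  - apply bsum_ext. intros n. f_equal. lia.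
  - intros j.
    rewrite <- (bsum_succ (C * exp (IZR (Z.abs j))) (fun n => u (n + j)%Z)).
    + rewrite (bsum_ext (fun n => u (n + Z.succ j)%Z) (fun n => u (n + 1 + j)%Z)); [tauto|].
      intros n. f_equal. lia.
    + apply edecay_comp; [assumption|]. intros n. lia.
Qed.

Lemma bsum_opp (C : R) (u : Z -> R) : edecay C u -> bsum (fun n => u (- n)%Z) = bsum u.
Proof.
  intros H. rewrite <- (bsum_shift C u 1) by assumption. unfold bsum.
  rewrite Rplus_comm. f_equal; apply Series_ext; intros n; f_equal; lia.
Qed.

Lemma bsum_even_odd (C : R) (u : Z -> R) :
  edecay C u -> bsum u = bsum (fun n => u (2 * n)%Z) + bsum (fun n => u (2 * n + 1)%Z).
Proof.
  intros H. unfold bsum.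
  rewrite (Series_even_odd C _ (edecay_geometric_pos _ _ H)).
  rewrite (Series_even_odd C _ (edecay_geometric_neg _ _ H)).
  rewrite (Series_ext (fun n => u (Z.of_nat (2 * n))) (fun n => u (2 * Z.of_nat n)%Z)) by (intros; f_equal; lia).
  rewrite (Series_ext (fun n => u (Z.of_nat (2 * n + 1))) (fun n => u (2 * Z.of_nat n + 1)%Z)) by (intros; f_equal; lia).
  rewrite (Series_ext (fun n => u (- Z.of_nat (2 * n) - 1)%Z) (fun n => u (2 * (- Z.of_nat n - 1) + 1)%Z)) by (intros; f_equal; lia).
  rewrite (Series_ext (fun n => u (- Z.of_nat (2 * n + 1) - 1)%Z) (fun n => u (2 * (- Z.of_nat n - 1))%Z)) by (intros; f_equal; lia).
  ring.
Qed.

Lemma bsum_of_even (C : R) (u : Z -> R) :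
  edecay C u -> (forall n, u (- n)%Z = u n) ->
  bsum u = u 0%Z + 2 * Series (fun n => u (Z.of_nat (S n))).
Proof.
  intros H He. unfold bsum.
  rewrite (Series_incr_1 (fun n => u (Z.of_nat n))) by (eapply geometric_ex_series, edecay_geometric_pos, H).
  rewrite (Series_ext (fun n => u (- Z.of_nat n - 1)%Z) (fun n => u (Z.of_nat (S n)))).
  - simpl. ring.
  - intros n. rewrite <- He. f_equal. lia.
Qed.

(** Z^2 is cut into four quadrants, each a double series over the naturals. *)
Lemma bsum_swap (C : R) (f : Z -> Z -> R) :
  (forall m, edecay (C * exp (- IZR (Z.abs m))) (f m)) ->
  bsum (fun m => bsum (f m)) = bsum (fun n => bsum (fun m => f m n)).
Proof.
  intros H.
  assert (HC : 0 <= C).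
  { pose proof (edecay_const_ge0 _ _ (H 0%Z)) as Hc. simpl in Hc. rewrite Ropp_0, exp_0 in Hc. lra. }
  assert (Hp : forall n, 0 < exp (-1) ^ n) by (intros; apply pow_lt, exp_pos).
  assert (Key : forall p p' : nat -> Z,
    (forall n, exp (- IZR (Z.abs (p n))) <= exp (-1) ^ n) ->
    (forall n, exp (- IZR (Z.abs (p' n))) <= exp (-1) ^ n) ->
    (forall m n, Rabs (f (p m) (p' n)) <= C * exp (-1) ^ m * exp (-1) ^ n)).
  { intros p p' H1 H2 m n. eapply Rle_trans; [apply H|].
    pose proof (exp_pos (- IZR (Z.abs (p m)))). pose proof (exp_pos (- IZR (Z.abs (p' n)))).
    apply Rmult_le_compat; [nra|lra| |apply H2].
    apply Rmult_le_compat_l; [lra|apply H1]. }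
  assert (Ha : forall n, exp (- IZR (Z.abs (Z.of_nat n))) <= exp (-1) ^ n)
    by (intros n; right; apply exp_abs_of_nat).
  pose proof exp_abs_neg_le as Hb.
  assert (Hs : forall p p' : nat -> Z,
    (forall n, exp (- IZR (Z.abs (p n))) <= exp (-1) ^ n) ->
    (forall n, exp (- IZR (Z.abs (p' n))) <= exp (-1) ^ n) ->
    ex_series (fun m => Series (fun n => f (p m) (p' n))) /\
    ex_series (fun n => Series (fun m => f (p m) (p' n)))).
  { intros p p' H1 H2. split.
    - apply (geometric_ex_series (C * / (1 - exp (-1)))). intros m.
      eapply Rle_trans; [apply (geometric_Series_le (C * exp (-1) ^ m)); intros n; now apply Key|].
      right; ring.
    - apply (geometric_ex_series (C * / (1 - exp (-1)))). intros n.
      eapply Rle_trans; [apply (geometric_Series_le (C * exp (-1) ^ n)); intros m|].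
      + eapply Rle_trans; [now apply Key|]. right; ring.
      + right; ring. }
  assert (Hswap : forall p p' : nat -> Z,
    (forall n, exp (- IZR (Z.abs (p n))) <= exp (-1) ^ n) ->
    (forall n, exp (- IZR (Z.abs (p' n))) <= exp (-1) ^ n) ->
    Series (fun m => Series (fun n => f (p m) (p' n))) =
    Series (fun n => Series (fun m => f (p m) (p' n)))).
  { intros p p' H1 H2. apply (Series_swap C (fun m n => f (p m) (p' n))). now apply Key. }
  pose (p := fun n => Z.of_nat n). pose (q := fun n => (- Z.of_nat n - 1)%Z).
  change (forall n, exp (- IZR (Z.abs (p n))) <= exp (-1) ^ n) in Ha.
  change (forall n, exp (- IZR (Z.abs (q n))) <= exp (-1) ^ n) in Hb.
  transitivity
    ((Series (fun m => Series (fun n => f (p m) (p n))) + Series (fun m => Series (fun n => f (p m) (q n)))) +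
     (Series (fun m => Series (fun n => f (q m) (p n))) + Series (fun m => Series (fun n => f (q m) (q n))))).
  { unfold bsum. f_equal.
    - apply (Series_plus _ _ (proj1 (Hs p p Ha Ha))
               (proj1 (Hs p q Ha Hb))).
    - apply (Series_plus _ _ (proj1 (Hs q p Hb Ha))
               (proj1 (Hs q q Hb Hb))). }
  rewrite (Hswap p p), (Hswap p q), (Hswap q p), (Hswap q q) by assumption.
  transitivity
    ((Series (fun n => Series (fun m => f (p m) (p n))) + Series (fun n => Series (fun m => f (q m) (p n)))) +
     (Series (fun n => Series (fun m => f (p m) (q n))) + Series (fun n => Series (fun m => f (q m) (q n))))).
  { ring. }
  unfold bsum. symmetry. f_equal.
  - apply (Series_plus _ _ (proj2 (Hs p p Ha Ha))
             (proj2 (Hs q p Hb Ha))).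
  - apply (Series_plus _ _ (proj2 (Hs p q Ha Hb))
             (proj2 (Hs q q Hb Hb))).
Qed.

Lemma edecay_bsum (C : R) (f : Z -> Z -> R) :
  (forall m, edecay (C * exp (- IZR (Z.abs m))) (f m)) ->
  edecay (C * (2 / (1 - exp (-1)))) (fun m => bsum (f m)).
Proof.
  intros H m. eapply Rle_trans; [apply bsum_Rabs_le, H|]. right. ring.
Qed.

(* Substitutes [a = m + n] in the inner sum and splits the outer one by the parity of [a]. *)
Lemma bsum_lattice (C : R) (f : Z -> Z -> R) :
  (forall m n, Rabs (f m n) <= C * exp (- 2 * IZR (Z.abs m)) * exp (- 2 * IZR (Z.abs n))) ->
  bsum (fun m => bsum (f m)) =
  bsum (fun a => bsum (fun b => f (a + b)%Z (a - b)%Z)) +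
  bsum (fun a => bsum (fun b => f (a + b + 1)%Z (a - b)%Z)).
Proof.
  intros H.
  assert (HC : 0 <= C).
  { specialize (H 0%Z 0%Z). pose proof (Rabs_pos (f 0%Z 0%Z)). simpl in H.
    rewrite Rmult_0_r, exp_0 in H. lra. }
  assert (Hexp : forall a b, a <= b -> exp a <= exp b).
  { intros a b [Hlt | ->]; [apply Rlt_le, exp_increasing, Hlt | lra]. }
  assert (Hf : forall m, edecay (C * exp (- IZR (Z.abs m))) (f m)).
  { intros m n. eapply Rle_trans; [apply H|].
    pose proof (IZR_le _ _ (Z.abs_nonneg m)). pose proof (IZR_le _ _ (Z.abs_nonneg n)).
    pose proof (exp_pos (- 2 * IZR (Z.abs m))). pose proof (exp_pos (- 2 * IZR (Z.abs n))).
    apply Rmult_le_compat; [nra|lra| |apply Hexp; lra].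
    apply Rmult_le_compat_l; [lra|apply Hexp; lra]. }
  assert (Hg : forall m, edecay (C * exp (- IZR (Z.abs m))) (fun a => f m (a - m)%Z)).
  { intros m a. eapply Rle_trans; [apply H|].
    rewrite !Rmult_assoc, <- !exp_plus. apply Rmult_le_compat_l; [lra|]. apply Hexp.
    assert (Ht : (Z.abs a <= Z.abs m + Z.abs (a - m))%Z) by lia.
    apply IZR_le in Ht. rewrite plus_IZR in Ht.
    pose proof (IZR_le _ _ (Z.abs_nonneg m)). pose proof (IZR_le _ _ (Z.abs_nonneg (a - m))). lra. }
  assert (Hg' : forall a, edecay (C * exp (- IZR (Z.abs a))) (fun m => f m (a - m)%Z)).
  { intros a m. eapply Rle_trans; [apply Hg|]. right; ring. }
  rewrite (bsum_ext (fun m => bsum (f m)) (fun m => bsum (fun a => f m (a - m)%Z))).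
  2:{ intros m. symmetry. apply (bsum_shift (C * exp (- IZR (Z.abs m))) (f m) (- m)), Hf. }
  rewrite (bsum_swap C) by assumption.
  rewrite (bsum_even_odd (C * (2 / (1 - exp (-1))))) by (apply (edecay_bsum C (fun a m => f m (a - m)%Z)), Hg').
  f_equal; apply bsum_ext; intros a.
  - rewrite <- (bsum_shift _ _ a (Hg' (2 * a)%Z)).
    apply bsum_ext. intros b. f_equal; lia.
  - rewrite <- (bsum_shift _ _ (a + 1)%Z (Hg' (2 * a + 1)%Z)).
    apply bsum_ext. intros b. f_equal; lia.
Qed.

(** Quadratic Taylor remainders of the terms add up to a quadratic remainder of the sum. This takes
    the place of uniform convergence of the derived series, which has to converge at [x] alone. *)
Lemma is_derive_bsum (C d : R) (f g : Z -> R -> R) (x : R) :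
  0 < d ->
  (forall y, Rabs (y - x) <= d -> exists C', edecay C' (fun n => f n y)) ->
  (exists C', edecay C' (fun n => g n x)) ->
  (forall y, Rabs y <= d -> edecay (C * y ^ 2) (fun n => f n (x + y) - f n x - y * g n x)) ->
  is_derive (fun z => bsum (fun n => f n z)) x (bsum (fun n => g n x)).
Proof.
  intros Hd Hf [Cg Hg] H. set (B := C * (2 / (1 - exp (-1)))).
  apply is_derive_Reals. intros eps Heps.
  assert (HB : 0 < Rmin d (eps / (Rabs B + 1))).
  { apply Rmin_glb_lt; [assumption|]. apply Rdiv_lt_0_compat; [lra|].
    pose proof (Rabs_pos B); lra. }
  exists (mkposreal _ HB). simpl. intros h Hh0 Hh.
  assert (Hhd : Rabs h <= d) by (eapply Rle_trans; [apply Rlt_le, Hh|apply Rmin_l]).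
  assert (Hhe : Rabs h < eps / (Rabs B + 1)) by (eapply Rlt_le_trans; [apply Hh|apply Rmin_r]).
  pose proof (bsum_Rabs_le _ _ (H h Hhd)) as Hb.
  destruct (Hf (x + h)) as [C1 H1]. { now replace (x + h - x) with h by ring. }
  destruct (Hf x) as [C2 H2]. { rewrite Rminus_diag, Rabs_R0. lra. }
  assert (H12 : edecay (C1 + C2) (fun n => f n (x + h) - f n x)).
  { intros n. specialize (H1 n). specialize (H2 n). unfold Rminus.
    eapply Rle_trans; [apply Rabs_triang|]. rewrite Rabs_Ropp. lra. }
  assert (H3 : edecay (Rabs h * Cg) (fun n => h * g n x)).
  { intros n. rewrite Rabs_mult, Rmult_assoc. apply Rmult_le_compat_l; [apply Rabs_pos|apply Hg]. }
  rewrite (bsum_minus _ _ _ _ H12 H3), (bsum_minus _ _ _ _ H1 H2), bsum_scal in Hb.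
  set (F1 := bsum (fun n => f n (x + h))) in *. set (F0 := bsum (fun n => f n x)) in *.
  set (G := bsum (fun n => g n x)) in *.
  replace ((F1 - F0) / h - G) with ((F1 - F0 - h * G) / h) by (field; assumption).
  unfold Rdiv. rewrite Rabs_mult, Rabs_inv. pose proof (Rabs_pos_lt h Hh0) as Hp.
  apply Rmult_lt_reg_r with (Rabs h); [assumption|].
  rewrite Rmult_assoc, Rinv_l, Rmult_1_r by lra.
  eapply Rle_lt_trans; [apply Hb|].
  replace (C * h ^ 2 * (2 / (1 - exp (-1)))) with (B * Rabs h * Rabs h).
  - apply Rmult_lt_compat_r; [assumption|].
    apply Rle_lt_trans with (Rabs B * Rabs h).
    + apply Rmult_le_compat_r; [lra|apply Rle_abs].
    + pose proof (Rabs_pos B). apply Rle_lt_trans with ((Rabs B + 1) * Rabs h); [nra|].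
      apply Rmult_lt_reg_r with (/ (Rabs B + 1)); [apply Rinv_0_lt_compat; lra|].
      rewrite (Rmult_comm (Rabs B + 1)), Rmult_assoc, Rinv_r by lra. unfold Rdiv in Hhe. lra.
  - unfold B. rewrite <- (pow2_abs h). ring.
Qed.

(** * Theta functions and their products *)

Lemma exp_le (a b : R) : a <= b -> exp a <= exp b.
Proof. intros [Hlt | ->]; [apply Rlt_le, exp_increasing, Hlt | lra]. Qed.

Lemma exp_ge_1_plus (x : R) : 1 + x <= exp x.
Proof. destruct (Req_dec x 0) as [->|H]; [rewrite exp_0; lra | left; now apply exp_ineq1]. Qed.

Lemma sqr_le_exp (w : R) : 0 <= w -> w ^ 2 <= 4 * exp w.
Proof.
  intros Hw. pose proof (exp_ge_1_plus (w / 2)) as H.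
  replace w with (w / 2 + w / 2) at 2 by field. rewrite exp_plus. nra.
Qed.

(** What termwise differentiation asks of the trigonometric factor [f] with derivative [g], in a
    form shared by cos, sin, cosh and sinh. The factor 2 counts the two terms of an addition
    theorem. *)
Record exp_type (f g : R -> R) : Prop := {
  exp_type_fun : forall x, Rabs (f x) <= exp (Rabs x);
  exp_type_der : forall x, Rabs (g x) <= exp (Rabs x);
  exp_type_taylor : forall a b,
    Rabs (f (a + b) - f a - b * g a) <= 2 * b ^ 2 * exp (Rabs a) * exp (Rabs b) }.

(* The nome is [exp (- t)]; the classical theta functions have [h] in {0, 1/2} and [sg] in {1, -1}. *)
Definition gauss (h sg t : R) (n : Z) : R := powerRZ sg n * exp (- (t * (IZR n + h) ^ 2)).

Definition theta_gen (f : R -> R) (h sg t x : R) : R :=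
  bsum (fun n => gauss h sg t n * f (2 * (IZR n + h) * x)).

Definition is_sign (sg : R) : Prop := sg = 1 \/ sg = -1.

Lemma is_sign_sqr (sg : R) : is_sign sg -> sg * sg = 1.
Proof. intros [-> | ->]; ring. Qed.

Lemma is_sign_neq0 (sg : R) : is_sign sg -> sg <> 0.
Proof. intros [-> | ->]; lra. Qed.

Lemma is_sign_mult (a b : R) : is_sign a -> is_sign b -> is_sign (a * b).
Proof. intros [-> | ->] [-> | ->]; unfold is_sign; lra. Qed.

Lemma powerRZ_1_r (x : R) : powerRZ x 1 = x.
Proof. simpl. ring. Qed.

Lemma Rabs_powerRZ_sign (sg : R) (n : Z) : is_sign sg -> Rabs (powerRZ sg n) = 1.
Proof.
  intros H.
  assert (Ha : Rabs sg = 1) by (destruct H as [-> | ->]; [rewrite Rabs_pos_eq|rewrite Rabs_left]; lra).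
  destruct n; simpl; rewrite ?Rabs_inv, <- ?RPow_abs, ?Ha, ?pow1, ?Rabs_R1; lra.
Qed.

Lemma powerRZ_sign_opp (sg : R) (n : Z) : is_sign sg -> powerRZ sg (- n) = powerRZ sg n.
Proof.
  intros H. rewrite powerRZ_neg'.
  assert (Hs : powerRZ sg n * powerRZ sg n = 1).
  { rewrite <- powerRZ_mult, is_sign_sqr by assumption. apply powerRZ_R1. }
  assert (powerRZ sg n <> 0) by (intros E; rewrite E in Hs; lra).
  apply (Rmult_eq_reg_l (powerRZ sg n)); [|assumption]. rewrite Rinv_r, Hs by assumption. reflexivity.
Qed.

Lemma Rabs_gauss (h sg t : R) (n : Z) :
  is_sign sg -> Rabs (gauss h sg t n) = exp (- (t * (IZR n + h) ^ 2)).
Proof.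
  intros H. unfold gauss. rewrite Rabs_mult, Rabs_powerRZ_sign by assumption.
  rewrite Rabs_pos_eq by (left; apply exp_pos). ring.
Qed.

(** Completing the square gives (A + 2) w - t w^2 <= (A + 2)^2 / (4 t) for w = |n + h|. The surplus
    2 w pays for e^(-2|n|) at the price of 2|h|; the rate 2 is the one that [bsum_lattice]
    consumes. *)
Lemma gauss_exp_le (h sg t A : R) (n : Z) :
  is_sign sg -> 0 < t ->
  Rabs (gauss h sg t n) * exp (A * Rabs (IZR n + h)) <=
  exp ((A + 2) ^ 2 / (4 * t) + 2 * Rabs h) * exp (- 2 * IZR (Z.abs n)).
Proof.
  intros Hs Ht. rewrite Rabs_gauss by assumption. rewrite <- !exp_plus. apply exp_le.
  rewrite <- (pow2_abs (IZR n + h)), abs_IZR. set (w := Rabs (IZR n + h)).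
  assert (Hn : Rabs (IZR n) <= w + Rabs h).
  { replace (IZR n) with (IZR n + h + - h) at 1 by ring. rewrite <- (Rabs_Ropp h). apply Rabs_triang. }
  assert (Hsq : 0 <= (2 * t * w - (A + 2)) ^ 2 / (4 * t)).
  { apply Rdiv_le_0_compat; [apply pow2_ge_0|lra]. }
  replace ((2 * t * w - (A + 2)) ^ 2 / (4 * t)) with (t * w ^ 2 - (A + 2) * w + (A + 2) ^ 2 / (4 * t))
    in Hsq by (field; lra).
  lra.
Qed.

Lemma exp_opp2_le_abs (n : Z) : exp (- 2 * IZR (Z.abs n)) <= exp (- IZR (Z.abs n)).
Proof. apply exp_le. pose proof (IZR_le _ _ (Z.abs_nonneg n)). lra. Qed.

Lemma theta_gen_term_le (f : R -> R) (h sg t x : R) (n : Z) :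
  is_sign sg -> 0 < t -> (forall x, Rabs (f x) <= exp (Rabs x)) ->
  Rabs (gauss h sg t n * f (2 * (IZR n + h) * x)) <=
  exp ((2 * Rabs x + 2) ^ 2 / (4 * t) + 2 * Rabs h) * exp (- 2 * IZR (Z.abs n)).
Proof.
  intros Hs Ht Hf. rewrite Rabs_mult.
  eapply Rle_trans; [apply Rmult_le_compat_l; [apply Rabs_pos|apply Hf]|].
  eapply Rle_trans; [|apply (gauss_exp_le h sg t (2 * Rabs x)); assumption].
  right. f_equal. f_equal. rewrite !Rabs_mult, (Rabs_pos_eq 2) by lra. ring.
Qed.

Lemma theta_gen_edecay (f : R -> R) (h sg t x : R) :
  is_sign sg -> 0 < t -> (forall x, Rabs (f x) <= exp (Rabs x)) ->
  edecay (exp ((2 * Rabs x + 2) ^ 2 / (4 * t) + 2 * Rabs h))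
         (fun n => gauss h sg t n * f (2 * (IZR n + h) * x)).
Proof.
  intros Hs Ht Hf n. eapply Rle_trans; [now apply theta_gen_term_le|].
  apply Rmult_le_compat_l; [left; apply exp_pos|apply exp_opp2_le_abs].
Qed.

Lemma is_derive_theta_gen (f g : R -> R) (h sg t x : R) :
  is_sign sg -> 0 < t -> exp_type f g ->
  is_derive (theta_gen f h sg t) x
    (bsum (fun n => gauss h sg t n * (2 * (IZR n + h) * g (2 * (IZR n + h) * x)))).
Proof.
  intros Hs Ht [Hf Hg HT].
  (* With w = |n + h| the remainder is at most 2 b^2 e^|a| e^|b|, where b^2 = 4 y^2 w^2 and w^2 <= 4
     e^w: this is 32 = 2 * 4 * 4. The growth rate 2|x| + 3 collects 2|x| from a, 2 from b since |y|
     <= 1, and 1 from w^2. *)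
  apply (is_derive_bsum (32 * exp ((2 * Rabs x + 3 + 2) ^ 2 / (4 * t) + 2 * Rabs h)) 1
           (fun n z => gauss h sg t n * f (2 * (IZR n + h) * z))
           (fun n z => gauss h sg t n * (2 * (IZR n + h) * g (2 * (IZR n + h) * z)))).
  - lra.
  - intros y _. eexists. now apply theta_gen_edecay.
  - exists (4 * (exp ((2 * Rabs x + 1 + 2) ^ 2 / (4 * t) + 2 * Rabs h))). intros n.
    rewrite !Rabs_mult, (Rabs_pos_eq 2) by lra. set (w := Rabs (IZR n + h)).
    assert (Hw : w <= exp w) by (pose proof (exp_ge_1_plus w); lra).
    pose proof (gauss_exp_le h sg t (2 * Rabs x + 1) n Hs Ht) as HG. fold w in HG.
    pose proof (exp_opp2_le_abs n) as H2.
    specialize (Hg (2 * (IZR n + h) * x)). rewrite !Rabs_mult, (Rabs_pos_eq 2) in Hg by lra. fold w in Hg.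
    replace ((2 * Rabs x + 1) * w) with (2 * w * Rabs x + w) in HG by ring. rewrite exp_plus in HG.
    pose proof (exp_pos (2 * w * Rabs x)) as E1. pose proof (exp_pos w) as E2.
    pose proof (exp_pos ((2 * Rabs x + 1 + 2) ^ 2 / (4 * t) + 2 * Rabs h)) as E3.
    pose proof (Rabs_pos (gauss h sg t n)) as G0.
    assert (W0 : 0 <= w) by apply Rabs_pos.
    pose proof (Rabs_pos (g (2 * (IZR n + h) * x))) as G1.
    apply Rle_trans with (2 * (Rabs (gauss h sg t n) * (exp (2 * w * Rabs x) * exp w))).
    + replace (Rabs (gauss h sg t n) * (2 * w * Rabs (g (2 * (IZR n + h) * x))))
        with (2 * (Rabs (gauss h sg t n) * (Rabs (g (2 * (IZR n + h) * x)) * w))) by ring.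
      apply Rmult_le_compat_l; [lra|]. apply Rmult_le_compat_l; [lra|]. apply Rmult_le_compat; lra.
    + pose proof (exp_pos (- IZR (Z.abs n))) as E4. nra.
  - intros y Hy n. set (b := 2 * (IZR n + h) * y). set (a := 2 * (IZR n + h) * x).
    replace (gauss h sg t n * f (2 * (IZR n + h) * (x + y)) - gauss h sg t n * f a
             - y * (gauss h sg t n * (2 * (IZR n + h) * g a)))
      with (gauss h sg t n * (f (a + b) - f a - b * g a)).
    2:{ unfold a, b. replace (2 * (IZR n + h) * x + 2 * (IZR n + h) * y)
          with (2 * (IZR n + h) * (x + y)) by ring. ring. }
    rewrite Rabs_mult. set (w := Rabs (IZR n + h)).
    assert (W0 : 0 <= w) by apply Rabs_pos.
    assert (Hb : b ^ 2 = 4 * y ^ 2 * w ^ 2) by (unfold b, w; rewrite pow2_abs; ring).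
    assert (Hab : exp (Rabs b) <= exp (2 * w)).
    { apply exp_le. unfold b. rewrite !Rabs_mult, (Rabs_pos_eq 2) by lra. fold w. nra. }
    assert (Haa : Rabs a = 2 * Rabs x * w).
    { unfold a. rewrite !Rabs_mult, (Rabs_pos_eq 2) by lra. fold w. ring. }
    pose proof (sqr_le_exp w W0) as Hww.
    pose proof (gauss_exp_le h sg t (2 * Rabs x + 3) n Hs Ht) as HG. fold w in HG.
    pose proof (exp_opp2_le_abs n) as H2.
    replace ((2 * Rabs x + 3) * w) with (2 * Rabs x * w + (2 * w + w)) in HG by ring.
    rewrite (exp_plus (2 * Rabs x * w)), (exp_plus (2 * w)) in HG.
    pose proof (Rabs_pos (gauss h sg t n)) as G0.
    apply Rle_trans with (Rabs (gauss h sg t n) * (2 * b ^ 2 * exp (Rabs a) * exp (Rabs b))).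
    { apply Rmult_le_compat_l; [assumption|apply HT]. }
    rewrite Hb, Haa.
    apply Rle_trans with (Rabs (gauss h sg t n) *
      (2 * (4 * y ^ 2 * (4 * exp w)) * exp (2 * Rabs x * w) * exp (2 * w))).
    { apply Rmult_le_compat_l; [assumption|].
      pose proof (exp_pos (2 * Rabs x * w)). pose proof (exp_pos (Rabs b)). pose proof (pow2_ge_0 y).
      pose proof (pow2_ge_0 w). pose proof (exp_pos w).
      assert (0 <= 4 * y ^ 2 * w ^ 2) by (apply Rmult_le_pos; lra).
      apply Rmult_le_compat; [|lra| |exact Hab].
      - apply Rmult_le_pos; lra.
      - apply Rmult_le_compat_r; [lra|]. apply Rmult_le_compat_l; [lra|].
        apply Rmult_le_compat_l; lra. }
    pose proof (pow2_ge_0 y) as Hy2.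
    set (E := exp ((2 * Rabs x + 3 + 2) ^ 2 / (4 * t) + 2 * Rabs h)) in *.
    assert (HE : 0 < E) by apply exp_pos.
    replace (Rabs (gauss h sg t n) * (2 * (4 * y ^ 2 * (4 * exp w)) * exp (2 * Rabs x * w) * exp (2 * w)))
      with (32 * y ^ 2 * (Rabs (gauss h sg t n) * (exp (2 * Rabs x * w) * (exp (2 * w) * exp w)))) by ring.
    replace (32 * E * y ^ 2 * exp (- IZR (Z.abs n))) with (32 * y ^ 2 * (E * exp (- IZR (Z.abs n)))) by ring.
    apply Rmult_le_compat_l; [lra|]. nra.
Qed.

(* Common addition theorems of (cos, sin) for [e = 1] and of (cosh, sinh) for [e = -1]; the
   hyperbolic case is a theta function on the imaginary axis, written without complex numbers. *)
Record trig_pair (e : R) (c s : R -> R) : Prop := {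
  trig_sign : is_sign e;
  trig_c_add : forall x y, c (x + y) = c x * c y - e * s x * s y;
  trig_s_add : forall x y, s (x + y) = s x * c y + c x * s y;
  trig_c_opp : forall x, c (- x) = c x;
  trig_s_opp : forall x, s (- x) = - s x;
  trig_c_0 : c 0 = 1;
  trig_c_type : exp_type c (fun x => - e * s x);
  trig_s_type : exp_type s c }.

(** A product of two theta series in which the two phases are joined under one function: the
    addition theorem of [g] turns it into products of thetas, while as a lattice sum it can be
    rotated. *)
Definition theta_pair (g : R -> R) (h sg h' sg' t x y : R) : R :=
  bsum (fun m => bsum (fun n =>
    gauss h sg t m * gauss h' sg' t n * g (2 * (IZR m + h) * x + 2 * (IZR n + h') * y))).

(** For m = a + b, n = a - b one has (m + h)^2 + (n + h')^2 = 2 (a + (h + h')/2)^2 + 2 (b + (h -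
    h')/2)^2, and the phases regroup along x + y and x - y. For m = a + b + 1 both new
    characteristics grow by 1/2 and one factor [sg] comes out. *)
Lemma theta_pair_lattice (g : R -> R) (h sg h' sg' t x y : R) :
  is_sign sg -> is_sign sg' -> 0 < t -> (forall x, Rabs (g x) <= exp (Rabs x)) ->
  theta_pair g h sg h' sg' t x y =
  theta_pair g ((h + h') / 2) (sg * sg') ((h - h') / 2) (sg * sg') (2 * t) (x + y) (x - y) +
  sg * theta_pair g ((h + h' + 1) / 2) (sg * sg') ((h - h' + 1) / 2) (sg * sg') (2 * t) (x + y) (x - y).
Proof.
  intros Hs Hs' Ht Hg. unfold theta_pair.
  rewrite (bsum_lattice (exp ((2 * Rabs x + 2) ^ 2 / (4 * t) + 2 * Rabs h)
                         * exp ((2 * Rabs y + 2) ^ 2 / (4 * t) + 2 * Rabs h'))).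
  - assert (Hpow : forall a b, powerRZ sg (a + b) * powerRZ sg' (a - b)
                      = powerRZ (sg * sg') a * powerRZ (sg * sg') b).
    { intros a b. unfold Z.sub.
      rewrite !powerRZ_add by (now apply is_sign_neq0).
      rewrite powerRZ_sign_opp, !powerRZ_mult by assumption. ring. }
    f_equal; [|rewrite <- bsum_scal]; apply bsum_ext; intros a; [|rewrite <- bsum_scal];
      apply bsum_ext; intros b; unfold gauss.
    + rewrite plus_IZR, minus_IZR. set (A := IZR a). set (B := IZR b).
      transitivity (powerRZ sg (a + b) * powerRZ sg' (a - b) *
        (exp (- (t * (A + B + h) ^ 2)) * exp (- (t * (A - B + h') ^ 2))) *
         g (2 * (A + B + h) * x + 2 * (A - B + h') * y)); [ring|].
      rewrite Hpow, <- exp_plus.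
      transitivity (powerRZ (sg * sg') a * powerRZ (sg * sg') b *
        (exp (- (2 * t * (A + (h + h') / 2) ^ 2)) * exp (- (2 * t * (B + (h - h') / 2) ^ 2))) *
         g (2 * (A + (h + h') / 2) * (x + y) + 2 * (B + (h - h') / 2) * (x - y))); [|ring].
      rewrite <- exp_plus. f_equal; [f_equal|]; f_equal; field.
    + rewrite !plus_IZR, minus_IZR. set (A := IZR a). set (B := IZR b).
      transitivity (powerRZ sg (a + b + 1) * powerRZ sg' (a - b) *
        (exp (- (t * (A + B + 1 + h) ^ 2)) * exp (- (t * (A - B + h') ^ 2))) *
         g (2 * (A + B + 1 + h) * x + 2 * (A - B + h') * y)); [ring|].
      rewrite (powerRZ_add sg (a + b) 1), powerRZ_1_r by (now apply is_sign_neq0).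
      rewrite (Rmult_comm _ sg), (Rmult_assoc sg), Hpow, <- exp_plus.
      transitivity (sg * (powerRZ (sg * sg') a * powerRZ (sg * sg') b) *
        (exp (- (2 * t * (A + (h + h' + 1) / 2) ^ 2)) * exp (- (2 * t * (B + (h - h' + 1) / 2) ^ 2))) *
         g (2 * (A + (h + h' + 1) / 2) * (x + y) + 2 * (B + (h - h' + 1) / 2) * (x - y))); [|ring].
      rewrite <- exp_plus. f_equal; [f_equal|]; f_equal; field.
  - intros m n. rewrite !Rabs_mult.
    pose proof (gauss_exp_le h sg t (2 * Rabs x) m Hs Ht) as H1.
    pose proof (gauss_exp_le h' sg' t (2 * Rabs y) n Hs' Ht) as H2.
    pose proof (Rabs_pos (gauss h sg t m)) as G1. pose proof (Rabs_pos (gauss h' sg' t n)) as G2.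
    pose proof (exp_pos (2 * Rabs x * Rabs (IZR m + h))) as P1.
    pose proof (exp_pos (2 * Rabs y * Rabs (IZR n + h'))) as P2.
    assert (Hgb : Rabs (g (2 * (IZR m + h) * x + 2 * (IZR n + h') * y)) <=
              exp (2 * Rabs x * Rabs (IZR m + h)) * exp (2 * Rabs y * Rabs (IZR n + h'))).
    { eapply Rle_trans; [apply Hg|]. rewrite <- exp_plus. apply exp_le.
      eapply Rle_trans; [apply Rabs_triang|]. rewrite !Rabs_mult, (Rabs_pos_eq 2) by lra. lra. }
    apply Rle_trans with ((Rabs (gauss h sg t m) * exp (2 * Rabs x * Rabs (IZR m + h))) *
      (Rabs (gauss h' sg' t n) * exp (2 * Rabs y * Rabs (IZR n + h')))).
    + rewrite (Rmult_comm (Rabs (gauss h sg t m) * exp _)).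
      apply Rle_trans with (Rabs (gauss h sg t m) * Rabs (gauss h' sg' t n) *
        (exp (2 * Rabs x * Rabs (IZR m + h)) * exp (2 * Rabs y * Rabs (IZR n + h')))); [|right; ring].
      apply Rmult_le_compat_l; [nra|assumption].
    + eapply Rle_trans; [apply Rmult_le_compat; [nra|nra|apply H1|apply H2]|]. right; ring.
Qed.

Lemma theta_pair_split (e : R) (g p q p' q' : R -> R) (h sg h' sg' t x y : R) :
  is_sign sg -> is_sign sg' -> 0 < t ->
  (forall f, f = p \/ f = q \/ f = p' \/ f = q' -> forall z, Rabs (f z) <= exp (Rabs z)) ->
  (forall a b, g (a + b) = p a * q b + e * p' a * q' b) ->
  theta_pair g h sg h' sg' t x y =
  theta_gen p h sg t x * theta_gen q h' sg' t y + e * theta_gen p' h sg t x * theta_gen q' h' sg' t y.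
Proof.
  intros Hs Hs' Ht Hb Hg. unfold theta_pair.
  assert (Hscal : forall C w k, edecay C w -> edecay (Rabs k * C) (fun n => k * w n)).
  { intros C w k Hw n. rewrite Rabs_mult, Rmult_assoc. apply Rmult_le_compat_l; [apply Rabs_pos|apply Hw]. }
  pose (term := fun f h sg x m => gauss h sg t m * f (2 * (IZR m + h) * x)).
  rewrite (bsum_ext _ (fun m => bsum (term q h' sg' y) * term p h sg x m
                                + (e * bsum (term q' h' sg' y)) * term p' h sg x m)).
  - erewrite bsum_plus; [|apply Hscal; apply theta_gen_edecay; auto..].
    rewrite !bsum_scal. unfold theta_gen, term. ring.
  - intros m. rewrite (bsum_ext _ (fun n => term p h sg x m * term q h' sg' y n
                                            + (e * term p' h sg x m) * term q' h' sg' y n)).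
    + erewrite bsum_plus; [|apply Hscal; apply theta_gen_edecay; auto..].
      rewrite !bsum_scal. ring.
    + intros n. rewrite Hg. unfold term. ring.
Qed.

Lemma theta_pair_c (e : R) (c s : R -> R) (h sg h' sg' t x y : R) :
  trig_pair e c s -> is_sign sg -> is_sign sg' -> 0 < t ->
  theta_pair c h sg h' sg' t x y =
  theta_gen c h sg t x * theta_gen c h' sg' t y - e * theta_gen s h sg t x * theta_gen s h' sg' t y.
Proof.
  intros H Hs Hs' Ht. pose proof (exp_type_fun _ _ (trig_c_type _ _ _ H)).
  pose proof (exp_type_fun _ _ (trig_s_type _ _ _ H)).
  rewrite (theta_pair_split (- e) c c c s s); [ring|assumption..| |].
  - now intros f [-> | [-> | [-> | ->]]].
  - intros a b. rewrite (trig_c_add _ _ _ H). ring.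
Qed.

Lemma theta_pair_s (e : R) (c s : R -> R) (h sg h' sg' t x y : R) :
  trig_pair e c s -> is_sign sg -> is_sign sg' -> 0 < t ->
  theta_pair s h sg h' sg' t x y =
  theta_gen s h sg t x * theta_gen c h' sg' t y + theta_gen c h sg t x * theta_gen s h' sg' t y.
Proof.
  intros H Hs Hs' Ht. pose proof (exp_type_fun _ _ (trig_c_type _ _ _ H)).
  pose proof (exp_type_fun _ _ (trig_s_type _ _ _ H)).
  rewrite (theta_pair_split 1 s s c c s); [ring|assumption..| |].
  - now intros f [-> | [-> | [-> | ->]]].
  - intros a b. rewrite (trig_s_add _ _ _ H). ring.
Qed.

Lemma gauss_opp (sg t : R) (n : Z) : is_sign sg -> gauss 0 sg t (- n) = gauss 0 sg t n.
Proof.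
  intros H. unfold gauss. rewrite powerRZ_sign_opp, opp_IZR by assumption. f_equal. f_equal. ring.
Qed.

Lemma gauss_half_opp (sg t : R) (n : Z) :
  is_sign sg -> gauss (1 / 2) sg t (- n - 1) = sg * gauss (1 / 2) sg t n.
Proof.
  intros H. unfold gauss.
  replace (- n - 1)%Z with (- (n + 1))%Z by ring.
  rewrite powerRZ_sign_opp, powerRZ_add, powerRZ_1_r, opp_IZR, plus_IZR
    by (assumption || now apply is_sign_neq0).
  rewrite (Rmult_comm (powerRZ sg n)), Rmult_assoc. do 3 f_equal. field.
Qed.

(* Reflection [n -> -n-2h] for the characteristics [h = 0, 1/2]. *)
Lemma theta_gen_opp (f : R -> R) (sg t x : R) :
  is_sign sg -> 0 < t -> (forall x, Rabs (f x) <= exp (Rabs x)) ->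
  theta_gen f 0 sg t x = theta_gen (fun z => f (- z)) 0 sg t x /\
  theta_gen f (1 / 2) sg t x = sg * theta_gen (fun z => f (- z)) (1 / 2) sg t x.
Proof.
  intros Hs Ht Hf. split.
  - unfold theta_gen at 1. rewrite <- (bsum_opp _ _ (theta_gen_edecay f 0 sg t x Hs Ht Hf)).
    apply bsum_ext. intros n. rewrite gauss_opp, opp_IZR by assumption. do 2 f_equal. ring.
  - unfold theta_gen. pose proof (theta_gen_edecay f (1 / 2) sg t x Hs Ht Hf) as Hd.
    rewrite <- (bsum_opp _ _ Hd), <- bsum_scal.
    erewrite <- (bsum_shift _ _ 1); [|apply (edecay_comp _ _ (fun n => (- n)%Z) 0 Hd); intros; lia].
    apply bsum_ext. intros n. cbv beta. replace (- (n + 1))%Z with (- n - 1)%Z by ring.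
    rewrite gauss_half_opp, minus_IZR, opp_IZR, <- Rmult_assoc by assumption. do 2 f_equal. field.
Qed.

Lemma theta_gen_succ (f : R -> R) (h sg t x : R) :
  is_sign sg -> 0 < t -> (forall x, Rabs (f x) <= exp (Rabs x)) ->
  theta_gen f (h + 1) sg t x = sg * theta_gen f h sg t x.
Proof.
  intros Hs Ht Hf. unfold theta_gen.
  rewrite <- (bsum_shift _ _ 1 (theta_gen_edecay f h sg t x Hs Ht Hf)), <- bsum_scal.
  apply bsum_ext. intros n. unfold gauss.
  rewrite powerRZ_add, powerRZ_1_r, plus_IZR by (now apply is_sign_neq0).
  replace (IZR n + 1 + h) with (IZR n + (h + 1)) by ring.
  transitivity (sg * sg * (powerRZ sg n * exp (- (t * (IZR n + (h + 1)) ^ 2)) *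
    f (2 * (IZR n + (h + 1)) * x))); [|ring].
  rewrite is_sign_sqr by assumption. ring.
Qed.

Lemma theta_gen_opp_x (f : R -> R) (h sg t x : R) :
  theta_gen f h sg t (- x) = theta_gen (fun z => f (- z)) h sg t x.
Proof. apply bsum_ext. intros n. do 2 f_equal. ring. Qed.

Definition theta1 (s : R -> R) : R -> R -> R := theta_gen s (1 / 2) (-1).
Definition theta2 (c : R -> R) : R -> R -> R := theta_gen c (1 / 2) 1.
Definition theta3 (c : R -> R) : R -> R -> R := theta_gen c 0 1.
Definition theta4 (c : R -> R) : R -> R -> R := theta_gen c 0 (-1).

Lemma is_sign_1 : is_sign 1. Proof. now left. Qed.
Lemma is_sign_m1 : is_sign (-1). Proof. now right. Qed.

Lemma theta_gen_ext (f g : R -> R) (h sg t x : R) :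
  (forall z, f z = g z) -> theta_gen f h sg t x = theta_gen g h sg t x.
Proof. intros H. apply bsum_ext. intros n. now rewrite H. Qed.

Lemma theta_gen_fun_opp (f : R -> R) (h sg t x : R) :
  theta_gen (fun z => - f z) h sg t x = - theta_gen f h sg t x.
Proof.
  unfold theta_gen. rewrite <- (Rmult_1_l (bsum _)) at 1.
  replace (- bsum (fun n => gauss h sg t n * f (2 * (IZR n + h) * x)))
    with (-1 * bsum (fun n => gauss h sg t n * f (2 * (IZR n + h) * x))) by ring.
  rewrite Rmult_1_l, <- bsum_scal. apply bsum_ext. intros n. ring.
Qed.

(** Reflecting the summation index multiplies each of these sums by -1. Their vanishing removes the
    mixed terms from the product formulas. *)
Lemma theta_gen_zero (e : R) (c s : R -> R) (t x : R) :
  trig_pair e c s -> 0 < t ->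
  theta_gen s 0 1 t x = 0 /\ theta_gen s 0 (-1) t x = 0 /\
  theta_gen s (1 / 2) 1 t x = 0 /\ theta_gen c (1 / 2) (-1) t x = 0.
Proof.
  intros H Ht.
  pose proof (exp_type_fun _ _ (trig_c_type _ _ _ H)) as Hc.
  pose proof (exp_type_fun _ _ (trig_s_type _ _ _ H)) as Hs.
  destruct (theta_gen_opp s 1 t x is_sign_1 Ht Hs) as [E1 E2].
  destruct (theta_gen_opp s (-1) t x is_sign_m1 Ht Hs) as [E3 _].
  destruct (theta_gen_opp c (-1) t x is_sign_m1 Ht Hc) as [_ E4].
  rewrite (theta_gen_ext _ (fun z => - s z) _ _ _ _ (trig_s_opp _ _ _ H)), theta_gen_fun_opp in E1.
  rewrite (theta_gen_ext _ (fun z => - s z) _ _ _ _ (trig_s_opp _ _ _ H)), theta_gen_fun_opp in E2.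
  rewrite (theta_gen_ext _ (fun z => - s z) _ _ _ _ (trig_s_opp _ _ _ H)), theta_gen_fun_opp in E3.
  rewrite (theta_gen_ext _ c _ _ _ _ (trig_c_opp _ _ _ H)) in E4.
  lra.
Qed.

Lemma theta_even (e : R) (c s : R -> R) (t x : R) :
  trig_pair e c s ->
  theta2 c t (- x) = theta2 c t x /\ theta3 c t (- x) = theta3 c t x /\
  theta4 c t (- x) = theta4 c t x /\ theta1 s t (- x) = - theta1 s t x.
Proof.
  intros H. unfold theta1, theta2, theta3, theta4. rewrite !theta_gen_opp_x.
  rewrite !(theta_gen_ext _ c _ _ _ _ (trig_c_opp _ _ _ H)).
  rewrite (theta_gen_ext _ (fun z => - s z) _ _ _ _ (trig_s_opp _ _ _ H)), theta_gen_fun_opp.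
  auto.
Qed.

Lemma theta1_0 (e : R) (c s : R -> R) (t : R) : trig_pair e c s -> theta1 s t 0 = 0.
Proof.
  intros H. destruct (theta_even e c s t 0 H) as [_ [_ [_ E]]].
  rewrite Ropp_0 in E. lra.
Qed.

(** Six instances of [theta_pair_lattice]. The characteristic 1 produced by h = h' = 1/2 is brought
    back to 0 by [theta_gen_succ]. *)
Lemma theta_products (e : R) (c s : R -> R) (t x y : R) :
  trig_pair e c s -> 0 < t ->
  let X1 := theta1 s (2 * t) (x + y) in let Y1 := theta1 s (2 * t) (x - y) in
  let X2 := theta2 c (2 * t) (x + y) in let Y2 := theta2 c (2 * t) (x - y) in
  let X3 := theta3 c (2 * t) (x + y) in let Y3 := theta3 c (2 * t) (x - y) in
  let X4 := theta4 c (2 * t) (x + y) in let Y4 := theta4 c (2 * t) (x - y) in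
  theta3 c t x * theta3 c t y = X3 * Y3 + X2 * Y2 /\
  theta4 c t x * theta4 c t y = X3 * Y3 - X2 * Y2 /\
  theta2 c t x * theta2 c t y = X2 * Y3 + X3 * Y2 /\
  e * theta1 s t x * theta1 s t y = X3 * Y2 - X2 * Y3 /\
  theta1 s t x * theta2 c t y = X1 * Y4 + X4 * Y1 /\
  theta3 c t x * theta4 c t y = X4 * Y4 - e * X1 * Y1.
Proof.
  intros H Ht. cbv zeta. unfold theta1, theta2, theta3, theta4.
  pose proof (exp_type_fun _ _ (trig_c_type _ _ _ H)) as Hc.
  pose proof (exp_type_fun _ _ (trig_s_type _ _ _ H)) as Hs.
  assert (Ht2 : 0 < 2 * t) by lra.
  pose proof is_sign_1 as S1. pose proof is_sign_m1 as S2.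
  destruct (theta_gen_zero e c s t x H Ht) as [Z1 [Z2 [Z3 Z4]]].
  destruct (theta_gen_zero e c s t y H Ht) as [Z1' [Z2' [Z3' Z4']]].
  destruct (theta_gen_zero e c s (2 * t) (x + y) H Ht2) as [A1 [A2 [A3 A4]]].
  destruct (theta_gen_zero e c s (2 * t) (x - y) H Ht2) as [B1 [B2 [B3 B4]]].
  assert (Hsucc : forall f sg z, is_sign sg -> (forall x, Rabs (f x) <= exp (Rabs x)) ->
    theta_gen f 1 sg (2 * t) z = sg * theta_gen f 0 sg (2 * t) z).
  { intros f sg z Hsg Hf. rewrite <- theta_gen_succ by assumption. f_equal. ring. }
  pose proof (fun h sg h' sg' Hs Hs' => eq_trans (eq_sym (theta_pair_c e c s h sg h' sg' t x y H Hs Hs' Ht))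
    (theta_pair_lattice c h sg h' sg' t x y Hs Hs' Ht Hc)) as PC.
  pose proof (fun h sg h' sg' Hs1 Hs1' => eq_trans (eq_sym (theta_pair_s e c s h sg h' sg' t x y H Hs1 Hs1' Ht))
    (theta_pair_lattice s h sg h' sg' t x y Hs1 Hs1' Ht Hs)) as PS.
  assert (T11 : is_sign (1 * 1)) by now apply is_sign_mult.
  assert (T12 : is_sign (1 * -1)) by now apply is_sign_mult.
  assert (T21 : is_sign (-1 * 1)) by now apply is_sign_mult.
  assert (T22 : is_sign (-1 * -1)) by now apply is_sign_mult.
  pose proof (PC 0 1 0 1 S1 S1) as P33.
  pose proof (PC 0 (-1) 0 (-1) S2 S2) as P44.
  pose proof (PC (1/2) 1 (1/2) 1 S1 S1) as P22.
  pose proof (PC (1/2) (-1) (1/2) (-1) S2 S2) as P11.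
  pose proof (PS (1/2) (-1) (1/2) 1 S2 S1) as P12.
  pose proof (PC 0 1 0 (-1) S1 S2) as P34.
  rewrite !(theta_pair_c e c s) in P33, P44, P22, P11, P34 by assumption.
  rewrite !(theta_pair_s e c s) in P12 by assumption.
  replace ((0 + 0) / 2) with 0 in * by field. replace ((0 - 0) / 2) with 0 in * by field.
  replace ((0 + 0 + 1) / 2) with (1 / 2) in * by field.
  replace ((0 - 0 + 1) / 2) with (1 / 2) in * by field.
  replace ((1 / 2 + 1 / 2) / 2) with (1 / 2) in * by field.
  replace ((1 / 2 - 1 / 2) / 2) with 0 in * by field.
  replace ((1 / 2 + 1 / 2 + 1) / 2) with 1 in * by field.
  replace ((1 / 2 - 1 / 2 + 1) / 2) with (1 / 2) in * by field.
  replace (1 * 1) with 1 in * by ring. replace (-1 * -1) with 1 in * by ring.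
  replace (1 * -1) with (-1) in * by ring. replace (-1 * 1) with (-1) in * by ring.
  let simpl_hyp P := rewrite ?Hsucc, ?Z1, ?Z2, ?Z3, ?Z4, ?Z1', ?Z2', ?Z3', ?Z4',
    ?A1, ?A2, ?A3, ?A4, ?B1, ?B2, ?B3, ?B4 in P by assumption in
  simpl_hyp P33; simpl_hyp P44; simpl_hyp P22; simpl_hyp P11; simpl_hyp P12; simpl_hyp P34.
  repeat split; lra.
Qed.

(** * Circular and hyperbolic functions *)

Lemma is_derive_bound (f df : R -> R) (b M : R) :
  (forall x, is_derive f x (df x)) -> (forall x, Rabs x <= Rabs b -> Rabs (df x) <= M) ->
  Rabs (f b - f 0) <= M * Rabs b.
Proof.
  intros Hd HM. destruct (MVT_gen f 0 b df) as [x [Hx E]].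
  - intros x _. apply Hd.
  - intros x _. apply continuity_pt_filterlim. apply (ex_derive_continuous (V := R_NormedModule)). eexists; apply Hd.
  - rewrite E, Rminus_0_r, Rabs_mult. apply Rmult_le_compat_r; [apply Rabs_pos|]. apply HM.
    unfold Rmin, Rmax, Rabs in *. destruct (Rle_dec 0 b); repeat destruct Rcase_abs; lra.
Qed.

(** By the addition theorems a Taylor remainder at [a] is a combination of c b - 1 and s b - b with
    coefficients bounded by e^|a|, so estimates at the origin suffice. *)
Lemma trig_pair_intro (e : R) (c s : R -> R) :
  is_sign e ->
  (forall x y, c (x + y) = c x * c y - e * s x * s y) ->
  (forall x y, s (x + y) = s x * c y + c x * s y) ->
  (forall x, c (- x) = c x) -> (forall x, s (- x) = - s x) -> c 0 = 1 ->
  (forall x, is_derive c x (- e * s x)) -> (forall x, is_derive s x (c x)) ->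
  (forall x, Rabs (c x) <= exp (Rabs x)) -> (forall x, Rabs (s x) <= exp (Rabs x)) ->
  trig_pair e c s.
Proof.
  intros He Hca Hsa Hco Hso Hc0 Hdc Hds Hbc Hbs.
  assert (He1 : Rabs e = 1) by (destruct He as [-> | ->]; [rewrite Rabs_pos_eq|rewrite Rabs_left]; lra).
  assert (Hes : forall x, Rabs (- e * s x) = Rabs (s x)).
  { intros x. rewrite Rabs_mult, Rabs_Ropp, He1. ring. }
  assert (Hs0 : s 0 = 0). { specialize (Hso 0). rewrite Ropp_0 in Hso. lra. }
  assert (Hmono : forall x b, Rabs x <= Rabs b -> exp (Rabs x) <= exp (Rabs b)) by (intros; now apply exp_le).
  assert (Hs1 : forall b, Rabs (s b) <= Rabs b * exp (Rabs b)).
  { intros b. rewrite <- (Rminus_0_r (s b)), <- Hs0, Rmult_comm.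
    apply (is_derive_bound _ c); [assumption|]. intros x Hx. eapply Rle_trans; [apply Hbc|auto]. }
  assert (Hc1 : forall b, Rabs (c b - 1) <= b ^ 2 * exp (Rabs b)).
  { intros b. rewrite <- Hc0. replace (b ^ 2 * exp (Rabs b)) with (Rabs b * exp (Rabs b) * Rabs b).
    - apply (is_derive_bound _ (fun x => - e * s x)); [assumption|]. intros x Hx. rewrite Hes.
      eapply Rle_trans; [apply Hs1|]. pose proof (Hmono _ _ Hx). pose proof (exp_pos (Rabs x)).
      pose proof (Rabs_pos x). apply Rmult_le_compat; lra.
    - rewrite <- pow2_abs. ring. }
  assert (Hs2 : forall b, Rabs (s b - b) <= b ^ 2 * exp (Rabs b)).
  { intros b. replace (s b - b) with ((s b - b) - (s 0 - 0)) by (rewrite Hs0; ring).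
    replace (b ^ 2 * exp (Rabs b)) with (Rabs b * exp (Rabs b) * Rabs b) by (rewrite <- pow2_abs; ring).
    apply (is_derive_bound (fun x => s x - x) (fun x => c x - 1)).
    - intros x. apply (is_derive_minus s (fun z => z) x (c x) 1); [apply Hds|auto_derive; [trivial|ring]].
    - intros x Hx. rewrite <- Hc0.
      eapply Rle_trans; [apply (is_derive_bound c (fun x => - e * s x) x (exp (Rabs b)))|].
      + assumption.
      + intros y Hy. rewrite Hes. eapply Rle_trans; [apply Hbs|]. apply Hmono. lra.
      + pose proof (exp_pos (Rabs b)). nra. }
  assert (Hcomb : forall f g a b, Rabs f <= exp (Rabs a) -> Rabs g <= exp (Rabs a) ->
    Rabs (f * (c b - 1) + g * (s b - b)) <= 2 * b ^ 2 * exp (Rabs a) * exp (Rabs b)).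
  { intros f g a b Hf Hg. eapply Rle_trans; [apply Rabs_triang|]. rewrite !Rabs_mult.
    specialize (Hc1 b). specialize (Hs2 b).
    pose proof (Rabs_pos f). pose proof (Rabs_pos g).
    pose proof (Rabs_pos (c b - 1)). pose proof (Rabs_pos (s b - b)).
    apply Rle_trans with (exp (Rabs a) * (b ^ 2 * exp (Rabs b)) + exp (Rabs a) * (b ^ 2 * exp (Rabs b))).
    - apply Rplus_le_compat; apply Rmult_le_compat; assumption.
    - right; ring. }
  split; try assumption; split; try assumption.
  - intros x. rewrite Hes. apply Hbs.
  - intros a b. rewrite Hca.
    replace (c a * c b - e * s a * s b - c a - b * (- e * s a))
      with (c a * (c b - 1) + (- e * s a) * (s b - b)) by ring.
    apply Hcomb; [apply Hbc | rewrite Hes; apply Hbs].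
  - intros a b. rewrite Hsa.
    replace (s a * c b + c a * s b - s a - b * c a)
      with (s a * (c b - 1) + c a * (s b - b)) by ring.
    apply Hcomb; [apply Hbs | apply Hbc].
Qed.

Lemma trig_pair_circular : trig_pair 1 cos sin.
Proof.
  assert (H1 : forall x, 1 <= exp (Rabs x)).
  { intros x. pose proof (exp_ge_1_plus (Rabs x)). pose proof (Rabs_pos x). lra. }
  apply trig_pair_intro.
  - apply is_sign_1.
  - intros x y. rewrite cos_plus. ring.
  - intros x y. apply sin_plus.
  - apply cos_neg.
  - apply sin_neg.
  - apply cos_0.
  - intros x. replace (- (1) * sin x) with (- sin x) by ring. apply is_derive_cos.
  - apply is_derive_sin.
  - intros x. eapply Rle_trans; [|apply H1]. apply Rabs_le, COS_bound.
  - intros x. eapply Rle_trans; [|apply H1]. apply Rabs_le, SIN_bound.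
Qed.

Lemma trig_pair_hyperbolic : trig_pair (-1) cosh sinh.
Proof.
  assert (H1 : forall x, exp x <= exp (Rabs x) /\ exp (- x) <= exp (Rabs x)).
  { intros x. split; apply exp_le; [apply Rle_abs|rewrite <- Rabs_Ropp; apply Rle_abs]. }
  apply trig_pair_intro.
  - apply is_sign_m1.
  - intros x y. unfold cosh, sinh. rewrite Ropp_plus_distr, !exp_plus. field.
  - intros x y. unfold cosh, sinh. rewrite Ropp_plus_distr, !exp_plus. field.
  - intros x. unfold cosh. rewrite Ropp_involutive. field.
  - intros x. unfold sinh. rewrite Ropp_involutive. field.
  - apply cosh_0.
  - intros x. replace (- -1 * sinh x) with (sinh x) by ring.
    apply is_derive_Reals, derivable_pt_lim_cosh.
  - intros x. apply is_derive_Reals, derivable_pt_lim_sinh.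
  - intros x. specialize (H1 x). pose proof (exp_pos x). pose proof (exp_pos (- x)).
    unfold cosh. apply Rabs_le. lra.
  - intros x. specialize (H1 x). pose proof (exp_pos x). pose proof (exp_pos (- x)).
    unfold sinh. apply Rabs_le. lra.
Qed.

(** * Theta constants, addition theorem and Wronskian *)

Definition nul2 (t : R) : R := theta2 cos t 0.
Definition nul3 (t : R) : R := theta3 cos t 0.
Definition nul4 (t : R) : R := theta4 cos t 0.
(** The derivative of theta1 at 0. Its value is the same for sin and for sinh, which is why real and
    imaginary arguments are run through with one speed. *)
Definition nul1' (t : R) : R := bsum (fun n => gauss (1 / 2) (-1) t n * (2 * (IZR n + 1 / 2))).

Lemma theta_null (e : R) (c s : R -> R) (t : R) :
  trig_pair e c s -> theta2 c t 0 = nul2 t /\ theta3 c t 0 = nul3 t /\ theta4 c t 0 = nul4 t.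
Proof.
  intros H.
  assert (Hg : forall h sg, theta_gen c h sg t 0 = theta_gen cos h sg t 0).
  { intros h sg. apply bsum_ext. intros n. now rewrite Rmult_0_r, cos_0, (trig_c_0 _ _ _ H). }
  repeat split; apply Hg.
Qed.

Lemma ex_derive_theta (e : R) (c s : R -> R) (t x : R) :
  trig_pair e c s -> 0 < t ->
  ex_derive (theta1 s t) x /\ ex_derive (theta2 c t) x /\
  ex_derive (theta3 c t) x /\ ex_derive (theta4 c t) x.
Proof.
  intros H Ht. pose proof (trig_c_type _ _ _ H) as Hc. pose proof (trig_s_type _ _ _ H) as Hs.
  repeat split; eexists; eapply is_derive_theta_gen; eauto using is_sign_1, is_sign_m1.
Qed.

Lemma is_derive_theta1_0 (e : R) (c s : R -> R) (t : R) :
  trig_pair e c s -> 0 < t -> is_derive (theta1 s t) 0 (nul1' t).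
Proof.
  intros H Ht.
  replace (nul1' t) with
    (bsum (fun n => gauss (1 / 2) (-1) t n * (2 * (IZR n + 1 / 2) * c (2 * (IZR n + 1 / 2) * 0)))).
  - apply is_derive_theta_gen; [apply is_sign_m1|assumption|apply (trig_s_type _ _ _ H)].
  - apply bsum_ext. intros n. rewrite Rmult_0_r, (trig_c_0 _ _ _ H). ring.
Qed.

(** The product formulas at x = y = 0: a step of the arithmetic-geometric mean for the squares of
    the theta constants. *)
Lemma nul_products (t : R) : 0 < t ->
  nul3 t ^ 2 = nul3 (2 * t) ^ 2 + nul2 (2 * t) ^ 2 /\
  nul4 t ^ 2 = nul3 (2 * t) ^ 2 - nul2 (2 * t) ^ 2 /\
  nul2 t ^ 2 = 2 * nul2 (2 * t) * nul3 (2 * t) /\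
  nul3 t * nul4 t = nul4 (2 * t) ^ 2.
Proof.
  intros Ht. pose proof (theta_products 1 cos sin t 0 0 trig_pair_circular Ht) as P. cbv zeta in P.
  rewrite Rplus_0_r, Rminus_diag in P.
  rewrite (theta1_0 _ _ _ (2 * t) trig_pair_circular) in P.
  fold (nul2 t) (nul3 t) (nul4 t) (nul2 (2 * t)) (nul3 (2 * t)) (nul4 (2 * t)) in P.
  simpl. repeat split; lra.
Qed.

(** Elimination through the nome q^2: theta4(x)^2 and theta2(x)^2 are linear in theta2(2x),
    theta3(2x) of nome q^2, and theta3(x+y) theta3(x-y) is bilinear in these and their values at
    2y. *)
Lemma theta_addition (e : R) (c s : R -> R) (t x y : R) :
  trig_pair e c s -> 0 < t ->
  nul3 t ^ 2 * (theta3 c t (x + y) * theta3 c t (x - y)) =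
  theta4 c t x ^ 2 * theta4 c t y ^ 2 + theta2 c t x ^ 2 * theta2 c t y ^ 2.
Proof.
  intros H Ht. assert (Ht2 : 0 < 2 * t) by lra.
  destruct (theta_products e c s t x x H Ht) as [_ [X4 [X2 _]]].
  destruct (theta_products e c s t y y H Ht) as [_ [Y4 [Y2 _]]].
  destruct (theta_products e c s t (x + y) (x - y) H Ht) as [P _].
  destruct (theta_null e c s (2 * t) H) as [N2 [N3 _]].
  destruct (nul_products t Ht) as [Q _].
  rewrite Rminus_diag, N2, N3 in X4, X2, Y4, Y2.
  replace (x + y + (x - y)) with (x + x) in P by ring.
  replace (x + y - (x - y)) with (y + y) in P by ring.
  rewrite P, Q. simpl (theta4 c t x ^ 2). simpl. rewrite !Rmult_1_r, X4, X2, Y4, Y2. ring.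
Qed.

(** The same elimination as in [theta_addition]. For e = 1 this becomes sn^2 + cn^2 = 1 after
    division. *)
Lemma theta_pythagoras_S (e : R) (c s : R -> R) (t x : R) :
  trig_pair e c s -> 0 < t ->
  e * nul3 t ^ 2 * theta1 s t x ^ 2 + nul4 t ^ 2 * theta2 c t x ^ 2 = nul2 t ^ 2 * theta4 c t x ^ 2.
Proof.
  intros H Ht. assert (Ht2 : 0 < 2 * t) by lra.
  destruct (theta_products e c s t x x H Ht) as [_ [X4 [X2 [X1 _]]]].
  destruct (theta_null e c s (2 * t) H) as [N2 [N3 _]].
  destruct (nul_products t Ht) as [Q3 [Q4 [Q2 _]]].
  rewrite Rminus_diag, N2, N3 in X4, X2, X1.
  rewrite Q3, Q4, Q2.
  transitivity ((nul3 (2 * t) ^ 2 + nul2 (2 * t) ^ 2) * (e * theta1 s t x * theta1 s t x)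
    + (nul3 (2 * t) ^ 2 - nul2 (2 * t) ^ 2) * (theta2 c t x * theta2 c t x)); [ring|].
  replace (theta4 c t x ^ 2) with (theta4 c t x * theta4 c t x) by ring.
  rewrite X1, X2, X4. ring.
Qed.

Lemma theta_pythagoras_D (e : R) (c s : R -> R) (t x : R) :
  trig_pair e c s -> 0 < t ->
  nul3 t ^ 2 * theta3 c t x ^ 2 = nul4 t ^ 2 * theta4 c t x ^ 2 + nul2 t ^ 2 * theta2 c t x ^ 2.
Proof.
  intros H Ht. pose proof (theta_addition e c s t x 0 H Ht) as P.
  destruct (theta_null e c s t H) as [N2 [N3 N4]].
  rewrite Rplus_0_r, Rminus_0_r, N2, N4 in P. lra.
Qed.

(** Both sides are multiples of theta4(2x) of nome q^2. For the left side, differentiate the product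
    formula of theta1(x+y) theta2(x-y) along y at y = 0, where the even function theta4 has
    derivative 0; the constant is read off at x = 0. *)
Lemma theta_wronskian (e : R) (c s : R -> R) (t x : R) :
  trig_pair e c s -> 0 < t -> nul3 t <> 0 -> nul4 t <> 0 ->
  nul3 t * nul4 t * (Derive (theta1 s t) x * theta2 c t x - theta1 s t x * Derive (theta2 c t) x)
  = nul1' t * nul2 t * (theta3 c t x * theta4 c t x).
Proof.
  intros H Ht H3 H4. assert (Ht2 : 0 < 2 * t) by lra.
  set (L := Derive (theta1 s (2 * t)) 0).
  destruct (nul_products t Ht) as [_ [_ [_ N34]]].
  destruct (theta_null e c s t H) as [N2 [N3 N4]].
  destruct (theta_null e c s (2 * t) H) as [_ [_ N4']].
  assert (HW : forall x, Derive (theta1 s t) x * theta2 c t x - theta1 s t x * Derive (theta2 c t) x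
                  = 2 * L * theta4 c (2 * t) (x + x)).
  { intros z. destruct (ex_derive_theta e c s t z H Ht) as [[d1 D1] [[d2 D2] _]].
    destruct (ex_derive_theta e c s (2 * t) 0 H Ht2) as [[e1 E1] [_ [_ [e4 E4]]]].
    assert (He4 : e4 = 0).
    { assert (E4' : is_derive (theta4 c (2 * t)) 0 (- e4)).
      { apply (is_derive_ext (fun y => theta4 c (2 * t) (- y))).
        - intros y. apply (theta_even e c s (2 * t) y H).
        - replace (- e4) with (scal (-1) e4) by (unfold scal; simpl; unfold mult; simpl; ring).
          apply (is_derive_comp (theta4 c (2 * t)) Ropp 0 e4 (-1)).
          + now rewrite Ropp_0.
          + auto_derive; [trivial|ring]. }
      apply is_derive_unique in E4'. apply is_derive_unique in E4. lra. }
    unfold L. rewrite (is_derive_unique _ _ _ D1), (is_derive_unique _ _ _ D2), (is_derive_unique _ _ _ E1).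
    set (F := fun y => theta1 s t (z + y) * theta2 c t (z - y)).
    assert (F1 : is_derive F 0 (d1 * theta2 c t z - theta1 s t z * d2)).
    { unfold F. auto_derive.
      - rewrite Ropp_0, !Rplus_0_r. repeat split; [now exists d1|now exists d2].
      - rewrite Ropp_0, !Rplus_0_r.
        change (Derive (fun x => theta1 s t x) z) with (Derive (theta1 s t) z).
        change (Derive (fun x => theta2 c t x) z) with (Derive (theta2 c t) z).
        rewrite (is_derive_unique _ _ _ D1), (is_derive_unique _ _ _ D2). ring. }
    assert (F2 : is_derive F 0 (2 * e1 * theta4 c (2 * t) (z + z))).
    { apply (is_derive_ext (fun y => theta1 s (2 * t) (z + z) * theta4 c (2 * t) (2 * y)
                                 + theta4 c (2 * t) (z + z) * theta1 s (2 * t) (2 * y))).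
      - intros y. unfold F. destruct (theta_products e c s t (z + y) (z - y) H Ht) as [_ [_ [_ [_ [P _]]]]].
        rewrite P. replace (z + y + (z - y)) with (z + z) by ring.
        replace (z + y - (z - y)) with (2 * y) by ring. reflexivity.
      - auto_derive.
        + rewrite Rmult_0_r. repeat split; [now exists e4|now exists e1].
        + rewrite Rmult_0_r.
          change (Derive (fun x => theta1 s (2 * t) x) 0) with (Derive (theta1 s (2 * t)) 0).
          change (Derive (fun x => theta4 c (2 * t) x) 0) with (Derive (theta4 c (2 * t)) 0).
          rewrite (is_derive_unique _ _ _ E1), (is_derive_unique _ _ _ E4), He4. ring. }
    rewrite <- (is_derive_unique _ _ _ F1), <- (is_derive_unique _ _ _ F2). reflexivity. }
  assert (H34 : forall x, theta3 c t x * theta4 c t x = theta4 c (2 * t) (x + x) * nul4 (2 * t)).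
  { intros z. destruct (theta_products e c s t z z H Ht) as [_ [_ [_ [_ [_ P]]]]].
    rewrite P, Rminus_diag, (theta1_0 e c s), N4' by assumption. ring. }
  assert (W0 : nul1' t * nul2 t = 2 * L * nul4 (2 * t)).
  { specialize (HW 0).
    rewrite (is_derive_unique _ _ _ (is_derive_theta1_0 e c s t H Ht)), N2, Rplus_0_r, N4' in HW.
    rewrite (theta1_0 e c s t H) in HW. lra. }
  rewrite HW, H34, W0, N34. ring.
Qed.

(** * Zeros of theta functions *)

Lemma exp_opp_le_inv (x : R) : 0 <= x -> exp (- x) <= / (1 + x).
Proof.
  intros Hx. rewrite exp_Ropp. apply Rinv_le_contravar; [lra|apply exp_ge_1_plus].
Qed.

Lemma Series_eq0 (a : nat -> R) : (forall n, a n = 0) -> Series a = 0.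
Proof.
  intros H. rewrite (Series_ext a (fun n => 0 * a n)) by (intros n; rewrite H; ring).
  rewrite Series_scal_l. ring.
Qed.

(** For t >= 10 one has (2n+3) e^(-t(n+1)) <= e^(2n+2-10(n+1)) <= e^(-8-n), so the tail is at most
    2/9 of the head [b]. The weight 2n+3 comes from the bounds relative to the head in
    [Rabs_cos_odd_le] and [one_minus_exp_le]. *)
Lemma dominated_head_pos (a : nat -> R) (b t : R) :
  0 < b -> 10 <= t ->
  (forall n, Rabs (a n) <= (2 * INR n + 3) * exp (- (t * INR (S n))) * b) ->
  0 < b + Series a.
Proof.
  intros Hb Ht H.
  assert (Hg : geometric (exp (-8) * b) a).
  { intros n. eapply Rle_trans; [apply H|].
    replace (exp (-8) * b * exp (-1) ^ n) with (exp (-8) * exp (-1) ^ n * b) by ring.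
    apply Rmult_le_compat_r; [lra|]. rewrite <- exp_opp_INR, <- exp_plus.
    pose proof (pos_INR n) as Hn.
    apply Rle_trans with (exp (2 * INR n + 2) * exp (- (t * INR (S n)))).
    - apply Rmult_le_compat_r; [left; apply exp_pos|].
      pose proof (exp_ge_1_plus (2 * INR n + 2)). lra.
    - rewrite <- exp_plus. apply exp_le. rewrite S_INR. nra. }
  apply geometric_Series_le in Hg.
  assert (H8 : exp (-8) <= 1 / 9).
  { pose proof (exp_opp_le_inv 8 ltac:(lra)) as E. replace (-8) with (- (8)) by lra. lra. }
  assert (H1 : exp (-1) <= 1 / 2).
  { pose proof (exp_opp_le_inv 1 ltac:(lra)) as E. replace (-1) with (- (1)) by lra. lra. }
  assert (H2 : / (1 - exp (-1)) <= 2).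
  { replace 2 with (/ (1 / 2)) by field. apply Rinv_le_contravar; lra. }
  assert (H3 : 0 < / (1 - exp (-1))).
  { apply Rinv_0_lt_compat. pose proof exp_opp1_bounds. lra. }
  pose proof (exp_pos (- 8)).
  assert (exp (-8) * b * / (1 - exp (-1)) <= 1 / 9 * b * 2).
  { apply Rmult_le_compat; try lra; try nra. }
  pose proof (Rle_abs (- Series a)) as Ha. rewrite Rabs_Ropp in Ha. lra.
Qed.

(** A bad point at t yields bad points at 2t, 4t, ..., hence one beyond 10, where the leading term
    of the series dominates. *)
Lemma doubling_descent (Bad : R -> R -> Prop) :
  (forall t x, 0 < t -> Bad t x -> exists x', Bad (2 * t) x') ->
  (forall t x, 10 <= t -> ~ Bad t x) ->
  forall t x, 0 < t -> ~ Bad t x.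
Proof.
  intros Hd Hb.
  assert (Hn : forall n t x, 0 < t -> 10 <= 2 ^ n * t -> ~ Bad t x).
  { induction n as [|n IH]; intros t x Ht H.
    - apply Hb. simpl in H. lra.
    - intros HB. destruct (Hd t x Ht HB) as [x' Hx']. apply (IH (2 * t) x'); [lra| |assumption].
      simpl in H. lra. }
  intros t x Ht. destruct (INR_unbounded (10 / t)) as [n Hlt].
  apply (Hn n); [assumption|].
  assert (H2 : INR n <= 2 ^ n).
  { clear. induction n as [|n IH]; [simpl; lra|]. rewrite S_INR. simpl.
    assert (1 <= 2 ^ n) by (apply pow_R1_Rle; lra). lra. }
  apply Rmult_le_reg_r with (/ t); [now apply Rinv_0_lt_compat|].
  rewrite Rmult_assoc, Rinv_r, Rmult_1_r by lra. unfold Rdiv in Hlt. lra.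
Qed.

Lemma bsum_pos (C : R) (u : Z -> R) : edecay C u -> (forall n, 0 < u n) -> 0 < bsum u.
Proof.
  intros Hd Hp.
  assert (H : forall a, geometric C a -> (forall n, 0 < a n) -> 0 < Series a).
  { intros a Ha Hpa. pose proof (geometric_ex_series _ _ Ha) as He.
    rewrite Series_incr_1 by assumption.
    assert (0 <= Series (fun k => a (S k))).
    { rewrite <- (Series_eq0 (fun _ => 0)) by reflexivity. apply Series_le.
      - intros n. split; [lra|left; apply Hpa].
      - now apply ex_series_incr_1 in He. }
    pose proof (Hpa 0%nat). lra. }
  unfold bsum. apply Rplus_lt_0_compat; apply H; auto using edecay_geometric_pos, edecay_geometric_neg.
Qed.

Lemma theta_gen_pos (f : R -> R) (h t x : R) :
  0 < t -> (forall z, Rabs (f z) <= exp (Rabs z)) ->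
  (forall n, 0 < f (2 * (IZR n + h) * x)) -> 0 < theta_gen f h 1 t x.
Proof.
  intros Ht Hf Hp. eapply bsum_pos; [apply theta_gen_edecay; auto using is_sign_1|].
  intros n. apply Rmult_lt_0_compat; [|apply Hp].
  unfold gauss. rewrite powerRZ_R1, Rmult_1_l. apply exp_pos.
Qed.

Lemma nul23_pos (t : R) : 0 < t -> 0 < nul2 t /\ 0 < nul3 t.
Proof.
  intros Ht. pose proof (exp_type_fun _ _ (trig_c_type _ _ _ trig_pair_circular)) as Hc.
  split; apply theta_gen_pos; auto; intros n; rewrite Rmult_0_r, cos_0; lra.
Qed.

Lemma cosh_pos (x : R) : 0 < cosh x.
Proof. unfold cosh. pose proof (exp_pos x). pose proof (exp_pos (- x)). lra. Qed.

Lemma theta23_cosh_pos (t x : R) : 0 < t -> 0 < theta2 cosh t x /\ 0 < theta3 cosh t x.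
Proof.
  intros Ht. pose proof (exp_type_fun _ _ (trig_c_type _ _ _ trig_pair_hyperbolic)) as Hc.
  split; apply theta_gen_pos; auto; intros n; apply cosh_pos.
Qed.

Lemma gauss_of_nat (h sg t : R) (n : nat) :
  gauss h sg t (Z.of_nat n) = sg ^ n * exp (- (t * (INR n + h) ^ 2)).
Proof. unfold gauss. now rewrite <- pow_powerRZ, <- INR_IZR_INZ. Qed.

Lemma theta_gen_even_series (f : R -> R) (sg t x : R) :
  is_sign sg -> 0 < t -> (forall z, Rabs (f z) <= exp (Rabs z)) -> (forall z, f (- z) = f z) ->
  theta_gen f 0 sg t x =
  f 0 + 2 * Series (fun n => sg ^ S n * exp (- (t * INR (S n) ^ 2)) * f (2 * INR (S n) * x)).
Proof.
  intros Hs Ht Hf He. unfold theta_gen.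
  rewrite (bsum_of_even _ _ (theta_gen_edecay f 0 sg t x Hs Ht Hf)).
  - f_equal.
    + unfold gauss. rewrite powerRZ_O, !Rplus_0_r, pow_i, Rmult_0_r, Ropp_0, exp_0, Rmult_0_r, Rmult_0_l by lia.
      ring.
    + f_equal. apply Series_ext. intros n.
      rewrite gauss_of_nat, <- INR_IZR_INZ, Rplus_0_r. reflexivity.
  - intros n. rewrite gauss_opp, opp_IZR by assumption. f_equal. rewrite <- He. f_equal. ring.
Qed.

(** The indices n and -n-1 contribute equally and (n + 1/2)^2 = n^2 + n + 1/4; the head [c x] is
    isolated for [dominated_head_pos]. *)
Lemma theta2_series (c : R -> R) (t x : R) :
  0 < t -> (forall z, Rabs (c z) <= exp (Rabs z)) -> (forall z, c (- z) = c z) ->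
  theta2 c t x = 2 * exp (- t / 4) *
    (c x + Series (fun n => exp (- (t * (INR (S n) ^ 2 + INR (S n)))) * c ((2 * INR (S n) + 1) * x))).
Proof.
  intros Ht Hc He. unfold theta2, theta_gen.
  pose proof (theta_gen_edecay c (1 / 2) 1 t x is_sign_1 Ht Hc) as Hd.
  unfold bsum.
  rewrite (Series_ext (fun n => gauss (1 / 2) 1 t (- Z.of_nat n - 1) * _)
    (fun n => gauss (1 / 2) 1 t (Z.of_nat n) * c (2 * (IZR (Z.of_nat n) + 1 / 2) * x))).
  2:{ intros n. rewrite gauss_half_opp, Rmult_1_l by apply is_sign_1. f_equal.
      rewrite <- He, minus_IZR, opp_IZR. f_equal. field. }
  rewrite (Series_ext (fun n => gauss (1 / 2) 1 t (Z.of_nat n) * c (2 * (IZR (Z.of_nat n) + 1 / 2) * x))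
    (fun n => exp (- t / 4) * (exp (- (t * (INR n ^ 2 + INR n))) * c ((2 * INR n + 1) * x)))).
  2:{ intros n. rewrite gauss_of_nat, pow1, Rmult_1_l, <- INR_IZR_INZ.
      rewrite <- (Rmult_assoc (exp (- t / 4))), <- exp_plus. f_equal; f_equal; field. }
  rewrite Series_scal_l, Series_incr_1.
  - replace (exp (- (t * (INR 0 ^ 2 + INR 0))) * c ((2 * INR 0 + 1) * x)) with (c x); [ring|].
    simpl INR. replace (- (t * (0 ^ 2 + 0))) with 0 by ring.
    rewrite exp_0, Rmult_1_l. f_equal. ring.
  - apply edecay_geometric_pos, geometric_ex_series in Hd.
    apply (ex_series_scal_l (V := R_NormedModule) (exp (t / 4))) in Hd. eapply ex_series_ext; [|apply Hd].
    intros n. unfold scal; simpl; unfold mult; simpl.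
    rewrite gauss_of_nat, pow1, Rmult_1_l, <- INR_IZR_INZ.
    rewrite <- (Rmult_assoc (exp (t / 4))), <- exp_plus. f_equal; f_equal; field.
Qed.

Lemma Rabs_cos_le1 (x : R) : Rabs (cos x) <= 1.
Proof. apply Rabs_le. pose proof (COS_bound x). lra. Qed.

Lemma Rabs_sin_le1 (x : R) : Rabs (sin x) <= 1.
Proof. apply Rabs_le. pose proof (SIN_bound x). lra. Qed.

(** The head cos x of theta2 tends to 0 at pi/2, so the other terms must be bounded relative to it;
    an absolute bound would fail there. *)
Lemma Rabs_cos_odd_le (n : nat) (x : R) :
  0 <= cos x -> Rabs (cos ((2 * INR n + 1) * x)) <= (2 * INR n + 1) * cos x.
Proof.
  intros Hx. induction n as [|n IH].
  - simpl. rewrite Rmult_0_r, Rplus_0_l, !Rmult_1_l, Rabs_pos_eq; lra.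
  - rewrite S_INR.
    replace ((2 * (INR n + 1) + 1) * x) with ((2 * INR n + 1) * x + 2 * x) by ring.
    set (y := (2 * INR n + 1) * x) in *. rewrite cos_plus, sin_2a.
    assert (H1 : Rabs (cos y * cos (2 * x)) <= (2 * INR n + 1) * cos x).
    { rewrite Rabs_mult. pose proof (Rabs_cos_le1 (2 * x)). pose proof (Rabs_pos (cos y)).
      pose proof (Rabs_pos (cos (2 * x))).
      apply Rle_trans with (Rabs (cos y) * 1); [apply Rmult_le_compat_l; assumption|lra]. }
    assert (H2 : Rabs (sin y * (2 * sin x * cos x)) <= 2 * cos x).
    { rewrite !Rabs_mult, (Rabs_pos_eq 2), (Rabs_pos_eq (cos x)) by lra.
      pose proof (Rabs_sin_le1 y). pose proof (Rabs_sin_le1 x).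
      pose proof (Rabs_pos (sin y)). pose proof (Rabs_pos (sin x)).
      assert (Rabs (sin y) * Rabs (sin x) <= 1 * 1) by (apply Rmult_le_compat; assumption).
      replace (Rabs (sin y) * (2 * Rabs (sin x) * cos x))
        with (2 * (Rabs (sin y) * Rabs (sin x) * cos x)) by ring.
      assert (Rabs (sin y) * Rabs (sin x) * cos x <= 1 * cos x) by (apply Rmult_le_compat_r; lra). lra. }
    unfold Rminus. eapply Rle_trans; [apply Rabs_triang|]. rewrite Rabs_Ropp. lra.
Qed.

Lemma theta4_cos_neq0_large (t x : R) : 10 <= t -> theta4 cos t x <> 0.
Proof.
  intros Ht. apply Rgt_not_eq. unfold theta4.
  pose proof (exp_type_fun _ _ (trig_c_type _ _ _ trig_pair_circular)) as Hc.
  rewrite theta_gen_even_series; auto using is_sign_m1, cos_neg; [|lra].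
  rewrite cos_0, <- Series_scal_l. apply (dominated_head_pos _ 1 t); [lra|assumption|].
  intros n. rewrite !Rabs_mult, (Rabs_pos_eq 2), pow_1_abs by lra.
  rewrite (Rabs_pos_eq (exp _)) by (left; apply exp_pos).
  pose proof (Rabs_cos_le1 (2 * INR (S n) * x)). pose proof (pos_INR n).
  pose proof (Rabs_pos (cos (2 * INR (S n) * x))).
  assert (He : exp (- (t * INR (S n) ^ 2)) <= exp (- (t * INR (S n)))).
  { apply exp_le. rewrite S_INR. nra. }
  pose proof (exp_pos (- (t * INR (S n) ^ 2))).
  apply Rle_trans with (2 * exp (- (t * INR (S n)))).
  { rewrite Rmult_1_l. apply Rmult_le_compat_l; [lra|].
    rewrite <- (Rmult_1_r (exp (- (t * INR (S n))))). apply Rmult_le_compat; lra. }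
  pose proof (exp_pos (- (t * INR (S n)))).
  rewrite Rmult_1_r. apply Rmult_le_compat_r; lra.
Qed.

(** A zero passes from t to 2t by [nul3 t * nul4 t = nul4 (2 * t) ^ 2]. The point argument of
    [doubling_descent] is a dummy here. *)
Lemma nul4_neq0 (t : R) : 0 < t -> nul4 t <> 0.
Proof.
  intros Ht. apply (doubling_descent (fun t _ => nul4 t = 0)); [| |exact 0|assumption].
  - intros r _ Hr H. exists 0. destruct (nul_products r Hr) as [_ [_ [_ P]]].
    rewrite H in P. nra.
  - intros r _ Hr. now apply theta4_cos_neq0_large.
Qed.

Lemma theta34_double (e : R) (c s : R -> R) (t x : R) :
  trig_pair e c s -> 0 < t -> theta3 c t x * theta4 c t x = theta4 c (2 * t) (2 * x) * nul4 (2 * t).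
Proof.
  intros H Ht. destruct (theta_products e c s t x x H Ht) as [_ [_ [_ [_ [_ P]]]]].
  destruct (theta_null e c s (2 * t) H) as [_ [_ N4]].
  rewrite P, Rminus_diag, (theta1_0 e c s), N4 by assumption.
  replace (x + x) with (2 * x) by ring. ring.
Qed.

Lemma theta12_double (e : R) (c s : R -> R) (t x : R) :
  trig_pair e c s -> 0 < t -> theta1 s t x * theta2 c t x = theta1 s (2 * t) (2 * x) * nul4 (2 * t).
Proof.
  intros H Ht. destruct (theta_products e c s t x x H Ht) as [_ [_ [_ [_ [P _]]]]].
  destruct (theta_null e c s (2 * t) H) as [_ [_ N4]].
  rewrite P, Rminus_diag, (theta1_0 e c s), N4 by assumption.
  replace (x + x) with (2 * x) by ring. ring.
Qed.

Lemma theta4_cos_neq0 (t x : R) : 0 < t -> theta4 cos t x <> 0.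
Proof.
  apply (doubling_descent (fun t x => theta4 cos t x = 0)).
  - intros r y Hr H. exists (2 * y). pose proof (theta34_double _ _ _ r y trig_pair_circular Hr) as P.
    pose proof (nul4_neq0 (2 * r)) as N. rewrite H, Rmult_0_r in P. symmetry in P.
    destruct (Rmult_integral _ _ P); [assumption|exfalso; apply N; lra].
  - intros. now apply theta4_cos_neq0_large.
Qed.

Lemma theta3_cos_neq0 (t x : R) : 0 < t -> theta3 cos t x <> 0.
Proof.
  intros Ht H. pose proof (theta34_double _ _ _ t x trig_pair_circular Ht) as P.
  rewrite H, Rmult_0_l in P. symmetry in P.
  destruct (Rmult_integral _ _ P) as [E|E]; revert E; [apply theta4_cos_neq0|apply nul4_neq0]; lra.
Qed.

Lemma cos_shift_Zpi (n : Z) (x : R) : cos (x + IZR n * PI) = powerRZ (-1) n * cos x.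
Proof.
  revert n x.
  assert (Hnat : forall (n : nat) x, cos (x + INR n * PI) = (-1) ^ n * cos x).
  { induction n as [|n IH]; intros x.
    - simpl. rewrite Rmult_0_l, Rplus_0_r. ring.
    - rewrite S_INR. replace (x + (INR n + 1) * PI) with (x + PI + INR n * PI) by ring.
      rewrite IH, neg_cos. simpl. ring. }
  assert (Hz : forall (n : nat) x, cos (x + IZR (Z.of_nat n) * PI) = powerRZ (-1) (Z.of_nat n) * cos x).
  { intros n x. now rewrite <- INR_IZR_INZ, Hnat, pow_powerRZ. }
  intros n x. destruct (Z_le_gt_dec 0 n).
  - rewrite <- (Z2Nat.id n) by assumption. apply Hz.
  - replace n with (- Z.of_nat (Z.to_nat (- n)))%Z by lia. set (m := Z.of_nat (Z.to_nat (- n))).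
    rewrite opp_IZR, powerRZ_sign_opp by apply is_sign_m1.
    transitivity (powerRZ (-1) m * (powerRZ (-1) m * cos (x + - IZR m * PI))).
    + rewrite <- Rmult_assoc, <- powerRZ_mult. replace (-1 * -1) with 1 by ring. rewrite powerRZ_R1. ring.
    + unfold m. rewrite <- (Hz _ (x + - IZR m * PI)). unfold m. do 2 f_equal. ring.
Qed.

Lemma theta_cos_half_period (t x : R) :
  theta4 cos t (x + PI / 2) = theta3 cos t x /\ theta3 cos t (x + PI / 2) = theta4 cos t x /\
  theta2 cos t (x + PI / 2) = - theta1 sin t x /\ theta1 sin t (x + PI / 2) = theta2 cos t x.
Proof.
  assert (Hp : forall n, powerRZ (-1) n * powerRZ (-1) n = 1).
  { intros n. rewrite <- powerRZ_mult. replace (-1 * -1) with 1 by ring. apply powerRZ_R1. }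
  assert (Hc : forall n y, cos (2 * (IZR n + 0) * (y + PI / 2)) = powerRZ (-1) n * cos (2 * (IZR n + 0) * y)).
  { intros n y. rewrite <- cos_shift_Zpi. f_equal. field. }
  assert (Hh : forall n y, cos (2 * (IZR n + 1 / 2) * (y + PI / 2)) = - (powerRZ (-1) n * sin (2 * (IZR n + 1 / 2) * y))).
  { intros n y. replace (2 * (IZR n + 1 / 2) * (y + PI / 2))
      with (PI / 2 + 2 * (IZR n + 1 / 2) * y + IZR n * PI) by field.
    rewrite cos_shift_Zpi, sin_cos. ring. }
  assert (Hs : forall n y, sin (2 * (IZR n + 1 / 2) * (y + PI / 2)) = powerRZ (-1) n * cos (2 * (IZR n + 1 / 2) * y)).
  { intros n y. rewrite sin_cos. replace (PI / 2 + 2 * (IZR n + 1 / 2) * (y + PI / 2))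
      with (2 * (IZR n + 1 / 2) * y + PI + IZR n * PI) by field.
    rewrite cos_shift_Zpi, neg_cos. ring. }
  unfold theta1, theta2, theta3, theta4, theta_gen, gauss. repeat split.
  - apply bsum_ext. intros n. rewrite Hc, powerRZ_R1. transitivity
      ((powerRZ (-1) n * powerRZ (-1) n) * (exp (- (t * (IZR n + 0) ^ 2)) * cos (2 * (IZR n + 0) * x))); [ring|].
    rewrite Hp. ring.
  - apply bsum_ext. intros n. rewrite Hc, powerRZ_R1. ring.
  - match goal with |- _ = - ?b => replace (- b) with (-1 * b) by ring end.
    rewrite <- bsum_scal. apply bsum_ext. intros n. rewrite Hh, powerRZ_R1. ring.
  - apply bsum_ext. intros n. rewrite Hs, powerRZ_R1. transitivity
      ((powerRZ (-1) n * powerRZ (-1) n) * (exp (- (t * (IZR n + 1 / 2) ^ 2)) * cos (2 * (IZR n + 1 / 2) * x))); [ring|].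
    rewrite Hp. ring.
Qed.

(** A zero y in (0, pi/2) makes theta1(2y) of nome q^2 vanish, which is theta2 at 2y - pi/2, again
    inside the open interval. Evenness handles y < 0, and positivity of [nul2] handles y = 0. *)
Lemma theta2_cos_neq0 (t x : R) : 0 < t -> - (PI / 2) < x < PI / 2 -> theta2 cos t x <> 0.
Proof.
  intros Ht Hx H.
  pose proof (exp_type_fun _ _ (trig_c_type _ _ _ trig_pair_circular)) as Hc.
  revert t x Ht Hx H.
  enough (Hn : forall t x, 0 < t -> ~ (- (PI / 2) < x < PI / 2 /\ theta2 cos t x = 0)).
  { intros t x Ht Hx H. exact (Hn t x Ht (conj Hx H)). }
  apply (doubling_descent (fun t x => - (PI / 2) < x < PI / 2 /\ theta2 cos t x = 0)).
  - assert (Hpos : forall r y, 0 < r -> 0 <= y < PI / 2 -> theta2 cos r y = 0 ->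
      exists x', - (PI / 2) < x' < PI / 2 /\ theta2 cos (2 * r) x' = 0).
    { intros r y Hr Hy H. destruct (Req_dec y 0) as [->|Hy0].
      - exfalso. destruct (nul23_pos r Hr) as [N _]. unfold nul2 in N. lra.
      - exists (2 * y - PI / 2). split; [lra|].
        pose proof (theta12_double _ _ _ r y trig_pair_circular Hr) as P.
        destruct (theta_cos_half_period (2 * r) (2 * y - PI / 2)) as [_ [_ [_ E]]].
        replace (2 * y - PI / 2 + PI / 2) with (2 * y) in E by ring.
        rewrite H, Rmult_0_r, E in P. symmetry in P. apply Rmult_integral in P.
        destruct P as [P|P]; [assumption|]. exfalso. apply (nul4_neq0 (2 * r)); lra. }
    intros r y Hr [Hy H]. destruct (Rle_lt_dec 0 y).
    + apply (Hpos r y); auto; lra.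
    + apply (Hpos r (- y)); auto; [lra|].
      destruct (theta_even _ _ _ r y trig_pair_circular) as [E _]. now rewrite E.
  - intros t x Ht [Hx H]. revert H. apply Rgt_not_eq.
    rewrite theta2_series; auto using cos_neg; [|lra].
    apply Rmult_lt_0_compat; [pose proof (exp_pos (- t / 4)); lra|].
    assert (Hcx : 0 < cos x) by (apply cos_gt_0; lra).
    apply (dominated_head_pos _ _ t); [assumption|assumption|].
    intros n. rewrite Rabs_mult, (Rabs_pos_eq (exp _)) by (left; apply exp_pos).
    pose proof (Rabs_cos_odd_le (S n) x) as Ho.
    assert (He : exp (- (t * (INR (S n) ^ 2 + INR (S n)))) <= exp (- (t * INR (S n)))).
    { apply exp_le. pose proof (pow2_ge_0 (INR (S n))). nra. }
    replace ((2 * INR n + 3) * exp (- (t * INR (S n))) * cos x)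
      with (exp (- (t * INR (S n))) * ((2 * INR (S n) + 1) * cos x)) by (rewrite S_INR; ring).
    apply Rmult_le_compat; [left; apply exp_pos|apply Rabs_pos|assumption|apply Ho; lra].
Qed.

(* Pairs the terms of index [n + 1] and [- n], which cancel at [x = t / 2]. *)
Lemma theta4_cosh_series (t x : R) : 0 < t ->
  theta4 cosh t x =
  Series (fun n => (-1) ^ n * exp (- (t * INR n ^ 2) - 2 * INR n * x)
                   * (1 - exp (- ((2 * INR n + 1) * (t - 2 * x))))).
Proof.
  intros Ht.
  pose proof (exp_type_fun _ _ (trig_c_type _ _ _ trig_pair_hyperbolic)) as Hc.
  pose proof (exp_type_fun _ _ (trig_s_type _ _ _ trig_pair_hyperbolic)) as Hs.
  destruct (theta_gen_zero _ _ _ t x trig_pair_hyperbolic Ht) as [_ [Z _]].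
  assert (Hexp : forall z, Rabs (exp z) <= exp (Rabs z)).
  { intros z. rewrite Rabs_pos_eq by (left; apply exp_pos). apply exp_le, Rle_abs. }
  (* Adding the vanishing sinh series replaces cosh by exp, so each index carries a single
     exponential. *)
  assert (E : theta4 cosh t x = theta_gen exp 0 (-1) t x).
  { transitivity (theta4 cosh t x + theta_gen sinh 0 (-1) t x); [rewrite Z; ring|].
    unfold theta4, theta_gen.
    rewrite <- (bsum_plus _ _ _ _ (theta_gen_edecay cosh 0 (-1) t x is_sign_m1 Ht Hc)
                                  (theta_gen_edecay sinh 0 (-1) t x is_sign_m1 Ht Hs)).
    apply bsum_ext. intros n. rewrite <- Rmult_plus_distr_l. f_equal. unfold cosh, sinh. field. }
  rewrite E. unfold theta_gen.
  pose proof (theta_gen_edecay exp 0 (-1) t x is_sign_m1 Ht Hexp) as Hd.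
  rewrite <- (bsum_succ _ _ Hd).
  pose proof (edecay_comp _ _ (fun n => (n + 1)%Z) 1 Hd) as Hd1. cbv beta in Hd1.
  specialize (Hd1 ltac:(intros; lia)).
  unfold bsum. rewrite <- Series_plus.
  - apply Series_ext. intros n.
    replace (- Z.of_nat n - 1 + 1)%Z with (- Z.of_nat n)%Z by ring.
    replace (Z.of_nat n + 1)%Z with (Z.of_nat (S n)) by lia.
    rewrite gauss_opp, !gauss_of_nat, opp_IZR, <- !INR_IZR_INZ by apply is_sign_m1.
    rewrite S_INR. simpl ((-1) ^ S n). rewrite !Rmult_assoc, <- !exp_plus.
    rewrite Rmult_minus_distr_l, <- exp_plus, Rmult_1_r, Rmult_minus_distr_l.
    match goal with |- _ * (_ * exp ?a) + _ * exp ?b = _ * exp ?c - _ * exp ?d =>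
      replace a with d by ring; replace b with c by ring end.
    ring.
  - apply edecay_geometric_pos, geometric_ex_series in Hd1. exact Hd1.
  - apply edecay_geometric_neg, geometric_ex_series in Hd1. exact Hd1.
Qed.

Lemma theta4_cosh_half (t : R) : 0 < t -> theta4 cosh t (t / 2) = 0.
Proof.
  intros Ht. rewrite theta4_cosh_series by assumption. apply Series_eq0. intros n.
  replace (t - 2 * (t / 2)) with 0 by field. rewrite Rmult_0_r, Ropp_0, exp_0. ring.
Qed.

(** The counterpart of [Rabs_cos_odd_le] for the hyperbolic theta4, whose head 1 - e^(-y), y = t -
    2x, vanishes at x = t/2. *)
Lemma one_minus_exp_le (n : nat) (y : R) :
  0 <= y -> 0 <= 1 - exp (- (INR n * y)) <= INR n * (1 - exp (- y)).
Proof.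
  intros Hy. induction n as [|n IH].
  - simpl. rewrite Rmult_0_l, Ropp_0, exp_0. lra.
  - rewrite S_INR. replace (- ((INR n + 1) * y)) with (- (INR n * y) + - y) by ring. rewrite exp_plus.
    pose proof (exp_pos (- (INR n * y))). pose proof (exp_pos (- y)).
    assert (exp (- y) <= 1) by (rewrite <- exp_0; apply exp_le; lra). nra.
Qed.

(** The map (t, x) -> (2t, 2x) of the duplication formula preserves the range 0 <= x < t/2, so a
    zero descends inside it. *)
Lemma theta4_cosh_neq0 (t x : R) : 0 < t -> 0 <= x < t / 2 -> theta4 cosh t x <> 0.
Proof.
  intros Ht Hx H. revert t x Ht Hx H.
  enough (Hn : forall t x, 0 < t -> ~ (0 <= x < t / 2 /\ theta4 cosh t x = 0)).
  { intros t x Ht Hx H. exact (Hn t x Ht (conj Hx H)). }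
  apply (doubling_descent (fun t x => 0 <= x < t / 2 /\ theta4 cosh t x = 0)).
  - intros r y Hr [Hy H]. exists (2 * y). split; [lra|].
    pose proof (theta34_double _ _ _ r y trig_pair_hyperbolic Hr) as P.
    rewrite H, Rmult_0_r in P. symmetry in P.
    destruct (Rmult_integral _ _ P) as [E|E]; [assumption|]. exfalso. apply (nul4_neq0 (2 * r)); lra.
  - intros t x Ht [Hx H]. revert H. apply Rgt_not_eq.
    assert (Ht0 : 0 < t) by lra.
    assert (Hb : 0 < 1 - exp (- (t - 2 * x))).
    { apply Rlt_0_minus. rewrite <- exp_0. apply exp_increasing. lra. }
    assert (Hterm : forall n, Rabs ((-1) ^ n * exp (- (t * INR n ^ 2) - 2 * INR n * x)
                   * (1 - exp (- ((2 * INR n + 1) * (t - 2 * x)))))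
              <= (2 * INR n + 1) * exp (- (t * INR n)) * (1 - exp (- (t - 2 * x)))).
    { intros n. rewrite !Rabs_mult, pow_1_abs, Rmult_1_l, (Rabs_pos_eq (exp _)) by (left; apply exp_pos).
      pose proof (one_minus_exp_le (2 * n + 1) (t - 2 * x)) as Ho.
      rewrite plus_INR, mult_INR in Ho. simpl (INR 2) in Ho. simpl (INR 1) in Ho.
      change (1 + 1) with 2 in Ho.
      rewrite Rabs_pos_eq by (apply Ho; lra).
      assert (He : exp (- (t * INR n ^ 2) - 2 * INR n * x) <= exp (- (t * INR n))).
      { apply exp_le. pose proof (pos_INR n).
        assert (INR n <= INR n ^ 2).
        { destruct n; [simpl; lra|]. rewrite S_INR. pose proof (pos_INR n). nra. }
        assert (t * INR n <= t * INR n ^ 2) by (apply Rmult_le_compat_l; lra).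
        assert (0 <= INR n * x) by (apply Rmult_le_pos; lra). lra. }
      rewrite (Rmult_comm (2 * INR n + 1) (exp _)), (Rmult_assoc (exp (- (t * INR n)))).
      apply Rmult_le_compat; [left; apply exp_pos|apply Ho; lra|assumption|apply Ho; lra]. }
    rewrite theta4_cosh_series by assumption.
    rewrite Series_incr_1.
    + replace ((-1) ^ 0 * _ * _) with (1 - exp (- (t - 2 * x))).
      * apply (dominated_head_pos _ _ t); [assumption|assumption|]. intros n.
        eapply Rle_trans; [apply Hterm|]. rewrite S_INR. right. ring.
      * simpl INR. simpl pow. rewrite !Rmult_0_l, !Rmult_0_r, Rmult_0_l, Rminus_0_r, Ropp_0, exp_0, Rplus_0_l, !Rmult_1_l. reflexivity.
    + apply (geometric_ex_series (1 - exp (- (t - 2 * x)))). intros n.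
      eapply Rle_trans; [apply Hterm|]. rewrite Rmult_comm. apply Rmult_le_compat_l; [lra|].
      rewrite <- exp_opp_INR. apply Rle_trans with (exp (2 * INR n) * exp (- (t * INR n))).
      * apply Rmult_le_compat_r; [left; apply exp_pos|]. pose proof (exp_ge_1_plus (2 * INR n)). lra.
      * rewrite <- exp_plus. apply exp_le. pose proof (pos_INR n). nra.
Qed.

(** * The modulus as a function of the nome *)

Definition modk (t : R) : R := nul2 t ^ 2 / nul3 t ^ 2.

Lemma nul_quartic (t : R) : 0 < t -> nul3 t ^ 4 = nul4 t ^ 4 + nul2 t ^ 4.
Proof.
  intros Ht. pose proof (theta_pythagoras_D _ _ _ t 0 trig_pair_circular Ht) as P.
  fold (nul2 t) (nul3 t) (nul4 t) in P. lra.
Qed.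

Lemma modk_bounds (t : R) : 0 < t -> 0 < modk t < 1.
Proof.
  intros Ht. destruct (nul23_pos t Ht) as [N2 N3]. pose proof (nul4_neq0 t Ht) as N4.
  assert (P3 : 0 < nul3 t ^ 2) by now apply pow_lt. assert (P2 : 0 < nul2 t ^ 2) by now apply pow_lt.
  assert (P4 : 0 < nul4 t ^ 2) by (apply pow2_gt_0; assumption).
  pose proof (nul_quartic t Ht) as Q. unfold modk. split.
  - now apply Rdiv_lt_0_compat.
  - apply Rmult_lt_reg_r with (nul3 t ^ 2); [assumption|]. unfold Rdiv.
    rewrite Rmult_assoc, Rinv_l by lra. nra.
Qed.

Lemma compl_modk (t : R) : 0 < t -> compl_modulus (modk t) = nul4 t ^ 2 / nul3 t ^ 2.
Proof.
  intros Ht. destruct (nul23_pos t Ht) as [_ N3]. pose proof (nul_quartic t Ht) as Q.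
  unfold compl_modulus, modk.
  replace (1 - (nul2 t ^ 2 / nul3 t ^ 2) ^ 2) with ((nul4 t ^ 2 / nul3 t ^ 2) ^ 2).
  - apply sqrt_pow2. apply Rmult_le_pos; [apply pow2_ge_0|]. left. apply Rinv_0_lt_compat. now apply pow_lt.
  - apply (Rmult_eq_reg_r (nul3 t ^ 4)); [|apply Rgt_not_eq; now apply pow_lt].
    transitivity (nul4 t ^ 4); [field; lra|]. transitivity (nul3 t ^ 4 - nul2 t ^ 4); [lra|field; lra].
Qed.

(* Landen's transformation [modk t = 2 sqrt (modk (2t)) / (1 + modk (2t))], in two weak forms. *)
Lemma modk_double (t : R) : 0 < t ->
  modk (2 * t) <= modk t ^ 2 /\ 1 - modk t <= (1 - modk (2 * t)) ^ 2.
Proof.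
  intros Ht. assert (Ht2 : 0 < 2 * t) by lra.
  destruct (nul23_pos (2 * t) Ht2) as [A2 A3]. destruct (modk_bounds (2 * t) Ht2) as [_ Hlt].
  destruct (nul_products t Ht) as [P3 [_ [P2 _]]].
  unfold modk in *. rewrite P2, P3. set (a := nul2 (2 * t)) in *. set (b := nul3 (2 * t)) in *.
  assert (Hab : a < b).
  { assert (a ^ 2 < b ^ 2).
    { apply Rmult_lt_reg_r with (/ b ^ 2); [apply Rinv_0_lt_compat; now apply pow_lt|].
      rewrite Rinv_r by (apply Rgt_not_eq; now apply pow_lt). exact Hlt. }
    nra. }
  assert (Hs : 0 < b ^ 2 + a ^ 2) by nra.
  split; apply Rminus_le_0.
  - replace ((2 * a * b / (b ^ 2 + a ^ 2)) ^ 2 - a ^ 2 / b ^ 2)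
      with (a ^ 2 * ((b ^ 2 - a ^ 2) * (3 * b ^ 2 + a ^ 2)) / (b ^ 2 * (b ^ 2 + a ^ 2) ^ 2)) by (field; lra).
    apply Rdiv_le_0_compat; [|apply Rmult_lt_0_compat; apply pow_lt; lra].
    apply Rmult_le_pos; [apply pow2_ge_0|]. apply Rmult_le_pos; nra.
  - replace ((1 - a ^ 2 / b ^ 2) ^ 2 - (1 - 2 * a * b / (b ^ 2 + a ^ 2)))
      with ((b - a) ^ 2 * (a * (2 * b ^ 3 + 2 * a * b ^ 2 + 2 * a ^ 2 * b + a ^ 3))
            / (b ^ 4 * (b ^ 2 + a ^ 2))) by (field; lra).
    apply Rdiv_le_0_compat; [|apply Rmult_lt_0_compat; [apply pow_lt; lra|lra]].
    apply Rmult_le_pos; [apply pow2_ge_0|]. apply Rmult_le_pos; [lra|].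
    assert (0 < b ^ 3) by now apply pow_lt. assert (0 < a ^ 3) by now apply pow_lt.
    assert (0 < a * b ^ 2) by (apply Rmult_lt_0_compat; [lra|now apply pow_lt]).
    assert (0 < a ^ 2 * b) by (apply Rmult_lt_0_compat; [now apply pow_lt|lra]). lra.
Qed.

Lemma exp_minus_taylor_le (b : R) : Rabs (exp b - 1 - b) <= b ^ 2 * exp (Rabs b).
Proof.
  pose proof (exp_ge_1_plus b) as H1. pose proof (exp_ge_1_plus (- b)) as H2.
  rewrite exp_Ropp in H2. pose proof (exp_pos b) as Hp.
  rewrite Rabs_pos_eq by lra.
  assert (H3 : exp b - 1 <= b * exp b).
  { apply (Rmult_le_compat_r (exp b)) in H2; [|lra]. rewrite Rinv_l in H2 by lra. lra. }
  assert (H4 : 1 <= exp (Rabs b)) by (pose proof (exp_ge_1_plus (Rabs b)); pose proof (Rabs_pos b); lra).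
  destruct (Rle_lt_dec 0 b) as [Hb|Hb].
  - rewrite (Rabs_pos_eq b) by assumption. nra.
  - apply Rle_trans with (b ^ 2 * 1); [nra|]. apply Rmult_le_compat_l; [apply pow2_ge_0|assumption].
Qed.

Lemma ex_derive_gauss_sum (h t : R) : 0 < t -> ex_derive (fun t => bsum (gauss h 1 t)) t.
Proof.
  intros Ht. eexists.
  (* With w = |n + h| the remainder contains w^4 <= 16 e^(2w). For |y| <= t/2 the factor e^(|y| w^2)
     is absorbed by half of the Gaussian, which leaves the width t/2. *)
  apply (is_derive_bsum (16 * exp ((2 + 2) ^ 2 / (4 * (t / 2)) + 2 * Rabs h)) (t / 2)
           (fun n r => gauss h 1 r n) (fun n r => - (IZR n + h) ^ 2 * gauss h 1 r n)).
  - lra.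
  - intros y Hy. exists (exp ((0 + 2) ^ 2 / (4 * y) + 2 * Rabs h)). intros n.
    assert (Hy0 : 0 < y) by (apply Rabs_le_between in Hy; lra).
    pose proof (gauss_exp_le h 1 y 0 n is_sign_1 Hy0) as H. rewrite Rmult_0_l, exp_0, Rmult_1_r in H.
    eapply Rle_trans; [apply H|]. apply Rmult_le_compat_l; [left; apply exp_pos|apply exp_opp2_le_abs].
  - exists (4 * exp ((1 + 2) ^ 2 / (4 * t) + 2 * Rabs h)). intros n.
    pose proof (gauss_exp_le h 1 t 1 n is_sign_1 Ht) as H. rewrite Rmult_1_l in H.
    pose proof (sqr_le_exp _ (Rabs_pos (IZR n + h))) as Hw. pose proof (exp_opp2_le_abs n) as H2.
    rewrite Rabs_mult, Rabs_Ropp, <- RPow_abs. set (w := Rabs (IZR n + h)) in *.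
    set (g := Rabs (gauss h 1 t n)) in *. assert (0 <= g) by apply Rabs_pos.
    pose proof (exp_pos ((1 + 2) ^ 2 / (4 * t) + 2 * Rabs h)).
    apply Rle_trans with (4 * (g * exp w)); [nra|]. nra.
  - intros y Hy n.
    pose proof (gauss_exp_le h 1 (t / 2) 2 n is_sign_1) as H. specialize (H ltac:(lra)).
    rewrite Rabs_gauss in H by apply is_sign_1. unfold gauss.
    rewrite powerRZ_R1, !Rmult_1_l. set (w2 := (IZR n + h) ^ 2) in *.
    assert (Hw2 : 0 <= w2) by apply pow2_ge_0.
    pose proof (exp_minus_taylor_le (- (y * w2))) as HT.
    replace (exp (- ((t + y) * w2)) - exp (- (t * w2)) - y * (- w2 * exp (- (t * w2))))
      with (exp (- (t * w2)) * (exp (- (y * w2)) - 1 - - (y * w2))).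
    2:{ replace (- ((t + y) * w2)) with (- (t * w2) + - (y * w2)) by ring. rewrite exp_plus. ring. }
    rewrite Rabs_mult, (Rabs_pos_eq (exp _)) by (left; apply exp_pos).
    rewrite Rabs_Ropp, Rabs_mult, (Rabs_pos_eq w2) in HT by assumption.
    pose proof (sqr_le_exp _ (Rabs_pos (IZR n + h))) as Hw. rewrite pow2_abs in Hw. fold w2 in Hw.
    set (w := Rabs (IZR n + h)) in *.
    assert (He : exp (- (t * w2)) * exp (Rabs y * w2) <= exp (- (t / 2 * w2))).
    { rewrite <- exp_plus. apply exp_le. nra. }
    pose proof (exp_opp2_le_abs n) as H2.
    replace (2 * w) with (w + w) in H by ring. rewrite exp_plus in H.
    set (E := exp ((2 + 2) ^ 2 / (4 * (t / 2)) + 2 * Rabs h)) in *. assert (HE : 0 < E) by apply exp_pos.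
    pose proof (exp_pos w) as Ew. pose proof (exp_pos (- (t * w2))) as Et.
    pose proof (exp_pos (- (t / 2 * w2))) as Et2. pose proof (pow2_ge_0 y) as Hy2.
    apply Rle_trans with (y ^ 2 * (w2 * w2) * exp (- (t / 2 * w2))).
    { apply Rle_trans with (exp (- (t * w2)) * ((- (y * w2)) ^ 2 * exp (Rabs y * w2))).
      - apply Rmult_le_compat_l; lra.
      - replace (exp (- (t * w2)) * ((- (y * w2)) ^ 2 * exp (Rabs y * w2)))
          with (y ^ 2 * (w2 * w2) * (exp (- (t * w2)) * exp (Rabs y * w2))) by ring.
        apply Rmult_le_compat_l; [|assumption]. apply Rmult_le_pos; nra. }
    apply Rle_trans with (y ^ 2 * (16 * (exp (- (t / 2 * w2)) * (exp w * exp w)))).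
    { rewrite Rmult_assoc. apply Rmult_le_compat_l; [assumption|].
      apply Rle_trans with (4 * exp w * (4 * exp w) * exp (- (t / 2 * w2))); [|right; ring].
      apply Rmult_le_compat_r; [lra|]. apply Rmult_le_compat; lra. }
    replace (16 * E * y ^ 2 * exp (- IZR (Z.abs n))) with (y ^ 2 * (16 * (E * exp (- IZR (Z.abs n))))) by ring.
    apply Rmult_le_compat_l; [assumption|]. nra.
Qed.

Lemma nul_gauss_sum (t : R) : nul2 t = bsum (gauss (1 / 2) 1 t) /\ nul3 t = bsum (gauss 0 1 t).
Proof. split; apply bsum_ext; intros n; rewrite Rmult_0_r, cos_0; ring. Qed.

Lemma ex_derive_ratio_exp (f g : R -> R) (u : R) :
  ex_derive f (exp u) -> ex_derive g (exp u) -> g (exp u) <> 0 ->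
  ex_derive (fun u => f (exp u) ^ 2 / g (exp u) ^ 2) u.
Proof.
  intros Hf Hg Hn. auto_derive. repeat split; try assumption.
  rewrite Rmult_1_r. now apply Rmult_integral_contrapositive.
Qed.

(** The substitution t = e^u gives continuity on the whole line, as [IVT_gen] asks. *)
Lemma continuous_modk_exp (u : R) : continuous (fun u => modk (exp u)) u.
Proof.
  apply (ex_derive_continuous (V := R_NormedModule)).
  apply (ex_derive_ratio_exp nul2 nul3).
  - apply (ex_derive_ext (fun t => bsum (gauss (1 / 2) 1 t))).
    + intros t. now destruct (nul_gauss_sum t).
    + apply ex_derive_gauss_sum, exp_pos.
  - apply (ex_derive_ext (fun t => bsum (gauss 0 1 t))).
    + intros t. now destruct (nul_gauss_sum t).
    + apply ex_derive_gauss_sum, exp_pos.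
  - apply Rgt_not_eq, nul23_pos, exp_pos.
Qed.

Lemma pow_succ_le (q : R) (n : nat) : 0 <= q <= 1 -> q ^ S n <= q.
Proof.
  intros Hq. assert (H : q ^ n <= 1) by (rewrite <- (pow1 n); now apply pow_incr).
  simpl. apply (Rmult_le_compat_l q) in H; lra.
Qed.

(** Iterating the two estimates of [modk_double] from t = 1 drives the modulus to 0 along 2^n and to
    1 along 2^(-n); the values between follow by continuity. *)
Lemma modk_surjective (k : R) : 0 < k < 1 -> exists t, 0 < t /\ modk t = k.
Proof.
  intros Hk. destruct (modk_bounds 1 Rlt_0_1) as [K0 K1].
  assert (Hup : forall n, modk (2 ^ n) <= modk 1 ^ S n).
  { induction n as [|n IH]; [simpl; lra|].
    assert (H2n : 0 < 2 ^ n) by (apply pow_lt; lra).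
    destruct (modk_double (2 ^ n) H2n) as [H _]. destruct (modk_bounds (2 ^ n) H2n) as [B0 B1].
    change (2 ^ S n) with (2 * 2 ^ n). eapply Rle_trans; [apply H|].
    assert (modk 1 ^ S n <= modk 1) by (apply pow_succ_le; lra).
    change (modk 1 ^ S (S n)) with (modk 1 * modk 1 ^ S n).
    replace (modk (2 ^ n) ^ 2) with (modk (2 ^ n) * modk (2 ^ n)) by ring.
    apply Rmult_le_compat; lra. }
  assert (Hdn : forall n, 1 - modk (/ 2 ^ n) <= (1 - modk 1) ^ S n).
  { induction n as [|n IH]; [simpl; rewrite Rinv_1; lra|].
    assert (H2n : 0 < / 2 ^ S n) by (apply Rinv_0_lt_compat, pow_lt; lra).
    destruct (modk_double (/ 2 ^ S n) H2n) as [_ H].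
    replace (2 * / 2 ^ S n) with (/ 2 ^ n) in H by (simpl; field; apply pow_nonzero; lra).
    assert (H2n' : 0 < / 2 ^ n) by (apply Rinv_0_lt_compat, pow_lt; lra).
    destruct (modk_bounds (/ 2 ^ n) H2n') as [B0 B1]. eapply Rle_trans; [apply H|].
    assert ((1 - modk 1) ^ S n <= 1 - modk 1) by (apply pow_succ_le; lra).
    change ((1 - modk 1) ^ S (S n)) with ((1 - modk 1) * (1 - modk 1) ^ S n).
    replace ((1 - modk (/ 2 ^ n)) ^ 2) with ((1 - modk (/ 2 ^ n)) * (1 - modk (/ 2 ^ n))) by ring.
    apply Rmult_le_compat; lra. }
  assert (Hpow : forall q e, 0 < q < 1 -> 0 < e -> exists n, q ^ S n < e).
  { intros q e Hq He. destruct (pow_lt_1_zero q) with (y := e) as [N HN]; [rewrite Rabs_pos_eq; lra|lra|].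
    exists N. specialize (HN (S N) ltac:(lia)). rewrite Rabs_pos_eq in HN; [assumption|apply pow_le; lra]. }
  destruct (Hpow (modk 1) k) as [n Hn]; [lra|lra|].
  destruct (Hpow (1 - modk 1) (1 - k)) as [m Hm]; [lra|lra|].
  specialize (Hup n). specialize (Hdn m).
  destruct (IVT_gen (fun u => modk (exp u)) (ln (2 ^ n)) (ln (/ 2 ^ m)) k) as [u [_ Hu]].
  - intros u. apply continuity_pt_filterlim, continuous_modk_exp.
  - rewrite !exp_ln by (try apply Rinv_0_lt_compat; apply pow_lt; lra).
    rewrite Rmin_left, Rmax_right; lra.
  - exists (exp u). split; [apply exp_pos|assumption].
Qed.

(** * Elliptic integrals *)

Lemma is_derive_continuous (f : R -> R) (x l : R) : is_derive f x l -> continuous f x.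
Proof. intros H. apply (ex_derive_continuous (V := R_NormedModule)). now exists l. Qed.

Lemma is_derive_ex (f : R -> R) (x l : R) : is_derive f x l -> ex_derive f x.
Proof. intros H. now exists l. Qed.

Lemma is_derive_val (f : R -> R) (x l l' : R) : is_derive f x l -> l = l' -> is_derive f x l'.
Proof. now intros H <-. Qed.

Lemma derive_0_const (f : R -> R) (v : R) :
  (forall u, Rmin 0 v <= u <= Rmax 0 v -> is_derive f u 0) -> f v = f 0.
Proof.
  intros H. destruct (Rtotal_order v 0) as [Hv|[->|Hv]]; [|reflexivity|].
  - apply (eq_is_derive f v 0); [|assumption]. intros u Hu. apply H. rewrite Rmin_right, Rmax_left; lra.
  - symmetry. apply (eq_is_derive f 0 v); [|assumption]. intros u Hu. apply H. rewrite Rmin_left, Rmax_right; lra.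
Qed.

Lemma nonvanishing_pos (f : R -> R) (v : R) :
  (forall x, continuous f x) -> 0 < f 0 ->
  (forall u, Rmin 0 v <= u <= Rmax 0 v -> f u <> 0) -> 0 < f v.
Proof.
  intros Hc H0 Hn. destruct (Rlt_le_dec 0 (f v)) as [H|H]; [assumption|exfalso].
  destruct (IVT_gen f 0 v 0) as [u [Hu E]].
  - intros x. apply continuity_pt_filterlim, Hc.
  - rewrite Rmin_right, Rmax_left by lra. lra.
  - exact (Hn u Hu E).
Qed.

(** For the quarter period, where cn vanishes and relations obtained by dividing by cn are available
    only on its left. *)
Lemma eq_at_right_end (f g : R -> R) (b : R) :
  continuous f b -> continuous g b -> 0 < b ->
  (forall v, 0 <= v < b -> f v = g v) -> f b = g b.
Proof.
  intros Hf Hg Hb H.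
  apply (filterlim_locally_unique (K := R_AbsRing) (V := R_NormedModule) (F := at_left b) f).
  - eapply filterlim_filter_le_1; [apply filter_le_within|apply Hf].
  - apply (filterlim_ext_loc g).
    + exists (mkposreal b Hb). intros v Hv Hvb. symmetry. apply H.
      apply Rabs_lt_between in Hv. change (minus v b) with (v - b) in Hv. simpl in Hv. lra.
    + eapply filterlim_filter_le_1; [apply filter_le_within|apply Hg].
Qed.

(* The planar vectors [(c, s)] and [(cos p, sin p)] rotate at the same speed [w]. *)
Lemma rotation_unique (s c p w : R -> R) (v : R) :
  (forall u, Rmin 0 v <= u <= Rmax 0 v ->
     is_derive s u (w u * c u) /\ is_derive c u (- (w u * s u)) /\ is_derive p u (w u)) ->
  s 0 = sin (p 0) -> c 0 = cos (p 0) -> s v = sin (p v) /\ c v = cos (p v).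
Proof.
  intros H Hs0 Hc0.
  assert (E : (s v - sin (p v)) ^ 2 + (c v - cos (p v)) ^ 2 = 0).
  { rewrite (derive_0_const (fun u => (s u - sin (p u)) ^ 2 + (c u - cos (p u)) ^ 2)).
    - rewrite Hs0, Hc0. ring.
    - intros u Hu. destruct (H u Hu) as [Hs [Hc Hp]].
      auto_derive.
      + repeat split; eapply is_derive_ex; eassumption.
      + rewrite (is_derive_unique (fun x : R => s x) _ _ Hs), (is_derive_unique (fun x : R => c x) _ _ Hc),
          (is_derive_unique (fun x : R => p x) _ _ Hp). ring. }
  rewrite <- !Rsqr_pow2 in E. pose proof (Rle_0_sqr (s v - sin (p v))).
  pose proof (Rle_0_sqr (c v - cos (p v))).
  split; apply Rminus_diag_uniq, Rsqr_eq_0; lra.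
Qed.

Lemma modulus_sin_pos (k p : R) : 0 <= k < 1 -> 0 < 1 - k ^ 2 * sin p ^ 2.
Proof.
  intros Hk. pose proof (SIN_bound p).
  assert (0 <= sin p ^ 2 <= 1) by (split; [apply pow2_ge_0|nra]).
  assert (0 <= k ^ 2 < 1) by (split; [apply pow2_ge_0|nra]). nra.
Qed.

(** * Legendre's integral and its inverse *)

Definition legendre_F (k p : R) : R := RInt (fun u => / sqrt (1 - k ^ 2 * sin u ^ 2)) 0 p.

Lemma continuous_legendre_integrand (k p : R) :
  0 <= k < 1 -> continuous (fun u => / sqrt (1 - k ^ 2 * sin u ^ 2)) p.
Proof.
  intros Hk. pose proof (modulus_sin_pos k p Hk) as H.
  apply (ex_derive_continuous (V := R_NormedModule)). auto_derive.
  replace (1 + - (k * (k * 1) * (sin p * (sin p * 1)))) with (1 - k ^ 2 * sin p ^ 2) by ring.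
  repeat split; [assumption|]. apply Rgt_not_eq, sqrt_lt_R0, H.
Qed.

Lemma is_RInt_legendre (k p : R) :
  0 <= k < 1 -> is_RInt (fun u => / sqrt (1 - k ^ 2 * sin u ^ 2)) 0 p (legendre_F k p).
Proof.
  intros Hk. apply (RInt_correct (V := R_CompleteNormedModule)).
  apply (ex_RInt_continuous (V := R_CompleteNormedModule)).
  intros u _. now apply continuous_legendre_integrand.
Qed.

Lemma is_derive_legendre (k p : R) :
  0 <= k < 1 -> is_derive (legendre_F k) p (/ sqrt (1 - k ^ 2 * sin p ^ 2)).
Proof.
  intros Hk. apply (is_derive_RInt (V := R_NormedModule) (fun u => / sqrt (1 - k ^ 2 * sin u ^ 2)) _ 0).
  - apply filter_forall. intros q. now apply is_RInt_legendre.
  - now apply continuous_legendre_integrand.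
Qed.

Lemma legendre_F_0 (k : R) : legendre_F k 0 = 0.
Proof. apply (RInt_point (V := R_CompleteNormedModule)). Qed.

Lemma legendre_F_lt (k p q : R) : 0 <= k < 1 -> p < q -> legendre_F k p < legendre_F k q.
Proof.
  intros Hk Hpq.
  destruct (MVT_gen (legendre_F k) p q (fun p => / sqrt (1 - k ^ 2 * sin p ^ 2))) as [x [_ E]].
  - intros x _. now apply is_derive_legendre.
  - intros x _. apply continuity_pt_filterlim. eapply is_derive_continuous. now apply is_derive_legendre.
  - assert (0 < / sqrt (1 - k ^ 2 * sin x ^ 2)) by (apply Rinv_0_lt_compat, sqrt_lt_R0; now apply modulus_sin_pos).
    nra.
Qed.

Lemma legendre_F_inj (k p q : R) : 0 <= k < 1 -> legendre_F k p = legendre_F k q -> p = q.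
Proof.
  intros Hk E. destruct (Rtotal_order p q) as [H|[H|H]]; [|assumption|];
    apply (legendre_F_lt k) in H; lra.
Qed.

Lemma jacobi_am_legendre (k p : R) : 0 <= k < 1 -> jacobi_am (legendre_F k p) k = p.
Proof.
  intros Hk. unfold jacobi_am. apply (iota_unique (V := R_CompleteNormedModule)).
  - intros q Hq. apply (legendre_F_inj k); [assumption|].
    unfold legendre_F at 1. now apply (is_RInt_unique (V := R_CompleteNormedModule)).
  - now apply is_RInt_legendre.
Qed.

Lemma is_derive_RInt_scal (a : R) (f : R -> R) (v : R) :
  (forall z, continuous f z) -> is_derive (fun v => RInt (fun z => a * f z) 0 v) v (a * f v).
Proof.
  intros Hf. apply (is_derive_RInt (V := R_NormedModule) (fun z => a * f z) _ 0).
  - apply filter_forall. intros q. apply (RInt_correct (V := R_CompleteNormedModule)).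
    apply (ex_RInt_continuous (V := R_CompleteNormedModule)). intros z _.
    apply (continuous_scal_r (V := R_NormedModule) a), Hf.
  - apply (continuous_scal_r (V := R_NormedModule) a), Hf.
Qed.

(** The vector (c, s) turns with speed nu d, so p is its angle. Along p the integrand of
    [legendre_F] is 1/d, which makes the integral grow with constant speed nu. The equations are
    asked for only between 0 and v, because the hyperbolic quotients are treated only before their
    quarter period. *)
Lemma elliptic_param (k nu : R) (s c d : R -> R) (v : R) :
  0 <= k < 1 -> (forall u, continuous d u) ->
  (forall u, Rmin 0 v <= u <= Rmax 0 v ->
     is_derive s u (nu * c u * d u) /\ is_derive c u (- (nu * s u * d u)) /\
     0 < d u /\ d u ^ 2 = 1 - k ^ 2 * s u ^ 2) ->
  s 0 = 0 -> c 0 = 1 ->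
  let p := fun u => RInt (fun z => nu * d z) 0 u in
  s v = sin (p v) /\ c v = cos (p v) /\ legendre_F k (p v) = nu * v.
Proof.
  intros Hk Hd H Hs0 Hc0 p.
  assert (Hp : forall u, is_derive p u (nu * d u)) by (intros u; now apply is_derive_RInt_scal).
  assert (Hp0 : p 0 = 0) by apply (RInt_point (V := R_CompleteNormedModule)).
  assert (Hr : forall w, Rmin 0 v <= w <= Rmax 0 v -> s w = sin (p w) /\ c w = cos (p w)).
  { intros w Hw. apply (rotation_unique s c p (fun u => nu * d u)).
    - intros u Hu. assert (Hu' : Rmin 0 v <= u <= Rmax 0 v).
      { unfold Rmin, Rmax in *. repeat destruct Rle_dec; lra. }
      destruct (H u Hu') as [H1 [H2 _]]. split; [|split; [|apply Hp]].
      + replace (nu * d u * c u) with (nu * c u * d u) by ring. exact H1.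
      + replace (nu * d u * s u) with (nu * s u * d u) by ring. exact H2.
    - rewrite Hp0, sin_0. assumption.
    - rewrite Hp0, cos_0. assumption. }
  assert (Hv : Rmin 0 v <= v <= Rmax 0 v) by (split; [apply Rmin_r|apply Rmax_r]).
  destruct (Hr v Hv) as [Es Ec]. split; [assumption|split; [assumption|]].
  enough (E : legendre_F k (p v) - nu * v = legendre_F k (p 0) - nu * 0).
  { rewrite Hp0, legendre_F_0 in E. lra. }
  apply (derive_0_const (fun u => legendre_F k (p u) - nu * u)). intros u Hu.
  destruct (H u Hu) as [_ [_ [Hdp Hd2]]]. destruct (Hr u Hu) as [Eu _].
  replace 0 with (nu * d u * / sqrt (1 - k ^ 2 * sin (p u) ^ 2) - nu * 1).
  - apply (is_derive_minus (fun u => legendre_F k (p u)) (fun u => nu * u)).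
    + apply (is_derive_comp (legendre_F k) p); [now apply is_derive_legendre|apply Hp].
    + auto_derive; [trivial|ring].
  - rewrite <- Eu, <- Hd2, sqrt_pow2 by lra. field. lra.
Qed.

(** By continuity the angle cannot pass beyond pi/2 or -pi/2 without an earlier zero of its cosine.
    Which end is reached is decided where the lemma is applied. *)
Lemma quarter_period_angle (p : R -> R) (b : R) :
  (forall x, continuous p x) -> p 0 = 0 -> 0 < b ->
  (forall v, 0 <= v < b -> 0 < cos (p v)) -> cos (p b) = 0 -> p b = PI / 2 \/ p b = - (PI / 2).
Proof.
  intros Hc H0 Hb Hpos Hz. pose proof PI_RGT_0 as Hpi.
  assert (Hno : forall q, cos q = 0 -> Rmin (p 0) (p b) <= q <= Rmax (p 0) (p b) -> p b = q).
  { intros q Hq Hin. destruct (IVT_gen p 0 b q) as [u [Hu E]]; [|assumption|].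
    - intros x. apply continuity_pt_filterlim, Hc.
    - rewrite Rmin_left, Rmax_right in Hu by lra.
      destruct (Rle_lt_or_eq_dec u b (proj2 Hu)) as [Hub|<-]; [|assumption].
      specialize (Hpos u ltac:(lra)). rewrite E in Hpos. lra. }
  assert (Hbd : - (PI / 2) <= p b <= PI / 2).
  { rewrite H0 in Hno. split; apply Rnot_lt_le; intros Hlt.
    - specialize (Hno (- (PI / 2)) ltac:(rewrite cos_neg; apply cos_PI2)).
      rewrite Rmin_right, Rmax_left in Hno by lra. lra.
    - specialize (Hno (PI / 2) cos_PI2). rewrite Rmin_left, Rmax_right in Hno by lra. lra. }
  destruct (Req_dec (p b) (PI / 2)) as [|N1]; [now left|]. destruct (Req_dec (p b) (- (PI / 2))) as [|N2]; [now right|].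
  exfalso. assert (0 < cos (p b)) by (apply cos_gt_0; lra). lra.
Qed.

Lemma asin_lt (x y : R) : -1 <= x -> x < y -> y <= 1 -> asin x < asin y.
Proof.
  intros Hx Hxy Hy. pose proof (asin_bound x). pose proof (asin_bound y).
  apply Rnot_le_lt. intros Hle.
  apply sin_incr_1 in Hle; try lra. rewrite !sin_asin in Hle by lra. lra.
Qed.

(** The substitution t = sin q is made on [0, q] with q < pi/2, where the integrand is regular. The
    end [l], singular for l = 1, is reached by continuity of [legendre_F] at asin l. *)
Lemma ellF_legendre (l k : R) : 0 < l <= 1 -> 0 <= k < 1 -> ellF l k = legendre_F k (asin l).
Proof.
  intros Hl Hk. unfold ellF. apply (is_RInt_gen_unique (V := R_CompleteNormedModule)).
  assert (Hint : forall q, 0 <= q < PI / 2 ->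
    is_RInt (fun t => / (sqrt (1 - t ^ 2) * sqrt (1 - k ^ 2 * t ^ 2))) 0 (sin q) (legendre_F k q)).
  { intros q Hq.
    assert (Hcos : forall x, Rmin 0 q <= x <= Rmax 0 q -> 0 < cos x).
    { intros x Hx. rewrite Rmin_left, Rmax_right in Hx by lra. apply cos_gt_0; lra. }
    assert (Hs2 : forall x, 1 - sin x ^ 2 = cos x ^ 2).
    { intros x. pose proof (sin2_cos2 x) as E. unfold Rsqr in E. nra. }
    rewrite <- sin_0.
    replace (legendre_F k q) with
      (RInt (fun t => / (sqrt (1 - t ^ 2) * sqrt (1 - k ^ 2 * t ^ 2))) (sin 0) (sin q)).
    - apply (RInt_correct (V := R_CompleteNormedModule)), (ex_RInt_continuous (V := R_CompleteNormedModule)).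
      intros z Hz. rewrite sin_0 in Hz.
      assert (Hsq : 0 <= sin q) by (apply sin_ge_0; lra).
      rewrite Rmin_left, Rmax_right in Hz by assumption.
      assert (Hz1 : 0 < 1 - z ^ 2).
      { assert (Hcq := Hcos q ltac:(rewrite Rmin_left, Rmax_right; lra)). pose proof (Hs2 q). nra. }
      assert (Hz2 : 0 < 1 - k ^ 2 * z ^ 2) by nra.
      apply (ex_derive_continuous (V := R_NormedModule)). auto_derive.
      replace (1 + - (z * (z * 1))) with (1 - z ^ 2) by ring.
      replace (1 + - (k * (k * 1) * (z * (z * 1)))) with (1 - k ^ 2 * z ^ 2) by ring.
      repeat split; try assumption. apply Rgt_not_eq, Rmult_lt_0_compat; now apply sqrt_lt_R0.
    - rewrite <- (RInt_comp (fun t => / (sqrt (1 - t ^ 2) * sqrt (1 - k ^ 2 * t ^ 2))) sin cos).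
      + apply RInt_ext. intros x Hx.
        assert (Hcx := Hcos x ltac:(lra)). rewrite Hs2, sqrt_pow2 by lra.
        pose proof (sqrt_lt_R0 _ (modulus_sin_pos k x Hk)).
        unfold scal; simpl; unfold mult; simpl. simpl in *. field. lra.
      + intros x Hx. assert (Hcx := Hcos x Hx). pose proof (modulus_sin_pos k x Hk).
        apply (ex_derive_continuous (V := R_NormedModule)). auto_derive.
        replace (1 + - (sin x * (sin x * 1))) with (1 - sin x ^ 2) by ring. rewrite Hs2.
        replace (1 + - (k * (k * 1) * (sin x * (sin x * 1)))) with (1 - k ^ 2 * sin x ^ 2) by ring.
        repeat split; try assumption; [now apply pow_lt|].
        apply Rgt_not_eq, Rmult_lt_0_compat; apply sqrt_lt_R0; [now apply pow_lt|assumption].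
      + intros x _. split; [apply is_derive_sin|]. apply continuous_cos. }
  pose proof PI_RGT_0 as Hpi. pose proof (asin_bound l) as Hal.
  assert (Hsl : sin (asin l) = l) by (apply sin_asin; lra).
  assert (Hal0 : 0 < asin l) by (rewrite <- asin_0; apply asin_lt; lra).
  intros P [eps HP].
  assert (Hcont := is_derive_continuous _ _ _ (is_derive_legendre k (asin l) Hk)).
  destruct (proj1 (filterlim_locally _ _) Hcont eps) as [dlt Hd].
  (* Close to asin l for the continuity estimate, and nonnegative so that asin b lies in the range
     of [Hint] for every b between sin q0 and l. *)
  set (q0 := Rmax 0 (asin l - dlt / 2)).
  assert (Hq0 : 0 <= q0 < asin l /\ asin l - dlt < q0).
  { unfold q0. pose proof (cond_pos dlt). split; [split|].
    - apply Rmax_l.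
    - apply Rmax_lub_lt; lra.
    - eapply Rlt_le_trans; [|apply Rmax_r]. lra. }
  assert (Hsq0 : sin q0 < l) by (rewrite <- Hsl; apply sin_increasing_1; lra).
  apply (Filter_prod _ _ _ (fun a => a = 0) (fun b => sin q0 < b < l)).
  - reflexivity.
  - exists (mkposreal _ (proj2 (Rlt_0_minus _ _) Hsq0)). intros y Hy Hyl. split; [|assumption].
    apply Rabs_lt_between in Hy. change (minus y l) with (y - l) in Hy. simpl in Hy. lra.
  - intros a b -> [Hb1 Hb2].
    assert (Hsq00 : 0 <= sin q0) by (apply sin_ge_0; lra).
    assert (Hsb : sin (asin b) = b) by (apply sin_asin; lra).
    assert (Hb3 : asin b < asin l) by (apply asin_lt; lra).
    assert (Hb4 : q0 < asin b).
    { rewrite <- (asin_sin q0) by lra. apply asin_lt; lra. }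
    exists (legendre_F k (asin b)). split.
    + simpl. rewrite <- Hsb at 1. apply Hint. lra.
    + apply HP, Hd. change (Rabs (asin b - asin l) < dlt). apply Rabs_lt_between. lra.
Qed.

Lemma ellK_legendre (k : R) : 0 <= k < 1 -> ellK k = legendre_F k (PI / 2).
Proof. intros Hk. unfold ellK. rewrite ellF_legendre, asin_1 by lra. reflexivity. Qed.

(** * Jacobi functions as theta quotients *)

Lemma is_derive_scal_div (a : R) (f g : R -> R) (x f' g' : R) :
  is_derive f x f' -> is_derive g x g' -> g x <> 0 ->
  is_derive (fun x => a * (f x / g x)) x (a * ((f' * g x - f x * g') / g x ^ 2)).
Proof.
  intros Hf Hg Hn. auto_derive.
  - repeat split; [now exists f'|now exists g'|assumption].
  - rewrite (is_derive_unique (fun x : R => f x) _ _ Hf), (is_derive_unique (fun x : R => g x) _ _ Hg).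
    field. assumption.
Qed.

Lemma unit_circle_derivative (s c : R -> R) (x s' c' : R) :
  is_derive s x s' -> is_derive c x c' -> (forall y, s y ^ 2 + c y ^ 2 = 1) -> s x * s' + c x * c' = 0.
Proof.
  intros Hs Hc H.
  assert (D : is_derive (fun y => s y ^ 2 + c y ^ 2) x (2 * (s x * s' + c x * c'))).
  { auto_derive; [repeat split; [now exists s'|now exists c']|].
    rewrite (is_derive_unique (fun x : R => s x) _ _ Hs), (is_derive_unique (fun x : R => c x) _ _ Hc). ring. }
  assert (D0 : is_derive (fun y => s y ^ 2 + c y ^ 2) x 0).
  { apply (is_derive_ext (fun _ => 1)); [intros y; now rewrite H|]. auto_derive; [trivial|ring]. }
  apply is_derive_unique in D. apply is_derive_unique in D0. lra.
Qed.

(** The ratio between Jacobi's argument and the theta argument, equal to theta3(0)^2 by Jacobi's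
    derivative formula. Its sign is read off from [ellK_modk]. *)
Definition nu (t : R) : R := nul1' t * nul3 t / (nul2 t * nul4 t).

(** Jacobi's sn, cn, dn of modulus [modk t] at the argument [nu t * v]. *)
Definition snq (t v : R) : R := nul3 t / nul2 t * (theta1 sin t v / theta4 cos t v).
Definition cnq (t v : R) : R := nul4 t / nul2 t * (theta2 cos t v / theta4 cos t v).
Definition dnq (t v : R) : R := nul4 t / nul3 t * (theta3 cos t v / theta4 cos t v).

Lemma snq2_cnq2 (t v : R) : 0 < t -> snq t v ^ 2 + cnq t v ^ 2 = 1.
Proof.
  intros Ht. destruct (nul23_pos t Ht) as [N2 N3]. pose proof (theta4_cos_neq0 t v Ht) as T4.
  pose proof (theta_pythagoras_S _ _ _ t v trig_pair_circular Ht) as P.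
  unfold snq, cnq.
  transitivity ((1 * nul3 t ^ 2 * theta1 sin t v ^ 2 + nul4 t ^ 2 * theta2 cos t v ^ 2)
                / (nul2 t ^ 2 * theta4 cos t v ^ 2)); [field; split; lra|].
  rewrite P. field. split; lra.
Qed.

Lemma dnq_sqr (t v : R) : 0 < t -> dnq t v ^ 2 = 1 - modk t ^ 2 * snq t v ^ 2.
Proof.
  intros Ht. destruct (nul23_pos t Ht) as [N2 N3]. pose proof (theta4_cos_neq0 t v Ht) as T4.
  pose proof (theta_pythagoras_S _ _ _ t v trig_pair_circular Ht) as P.
  pose proof (theta_pythagoras_D _ _ _ t v trig_pair_circular Ht) as Q.
  pose proof (nul_quartic t Ht) as R.
  unfold snq, dnq, modk. apply Rminus_diag_uniq.
  transitivity ((nul4 t ^ 2 * (nul3 t ^ 2 * theta3 cos t v ^ 2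
                   - (nul4 t ^ 2 * theta4 cos t v ^ 2 + nul2 t ^ 2 * theta2 cos t v ^ 2))
    + nul2 t ^ 2 * (1 * nul3 t ^ 2 * theta1 sin t v ^ 2 + nul4 t ^ 2 * theta2 cos t v ^ 2
                   - nul2 t ^ 2 * theta4 cos t v ^ 2)
    + theta4 cos t v ^ 2 * (nul4 t ^ 4 + nul2 t ^ 4 - nul3 t ^ 4)) / (nul3 t ^ 4 * theta4 cos t v ^ 2)).
  - field. repeat split; lra.
  - match goal with |- ?a / _ = 0 => replace a with 0 by (rewrite P, Q, R; ring) end.
    apply Rmult_0_l.
Qed.

Lemma ex_derive_jacobi_quot (t v : R) : 0 < t ->
  ex_derive (snq t) v /\ ex_derive (cnq t) v /\ ex_derive (dnq t) v.
Proof.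
  intros Ht. pose proof (theta4_cos_neq0 t v Ht) as T4.
  destruct (ex_derive_theta _ _ _ t v trig_pair_circular Ht) as [[d1 D1] [[d2 D2] [[d3 D3] [d4 D4]]]].
  repeat split; eexists; apply is_derive_scal_div; eassumption.
Qed.

Lemma jacobi_quot_0 (t : R) : 0 < t -> snq t 0 = 0 /\ cnq t 0 = 1 /\ dnq t 0 = 1.
Proof.
  intros Ht. destruct (nul23_pos t Ht) as [N2 N3]. pose proof (nul4_neq0 t Ht) as N4.
  unfold snq, cnq, dnq. rewrite (theta1_0 _ _ _ t trig_pair_circular).
  fold (nul2 t) (nul3 t) (nul4 t). repeat split; field; repeat split; lra.
Qed.

Lemma dnq_pos (t v : R) : 0 < t -> 0 < dnq t v.
Proof.
  intros Ht. destruct (nul23_pos t Ht) as [N2 N3]. pose proof (nul4_neq0 t Ht) as N4.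
  apply nonvanishing_pos.
  - intros x. apply (ex_derive_continuous (V := R_NormedModule)), (proj2 (proj2 (ex_derive_jacobi_quot t x Ht))).
  - destruct (jacobi_quot_0 t Ht) as [_ [_ ->]]. lra.
  - intros u _. pose proof (theta4_cos_neq0 t u Ht). pose proof (theta3_cos_neq0 t u Ht).
    unfold dnq, Rdiv. repeat apply Rmult_integral_contrapositive_currified; try apply Rinv_neq_0_compat; lra.
Qed.

(** Two linear equations for the derivatives: s s' + c c' = 0 from the circle and s' c - s c' = nu d
    from the theta Wronskian. They are solved with s^2 + c^2 = 1. *)
Lemma is_derive_sncnq (t v : R) : 0 < t ->
  is_derive (snq t) v (nu t * cnq t v * dnq t v) /\
  is_derive (cnq t) v (- (nu t * snq t v * dnq t v)).
Proof.
  intros Ht. destruct (nul23_pos t Ht) as [N2 N3]. pose proof (nul4_neq0 t Ht) as N4.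
  pose proof (theta4_cos_neq0 t v Ht) as T4.
  destruct (ex_derive_theta _ _ _ t v trig_pair_circular Ht) as [[d1 D1] [[d2 D2] [_ [d4 D4]]]].
  pose proof (is_derive_scal_div (nul3 t / nul2 t) _ _ v _ _ D1 D4 T4) as DS.
  pose proof (is_derive_scal_div (nul4 t / nul2 t) _ _ v _ _ D2 D4 T4) as DC.
  fold (snq t) in DS. fold (cnq t) in DC.
  pose proof (theta_wronskian _ _ _ t v trig_pair_circular Ht) as W. specialize (W ltac:(lra) N4).
  rewrite (is_derive_unique _ _ _ D1), (is_derive_unique _ _ _ D2) in W.
  pose proof (unit_circle_derivative (snq t) (cnq t) _ _ _ DS DC (fun y => snq2_cnq2 t y Ht)) as E.
  pose proof (snq2_cnq2 t v Ht) as E1.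
  assert (EW : nul3 t / nul2 t * ((d1 * theta4 cos t v - theta1 sin t v * d4) / theta4 cos t v ^ 2) * cnq t v
    - snq t v * (nul4 t / nul2 t * ((d2 * theta4 cos t v - theta2 cos t v * d4) / theta4 cos t v ^ 2))
    = nu t * dnq t v).
  { unfold snq, cnq, dnq, nu.
    transitivity ((nul3 t * nul4 t * (d1 * theta2 cos t v - theta1 sin t v * d2))
                  / (nul2 t ^ 2 * theta4 cos t v ^ 2)); [field; lra|].
    rewrite W. field. repeat split; lra. }
  set (ds := nul3 t / nul2 t * ((d1 * theta4 cos t v - theta1 sin t v * d4) / theta4 cos t v ^ 2)) in *.
  set (dc := nul4 t / nul2 t * ((d2 * theta4 cos t v - theta2 cos t v * d4) / theta4 cos t v ^ 2)) in *.
  split.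
  - replace (nu t * cnq t v * dnq t v) with ds; [exact DS|].
    transitivity (ds * (snq t v ^ 2 + cnq t v ^ 2)); [rewrite E1; ring|].
    transitivity (cnq t v * (ds * cnq t v - snq t v * dc) + snq t v * (snq t v * ds + cnq t v * dc)); [ring|].
    rewrite EW, E. ring.
  - replace (- (nu t * snq t v * dnq t v)) with dc; [exact DC|].
    transitivity (dc * (snq t v ^ 2 + cnq t v ^ 2)); [rewrite E1; ring|].
    transitivity (- snq t v * (ds * cnq t v - snq t v * dc) + cnq t v * (snq t v * ds + cnq t v * dc)); [ring|].
    rewrite EW, E. ring.
Qed.

Lemma continuous_dnq (t v : R) : 0 < t -> continuous (dnq t) v.
Proof.
  intros Ht. apply (ex_derive_continuous (V := R_NormedModule)), (proj2 (proj2 (ex_derive_jacobi_quot t v Ht))).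
Qed.

Definition amq (t v : R) : R := RInt (fun z => nu t * dnq t z) 0 v.

Lemma amq_spec (t v : R) : 0 < t ->
  snq t v = sin (amq t v) /\ cnq t v = cos (amq t v) /\ legendre_F (modk t) (amq t v) = nu t * v.
Proof.
  intros Ht. pose proof (modk_bounds t Ht) as Hk. destruct (jacobi_quot_0 t Ht) as [S0 [C0 _]].
  apply (elliptic_param (modk t) (nu t) (snq t) (cnq t) (dnq t)); try assumption; [lra| |].
  - intros u. now apply continuous_dnq.
  - intros u _. destruct (is_derive_sncnq t u Ht) as [D1 D2].
    exact (conj D1 (conj D2 (conj (dnq_pos t u Ht) (dnq_sqr t u Ht)))).
Qed.

Lemma legendre_F_pos (k p : R) : 0 <= k < 1 -> 0 < p -> 0 < legendre_F k p.
Proof. intros Hk Hp. rewrite <- (legendre_F_0 k). now apply legendre_F_lt. Qed.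

Lemma amq_quarter (t : R) : 0 < t -> amq t (PI / 2) = PI / 2.
Proof.
  intros Ht. pose proof PI_RGT_0 as Hpi. destruct (nul23_pos t Ht) as [N2 N3].
  destruct (theta_cos_half_period t 0) as [E4 [_ [E2 E1]]]. rewrite Rplus_0_l in E4, E2, E1.
  rewrite (theta1_0 _ _ _ t trig_pair_circular) in E2.
  fold (nul3 t) in E4. fold (nul2 t) in E1.
  assert (Hs : snq t (PI / 2) = 1) by (unfold snq; rewrite E4, E1; field; lra).
  assert (Hc : cnq t (PI / 2) = 0) by (unfold cnq; rewrite E4, E2; field; lra).
  destruct (amq_spec t (PI / 2) Ht) as [A1 [A2 _]].
  destruct (quarter_period_angle (amq t) (PI / 2)) as [E|E].
  - intros x. eapply is_derive_continuous, is_derive_RInt_scal. intros z. now apply continuous_dnq.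
  - apply (RInt_point (V := R_CompleteNormedModule)).
  - lra.
  - intros v Hv. destruct (amq_spec t v Ht) as [_ [<- _]].
    apply nonvanishing_pos.
    + intros x. apply (ex_derive_continuous (V := R_NormedModule)), (proj1 (proj2 (ex_derive_jacobi_quot t x Ht))).
    + destruct (jacobi_quot_0 t Ht) as [_ [-> _]]. lra.
    + intros u Hu. rewrite Rmin_left, Rmax_right in Hu by lra.
      pose proof (theta4_cos_neq0 t u Ht). pose proof (nul4_neq0 t Ht).
      pose proof (theta2_cos_neq0 t u Ht ltac:(lra)).
      unfold cnq, Rdiv. repeat apply Rmult_integral_contrapositive_currified; try apply Rinv_neq_0_compat; lra.
  - now rewrite <- A2.
  - exact E.
  - exfalso. rewrite Hs, E, sin_neg, sin_PI2 in A1. lra.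
Qed.

Lemma ellK_modk (t : R) : 0 < t -> ellK (modk t) = nu t * (PI / 2).
Proof.
  intros Ht. pose proof (modk_bounds t Ht) as Hk. rewrite ellK_legendre by lra.
  destruct (amq_spec t (PI / 2) Ht) as [_ [_ E]]. now rewrite amq_quarter in E.
Qed.

Lemma nu_pos (t : R) : 0 < t -> 0 < nu t.
Proof.
  intros Ht. pose proof (modk_bounds t Ht) as Hk. pose proof PI_RGT_0 as Hpi.
  pose proof (ellK_modk t Ht) as E. rewrite ellK_legendre in E by lra.
  pose proof (legendre_F_pos (modk t) (PI / 2) ltac:(lra) ltac:(lra)). nra.
Qed.

(* Jacobi's imaginary transformation: the hyperbolic theta quotients parametrize the integral of the
   complementary modulus with the same speed [nu t], and reach the quarter period at [t / 2]. *)
Lemma ellK_compl_modk (t : R) : 0 < t -> ellK (compl_modulus (modk t)) = nu t * (t / 2).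
Proof.
  intros Ht. pose proof PI_RGT_0 as Hpi. destruct (nul23_pos t Ht) as [N2 N3]. pose proof (nul4_neq0 t Ht) as N4.
  pose proof (nul_quartic t Ht) as Q4. pose proof (compl_modk t Ht) as Ek.
  assert (Hk : 0 <= compl_modulus (modk t) < 1).
  { split; [apply sqrt_pos|]. pose proof (modk_bounds t Ht) as Hk. unfold compl_modulus.
    generalize dependent (modk t). intros k _ Hk.
    rewrite <- sqrt_1 at 2. apply sqrt_lt_1_alt. nra. }
  rewrite ellK_legendre by assumption. set (k' := compl_modulus (modk t)) in *.
  (* For the complementary modulus sn, cn, dn are sn(iv) / (i cn(iv)), 1 / cn(iv) and dn(iv) /
     cn(iv); the common denominator theta2(iv) is positive. *)
  set (s := fun v => nul3 t / nul4 t * (theta1 sinh t v / theta2 cosh t v)).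
  set (c := fun v => nul2 t / nul4 t * (theta4 cosh t v / theta2 cosh t v)).
  set (d := fun v => nul2 t / nul3 t * (theta3 cosh t v / theta2 cosh t v)).
  assert (Hex : forall v, exists d1 d2 d3 d4, is_derive (theta1 sinh t) v d1 /\ is_derive (theta2 cosh t) v d2 /\
    is_derive (theta3 cosh t) v d3 /\ is_derive (theta4 cosh t) v d4).
  { intros v. destruct (ex_derive_theta _ _ _ t v trig_pair_hyperbolic Ht) as [[d1 D1] [[d2 D2] [[d3 D3] [d4 D4]]]].
    now exists d1, d2, d3, d4. }
  assert (Hsc : forall v, s v ^ 2 + c v ^ 2 = 1).
  { intros v. destruct (theta23_cosh_pos t v Ht) as [T2 T3].
    pose proof (theta_pythagoras_S _ _ _ t v trig_pair_hyperbolic Ht) as P. unfold s, c.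
    transitivity ((nul4 t ^ 2 * theta2 cosh t v ^ 2
       - (-1 * nul3 t ^ 2 * theta1 sinh t v ^ 2 + nul4 t ^ 2 * theta2 cosh t v ^ 2)
       + nul2 t ^ 2 * theta4 cosh t v ^ 2) / (nul4 t ^ 2 * theta2 cosh t v ^ 2)); [field; split; lra|].
    rewrite P. field. split; lra. }
  assert (Hd : forall v, 0 < d v /\ d v ^ 2 = 1 - k' ^ 2 * s v ^ 2).
  { intros v. destruct (theta23_cosh_pos t v Ht) as [T2 T3]. split.
    - unfold d. apply Rmult_lt_0_compat; now apply Rdiv_lt_0_compat.
    - pose proof (theta_pythagoras_S _ _ _ t v trig_pair_hyperbolic Ht) as P.
      pose proof (theta_pythagoras_D _ _ _ t v trig_pair_hyperbolic Ht) as Q.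
      unfold d, s. rewrite Ek. apply Rminus_diag_uniq.
      transitivity ((nul2 t ^ 2 * (nul3 t ^ 2 * theta3 cosh t v ^ 2
                   - (nul4 t ^ 2 * theta4 cosh t v ^ 2 + nul2 t ^ 2 * theta2 cosh t v ^ 2))
        - nul4 t ^ 2 * (-1 * nul3 t ^ 2 * theta1 sinh t v ^ 2 + nul4 t ^ 2 * theta2 cosh t v ^ 2
                   - nul2 t ^ 2 * theta4 cosh t v ^ 2)
        + theta2 cosh t v ^ 2 * (nul4 t ^ 4 + nul2 t ^ 4 - nul3 t ^ 4)) / (nul3 t ^ 4 * theta2 cosh t v ^ 2)).
      + field. repeat split; lra.
      + match goal with |- ?a / _ = 0 => replace a with 0 by (rewrite P, Q, Q4; ring) end.
        apply Rmult_0_l. }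
  assert (Hder : forall v, exists s' c' d', is_derive s v s' /\ is_derive c v c' /\ is_derive d v d').
  { intros v. destruct (Hex v) as [d1 [d2 [d3 [d4 [D1 [D2 [D3 D4]]]]]]].
    destruct (theta23_cosh_pos t v Ht) as [T2 _].
    do 3 eexists. split; [|split]; apply is_derive_scal_div; try eassumption; lra. }
  assert (Hds : forall v, is_derive s v (nu t * c v * d v)).
  { intros v. destruct (Hex v) as [d1 [d2 [_ [_ [D1 [D2 _]]]]]].
    destruct (theta23_cosh_pos t v Ht) as [T2 _].
    pose proof (is_derive_scal_div (nul3 t / nul4 t) _ _ v _ _ D1 D2 ltac:(lra)) as DS. fold s in DS.
    pose proof (theta_wronskian _ _ _ t v trig_pair_hyperbolic Ht ltac:(lra) N4) as W.
    rewrite (is_derive_unique _ _ _ D1), (is_derive_unique _ _ _ D2) in W.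
    replace (nu t * c v * d v)
      with (nul3 t / nul4 t * ((d1 * theta2 cosh t v - theta1 sinh t v * d2) / theta2 cosh t v ^ 2)); [exact DS|].
    transitivity ((nul3 t * nul4 t * (d1 * theta2 cosh t v - theta1 sinh t v * d2))
                  / (nul4 t ^ 2 * theta2 cosh t v ^ 2)); [field; lra|].
    rewrite W. unfold nu, c, d. field. repeat split; lra. }
  assert (Hcc : forall x, continuous c x).
  { intros x. destruct (Hder x) as [_ [c' [_ [_ [D _]]]]]. eapply is_derive_continuous, D. }
  assert (Hdc : forall x, continuous d x).
  { intros x. destruct (Hder x) as [_ [_ [d' [_ [_ D]]]]]. eapply is_derive_continuous, D. }
  destruct (theta_null _ _ _ t trig_pair_hyperbolic) as [E2 [E3 E4]].
  assert (Hc0 : c 0 = 1) by (unfold c; rewrite E2, E4; field; lra).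
  assert (Hs0 : s 0 = 0) by (unfold s; rewrite (theta1_0 _ _ _ t trig_pair_hyperbolic), E2; field; lra).
  assert (Hcpos : forall v, 0 <= v < t / 2 -> 0 < c v).
  { intros v Hv. apply nonvanishing_pos; [assumption|lra|].
    intros u Hu. rewrite Rmin_left, Rmax_right in Hu by lra.
    destruct (theta23_cosh_pos t u Ht) as [T2 _]. pose proof (theta4_cosh_neq0 t u Ht ltac:(lra)).
    unfold c, Rdiv. repeat apply Rmult_integral_contrapositive_currified; try apply Rinv_neq_0_compat; lra. }
  assert (Hcend : c (t / 2) = 0).
  { destruct (theta23_cosh_pos t (t / 2) Ht) as [T2 _]. unfold c. rewrite theta4_cosh_half by assumption. field; lra. }
  set (p := fun u => RInt (fun z => nu t * d z) 0 u).
  assert (Hp : forall u, is_derive p u (nu t * d u)) by (intros u; now apply is_derive_RInt_scal).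
  assert (Hpc : forall x, continuous p x) by (intros x; eapply is_derive_continuous, Hp).
  assert (Hpar : forall v, 0 <= v < t / 2 -> c v = cos (p v) /\ legendre_F k' (p v) = nu t * v).
  { intros v Hv. apply (elliptic_param k' (nu t) s c d v); try assumption.
    intros u Hu. rewrite Rmin_left, Rmax_right in Hu by lra.
    split; [apply Hds|split; [|apply Hd]].
    destruct (Hder u) as [_ [c' [_ [_ [D _]]]]].
    (* The circle relation determines c c', and division by c is possible only before t/2; the end
       point is recovered below by continuity. *)
    replace (- (nu t * s u * d u)) with c'; [exact D|].
    pose proof (unit_circle_derivative _ _ _ _ _ (Hds u) D Hsc) as E.
    pose proof (Hcpos u ltac:(lra)). apply (Rmult_eq_reg_l (c u)); lra. }
  assert (HcE : c (t / 2) = cos (p (t / 2))).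
  { apply (eq_at_right_end c (fun v => cos (p v))); [apply Hcc| |lra|intros v Hv; now apply Hpar].
    apply (continuous_comp p cos); [apply Hpc|apply continuous_cos]. }
  assert (HpE : legendre_F k' (p (t / 2)) = nu t * (t / 2)).
  { apply (eq_at_right_end (fun v => legendre_F k' (p v)) (fun v => nu t * v)); [| |lra|intros v Hv; now apply Hpar].
    - apply (continuous_comp p (legendre_F k')); [apply Hpc|].
      eapply is_derive_continuous, is_derive_legendre. assumption.
    - apply (continuous_scal_r (V := R_NormedModule) (nu t) (fun v => v)), continuous_id. }
  rewrite <- HpE. f_equal. symmetry.
  destruct (quarter_period_angle p (t / 2)) as [E|E]; [assumption| |lra| | |exact E|].
  - apply (RInt_point (V := R_CompleteNormedModule)).
  - intros v Hv. destruct (Hpar v Hv) as [<- _]. now apply Hcpos.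
  - now rewrite <- HcE.
  (* At -pi/2 the integral would be negative, against nu t * (t/2) > 0. *)
  - exfalso. pose proof (nu_pos t Ht).
    assert (legendre_F k' (p (t / 2)) < legendre_F k' 0) by (apply legendre_F_lt; [assumption|lra]).
    rewrite legendre_F_0 in H0. assert (0 < nu t * (t / 2)) by (apply Rmult_lt_0_compat; lra). lra.
Qed.

Lemma nome_modk (t : R) : 0 < t -> nome (modk t) = exp (- t).
Proof.
  intros Ht. unfold nome. rewrite ellK_modk, ellK_compl_modk by assumption.
  pose proof (nu_pos t Ht). pose proof PI_RGT_0. f_equal. field. split; lra.
Qed.

Lemma jacobi_am_modk (t v : R) : 0 < t -> jacobi_am (nu t * v) (modk t) = amq t v.
Proof.
  intros Ht. destruct (amq_spec t v Ht) as [_ [_ <-]]. apply jacobi_am_legendre.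
  pose proof (modk_bounds t Ht). lra.
Qed.

Lemma exp_pow_INR (x : R) (n : nat) : exp x ^ n = exp (INR n * x).
Proof.
  induction n as [|n IH]; [simpl; now rewrite Rmult_0_l, exp_0|].
  rewrite S_INR, <- tech_pow_Rmult, IH, <- exp_plus. f_equal. ring.
Qed.

Lemma Theta_modk (t v : R) : 0 < t ->
  Theta (nu t * v) (modk t) = theta4 cos t v /\ Theta1 (nu t * v) (modk t) = theta3 cos t v.
Proof.
  intros Ht. pose proof (exp_type_fun _ _ (trig_c_type _ _ _ trig_pair_circular)) as Hc.
  pose proof (nu_pos t Ht). pose proof PI_RGT_0.
  assert (Hq : forall n, nome (modk t) ^ (S n ^ 2) = exp (- (t * INR (S n) ^ 2))).
  { intros n. rewrite nome_modk, exp_pow_INR, pow_INR by assumption. f_equal. ring. }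
  assert (Ha : forall n, INR (S n) * PI * (nu t * v) / ellK (modk t) = 2 * INR (S n) * v).
  { intros n. rewrite ellK_modk by assumption. field. split; lra. }
  unfold Theta, Theta1, theta3, theta4.
  rewrite !theta_gen_even_series; auto using is_sign_1, is_sign_m1, cos_neg.
  rewrite cos_0. split; do 2 f_equal; apply Series_ext; intros n; rewrite Hq, Ha; [reflexivity|].
  rewrite pow1. ring.
Qed.

(** * Logarithmic derivatives of w_plus and w_minus *)

(** The addition theorem with the constants expressed by k and k' and theta2 by cn, so that the
    shift y enters the last factor only through cn(y). *)
Lemma theta3_product (t v y : R) : 0 < t ->
  nul3 t ^ 2 * compl_modulus (modk t) ^ 2 * (theta3 cos t (v + y) * theta3 cos t (v - y)) =
  theta4 cos t v ^ 2 * theta4 cos t y ^ 2 *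
  (compl_modulus (modk t) ^ 2 + modk t ^ 2 * cnq t v ^ 2 * cnq t y ^ 2).
Proof.
  intros Ht. destruct (nul23_pos t Ht) as [N2 N3]. pose proof (nul4_neq0 t Ht) as N4.
  pose proof (theta4_cos_neq0 t v Ht) as T4. pose proof (theta4_cos_neq0 t y Ht) as T4'.
  pose proof (theta_addition _ _ _ t v y trig_pair_circular Ht) as P.
  transitivity (compl_modulus (modk t) ^ 2 *
    (nul3 t ^ 2 * (theta3 cos t (v + y) * theta3 cos t (v - y)))); [ring|].
  rewrite P, compl_modk by assumption. unfold modk, cnq. field. repeat split; lra.
Qed.

Lemma is_derive_product_pm (f : R -> R) (v y f1 f2 : R) :
  is_derive f (v + y) f1 -> is_derive f (v - y) f2 ->
  is_derive (fun v => f (v + y) * f (v - y)) v (f1 * f (v - y) + f (v + y) * f2) /\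
  is_derive (fun y => f (v + y) * f (v - y)) y (f1 * f (v - y) - f (v + y) * f2).
Proof.
  intros H1 H2.
  split; auto_derive; try (split; [now exists f1|split; [now exists f2|trivial]]);
    change (v + - y) with (v - y);
    rewrite (is_derive_unique (fun x : R => f x) _ _ H1), (is_derive_unique (fun x : R => f x) _ _ H2); ring.
Qed.

Lemma is_derive_theta4_product (f c : R -> R) (x a b1 b2 f' c' : R) :
  is_derive f x f' -> is_derive c x c' ->
  is_derive (fun x => f x ^ 2 * a ^ 2 * (b1 + b2 * c x ^ 2)) x
    (2 * f x * f' * a ^ 2 * (b1 + b2 * c x ^ 2) + f x ^ 2 * a ^ 2 * (b2 * (2 * c x * c'))).
Proof.
  intros Hf Hc. auto_derive; [repeat split; [now exists f'|now exists c']|].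
  rewrite (is_derive_unique (fun x : R => f x) _ _ Hf), (is_derive_unique (fun x : R => c x) _ _ Hc). ring.
Qed.

(* The logarithmic derivatives of [theta3_product] along [v] and along [y], added up. *)
Lemma theta_zeta_addition (t v y : R) : 0 < t ->
  Derive (theta3 cos t) (v + y) / theta3 cos t (v + y) =
  Derive (theta4 cos t) v / theta4 cos t v + Derive (theta4 cos t) y / theta4 cos t y
  - nu t * modk t ^ 2 * (cnq t y ^ 2 * (snq t v * cnq t v * dnq t v) + cnq t v ^ 2 * (snq t y * cnq t y * dnq t y))
    / (compl_modulus (modk t) ^ 2 + modk t ^ 2 * cnq t v ^ 2 * cnq t y ^ 2).
Proof.
  intros Ht. destruct (nul23_pos t Ht) as [N2 N3]. pose proof (nul4_neq0 t Ht) as N4.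
  pose proof (theta4_cos_neq0 t v Ht) as T4. pose proof (theta4_cos_neq0 t y Ht) as T4'.
  pose proof (theta3_cos_neq0 t (v + y) Ht) as T3. pose proof (theta3_cos_neq0 t (v - y) Ht) as T3'.
  destruct (ex_derive_theta _ _ _ t (v + y) trig_pair_circular Ht) as [_ [_ [[f1 F1] _]]].
  destruct (ex_derive_theta _ _ _ t (v - y) trig_pair_circular Ht) as [_ [_ [[f2 F2] _]]].
  destruct (ex_derive_theta _ _ _ t v trig_pair_circular Ht) as [_ [_ [_ [g1 G1]]]].
  destruct (ex_derive_theta _ _ _ t y trig_pair_circular Ht) as [_ [_ [_ [g2 G2]]]].
  destruct (is_derive_sncnq t v Ht) as [_ C1]. destruct (is_derive_sncnq t y Ht) as [_ C2].
  rewrite (is_derive_unique _ _ _ F1), (is_derive_unique _ _ _ G1), (is_derive_unique _ _ _ G2).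
  destruct (is_derive_product_pm _ v y _ _ F1 F2) as [L1 L2].
  pose proof (is_derive_theta4_product _ _ v (theta4 cos t y) (compl_modulus (modk t) ^ 2)
                (modk t ^ 2 * cnq t y ^ 2) _ _ G1 C1) as R1.
  pose proof (is_derive_theta4_product _ _ y (theta4 cos t v) (compl_modulus (modk t) ^ 2)
                (modk t ^ 2 * cnq t v ^ 2) _ _ G2 C2) as R2.
  set (A := nul3 t ^ 2 * compl_modulus (modk t) ^ 2) in *.
  set (k2 := modk t ^ 2) in *. set (k'2 := compl_modulus (modk t) ^ 2) in *.
  assert (Hk' : 0 < k'2).
  { unfold k'2. apply pow2_gt_0. rewrite compl_modk by assumption. apply Rgt_not_eq.
    apply Rdiv_lt_0_compat; [apply pow2_gt_0; assumption|now apply pow_lt]. }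
  assert (Hk2 : 0 <= k2) by apply pow2_ge_0.
  assert (EL1 : forall x, A * (theta3 cos t (x + y) * theta3 cos t (x - y))
    = theta4 cos t x ^ 2 * theta4 cos t y ^ 2 * (k'2 + k2 * cnq t y ^ 2 * cnq t x ^ 2)).
  { intros x. unfold A, k2, k'2. rewrite theta3_product by assumption. ring. }
  assert (EL2 : forall x, A * (theta3 cos t (v + x) * theta3 cos t (v - x))
    = theta4 cos t x ^ 2 * theta4 cos t v ^ 2 * (k'2 + k2 * cnq t v ^ 2 * cnq t x ^ 2)).
  { intros x. unfold A, k2, k'2. rewrite theta3_product by assumption. ring. }
  apply (is_derive_scal _ _ A) in L1. apply (is_derive_ext _ _ _ _ EL1) in L1.
  apply (is_derive_scal _ _ A) in L2. apply (is_derive_ext _ _ _ _ EL2) in L2.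
  apply is_derive_unique in L1. apply is_derive_unique in L2.
  apply is_derive_unique in R1. apply is_derive_unique in R2.
  apply (eq_trans (eq_sym R1)) in L1. apply (eq_trans (eq_sym R2)) in L2. clear R1 R2.
  pose proof (theta3_product t v y Ht) as P. fold k2 k'2 A in P.
  set (F := k'2 + k2 * cnq t v ^ 2 * cnq t y ^ 2) in *.
  assert (HF : 0 < F).
  { unfold F. assert (0 <= k2 * cnq t v ^ 2 * cnq t y ^ 2).
    { apply Rmult_le_pos; [apply Rmult_le_pos|]; try assumption; apply pow2_ge_0. } lra. }
  replace (k'2 + k2 * cnq t y ^ 2 * cnq t v ^ 2) with F in L1 by (unfold F; ring).
  set (th3 := theta3 cos t (v + y)) in *. set (th3' := theta3 cos t (v - y)) in *.
  set (u := theta4 cos t v) in *. set (w := theta4 cos t y) in *.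
  assert (E : A * (f1 * th3') = u ^ 2 * w ^ 2 * ((g1 / u + g2 / w) * F
     - nu t * k2 * (cnq t y ^ 2 * (snq t v * cnq t v * dnq t v) + cnq t v ^ 2 * (snq t y * cnq t y * dnq t y)))).
  { apply (Rmult_eq_reg_l 2); [|lra].
    transitivity (A * (f1 * th3' + th3 * f2) + A * (f1 * th3' - th3 * f2)); [ring|].
    rewrite <- L1, <- L2. field. split; assumption. }
  assert (HA : A <> 0).
  { intros HA. rewrite HA, Rmult_0_l in P. symmetry in P. revert P.
    apply Rmult_integral_contrapositive_currified; [|lra].
    apply Rmult_integral_contrapositive_currified; now apply pow_nonzero. }
  apply (Rmult_eq_reg_l (A * (th3 * th3'))).
  2:{ apply Rmult_integral_contrapositive_currified; [exact HA|].
      apply Rmult_integral_contrapositive_currified; [exact T3|exact T3']. }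
  transitivity (A * (f1 * th3')); [field; assumption|].
  rewrite E, P. field. repeat split; lra.
Qed.

(** This is sn dn = - cn', where dn is the positive root. *)
Definition jacobi_sndn (z k : R) : R := sin (jacobi_am z k) * sqrt (1 - k ^ 2 * sin (jacobi_am z k) ^ 2).

Lemma jacobi_quot_modk (t v : R) : 0 < t ->
  jacobi_cn (nu t * v) (modk t) = cnq t v /\ jacobi_sndn (nu t * v) (modk t) = snq t v * dnq t v.
Proof.
  intros Ht. unfold jacobi_cn, jacobi_sndn. rewrite jacobi_am_modk by assumption.
  destruct (amq_spec t v Ht) as [<- [<- _]]. split; [reflexivity|].
  rewrite <- dnq_sqr, sqrt_pow2 by (try left; try apply dnq_pos; assumption). reflexivity.
Qed.

Lemma jacobi_cn_0 (k : R) : 0 < k < 1 -> jacobi_cn 0 k = 1.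
Proof.
  intros Hk. unfold jacobi_cn. rewrite <- (legendre_F_0 k), jacobi_am_legendre by lra. apply cos_0.
Qed.

Lemma is_derive_unscale (f g : R -> R) (a x l : R) :
  a <> 0 -> (forall v, f (a * v) = g v) -> is_derive g (x / a) l -> is_derive f x (l / a).
Proof.
  intros Ha Hfg Hg. apply (is_derive_ext (fun z => g (z / a))).
  - intros z. rewrite <- Hfg. f_equal. field. assumption.
  - auto_derive; [now exists l|]. change (x * / a) with (x / a).
    rewrite (is_derive_unique (fun x : R => g x) _ _ Hg). field. assumption.
Qed.

Lemma is_derive_jacobi (k x : R) : 0 < k < 1 ->
  is_derive (fun x => jacobi_cn x k) x (- jacobi_sndn x k) /\
  is_derive (fun x => jacobi_sndn x k) x (jacobi_cn x k * (1 - 2 * k ^ 2 + 2 * k ^ 2 * jacobi_cn x k ^ 2)) /\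
  jacobi_sndn x k ^ 2 = (1 - jacobi_cn x k ^ 2) * (1 - k ^ 2 + k ^ 2 * jacobi_cn x k ^ 2).
Proof.
  intros Hk. destruct (modk_surjective k Hk) as [t [Ht <-]]. pose proof (nu_pos t Ht) as Hn.
  set (v := x / nu t). assert (Ex : x = nu t * v) by (unfold v; field; lra).
  destruct (is_derive_sncnq t v Ht) as [DS DC]. destruct (ex_derive_jacobi_quot t v Ht) as [_ [_ [d' DD]]].
  destruct (jacobi_quot_modk t v Ht) as [Ec Es].
  pose proof (snq2_cnq2 t v Ht) as Q1. pose proof (dnq_sqr t v Ht) as Q2. pose proof (dnq_pos t v Ht) as Q3.
  (* The derivative of dn is taken from dn^2 = 1 - k^2 sn^2 and then divided by dn > 0. *)
  assert (Hd' : dnq t v * d' = - modk t ^ 2 * snq t v * (nu t * cnq t v * dnq t v)).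
  { assert (D1 : is_derive (fun y => dnq t y ^ 2) v (2 * dnq t v * d')).
    { auto_derive; [exact (ex_intro _ _ DD)|]. rewrite (is_derive_unique (fun x : R => dnq t x) _ _ DD). ring. }
    assert (D2 : is_derive (fun y => dnq t y ^ 2) v (- modk t ^ 2 * (2 * snq t v * (nu t * cnq t v * dnq t v)))).
    { apply (is_derive_ext (fun y => 1 - modk t ^ 2 * snq t y ^ 2)); [intros y; now rewrite dnq_sqr|].
      auto_derive; [exact (ex_intro _ _ DS)|]. rewrite (is_derive_unique (fun x : R => snq t x) _ _ DS). ring. }
    apply is_derive_unique in D1. apply is_derive_unique in D2. lra. }
  assert (Hd : d' = - modk t ^ 2 * nu t * snq t v * cnq t v).
  { apply (Rmult_eq_reg_l (dnq t v)); [rewrite Hd'; ring|lra]. }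
  split; [|split].
  - rewrite Ex, Es, <- Ex.
    replace (- (snq t v * dnq t v)) with (- (nu t * snq t v * dnq t v) / nu t) by (field; lra).
    apply (is_derive_unscale _ (cnq t)); [lra|intros u; exact (proj1 (jacobi_quot_modk t u Ht))|exact DC].
  - rewrite Ex, Ec, <- Ex.
    replace (cnq t v * (1 - 2 * modk t ^ 2 + 2 * modk t ^ 2 * cnq t v ^ 2))
      with (((nu t * cnq t v * dnq t v) * dnq t v + snq t v * d') / nu t).
    + apply (is_derive_unscale _ (fun u => snq t u * dnq t u));
        [lra|intros u; exact (proj2 (jacobi_quot_modk t u Ht))|].
      fold v. auto_derive; [exact (conj (ex_intro _ _ DS) (conj (ex_intro _ _ DD) I))|].
      rewrite (is_derive_unique (fun x : R => snq t x) _ _ DS), (is_derive_unique (fun x : R => dnq t x) _ _ DD). ring.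
    + rewrite Hd. transitivity (cnq t v * (dnq t v ^ 2 - modk t ^ 2 * snq t v ^ 2)); [field; lra|].
      rewrite Q2. replace (snq t v ^ 2) with (1 - cnq t v ^ 2) by lra. ring.
  - rewrite Ex, Ec, Es, Rpow_mult_distr, Q2. replace (snq t v ^ 2) with (1 - cnq t v ^ 2) by lra. ring.
Qed.

(** T is 2K: two shifts of the theta argument by pi/2 send theta2 to its negative and fix theta4. *)
Lemma jacobi_cn_antiperiodic (k : R) : 0 < k < 1 ->
  exists T, forall x, jacobi_cn (x + T) k = - jacobi_cn x k.
Proof.
  intros Hk. destruct (modk_surjective k Hk) as [t [Ht <-]]. pose proof (nu_pos t Ht) as Hn.
  exists (nu t * PI). intros x. set (v := x / nu t). assert (Ex : x = nu t * v) by (unfold v; field; lra).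
  rewrite Ex, <- Rmult_plus_distr_l. destruct (jacobi_quot_modk t v Ht) as [-> _].
  destruct (jacobi_quot_modk t (v + PI) Ht) as [-> _].
  destruct (theta_cos_half_period t v) as [E4 [E3 [E2 E1]]].
  destruct (theta_cos_half_period t (v + PI / 2)) as [E4' [E3' [E2' E1']]].
  replace (v + PI / 2 + PI / 2) with (v + PI) in * by field.
  unfold cnq. rewrite E2', E1, E4', E3. field. split; [apply theta4_cos_neq0; assumption|].
  destruct (nul23_pos t Ht). lra.
Qed.

(** In [theta_zeta_addition] the zeta term at v is cancelled by the denominator theta4 and the one
    at y by the exponential, which leaves an elliptic function of v as logarithmic derivative. *)
Lemma theta_shift_exp_derive (t y v : R) : 0 < t ->
  let wf := fun v => theta3 cos t (v + y) / theta4 cos t v * exp (- (v * (Derive (theta4 cos t) y / theta4 cos t y))) in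
  is_derive wf v (- nu t * modk t ^ 2 *
     (cnq t y ^ 2 * (snq t v * cnq t v * dnq t v) + cnq t v ^ 2 * (snq t y * cnq t y * dnq t y))
     / (compl_modulus (modk t) ^ 2 + modk t ^ 2 * cnq t v ^ 2 * cnq t y ^ 2) * wf v).
Proof.
  intros Ht wf. pose proof (theta_zeta_addition t v y Ht) as Z.
  pose proof (theta4_cos_neq0 t v Ht) as T4. pose proof (theta3_cos_neq0 t (v + y) Ht) as T3.
  destruct (ex_derive_theta _ _ _ t (v + y) trig_pair_circular Ht) as [_ [_ [[f1 F1] _]]].
  destruct (ex_derive_theta _ _ _ t v trig_pair_circular Ht) as [_ [_ [_ [g1 G1]]]].
  rewrite (is_derive_unique _ _ _ F1), (is_derive_unique _ _ _ G1) in Z.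
  unfold wf. set (z := Derive (theta4 cos t) y / theta4 cos t y) in *.
  set (E := nu t * modk t ^ 2 * _ / _) in Z.
  replace (- nu t * modk t ^ 2 * _ / _) with (- E) by (unfold E, Rdiv; ring).
  replace (- E) with (f1 / theta3 cos t (v + y) - g1 / theta4 cos t v - z) by lra.
  auto_derive; [repeat split; [now exists f1|now exists g1|assumption]|].
  rewrite (is_derive_unique (fun x : R => theta3 cos t x) _ _ F1), (is_derive_unique (fun x : R => theta4 cos t x) _ _ G1).
  field. split; assumption.
Qed.

Lemma Derive_theta4_odd (t y : R) : 0 < t -> Derive (theta4 cos t) (- y) = - Derive (theta4 cos t) y.
Proof.
  intros Ht. destruct (ex_derive_theta _ _ _ t y trig_pair_circular Ht) as [_ [_ [_ [g G]]]].
  rewrite (is_derive_unique _ _ _ G). apply is_derive_unique.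
  apply (is_derive_ext (fun x => theta4 cos t (- x))).
  - intros x. apply (theta_even _ _ _ t x trig_pair_circular).
  - auto_derive; rewrite Ropp_involutive; [now exists g|].
    rewrite (is_derive_unique (fun x : R => theta4 cos t x) _ _ G). ring.
Qed.

Lemma quot_parity (t y : R) : snq t (- y) = - snq t y /\ cnq t (- y) = cnq t y /\ dnq t (- y) = dnq t y.
Proof.
  destruct (theta_even _ _ _ t y trig_pair_circular) as [E2 [E3 [E4 E1]]].
  unfold snq, cnq, dnq. rewrite E1, E2, E3, E4. repeat split. unfold Rdiv. ring.
Qed.

Lemma wavelike_bounds (k : R) : wavelike_modulus k ->
  0 < k < 1 /\ 0 < 2 * k ^ 2 - 1 /\ 0 < compl_modulus k /\ compl_modulus k ^ 2 = 1 - k ^ 2 /\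
  0 < compl_modulus k / k < 1.
Proof.
  intros [H1 H2]. assert (Hs : 0 < 1 / sqrt 2).
  { apply Rdiv_lt_0_compat; [lra|apply sqrt_lt_R0; lra]. }
  assert (Hsq : (1 / sqrt 2) ^ 2 = 1 / 2).
  { unfold Rdiv. rewrite !Rmult_1_l, pow_inv, pow2_sqrt by lra. reflexivity. }
  assert (Hk2 : 1 / 2 < k ^ 2) by nra.
  assert (Hc : 0 < compl_modulus k) by (apply sqrt_lt_R0; nra).
  assert (Hc2 : compl_modulus k ^ 2 = 1 - k ^ 2) by (apply pow2_sqrt; nra).
  repeat split; try lra.
  - apply Rdiv_lt_0_compat; lra.
  - apply Rmult_lt_reg_r with k; [lra|]. unfold Rdiv. rewrite Rmult_assoc, Rinv_l by lra. nra.
Qed.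

Lemma alpha_legendre (k : R) : wavelike_modulus k -> alpha k = legendre_F k (asin (compl_modulus k / k)).
Proof.
  intros Hw. destruct (wavelike_bounds _ Hw) as [Hk [_ [_ [_ Hr]]]].
  unfold alpha. apply ellF_legendre; lra.
Qed.

(** The reason for the choice of alpha: k^2 cn(alpha)^2 = 2k^2 - 1, so the denominator of the
    logarithmic derivatives becomes k'^2 + (2k^2 - 1) cn^2, a constant multiple of kappa^2 +
    |mu|. *)
Lemma alpha_modk (t : R) : 0 < t -> wavelike_modulus (modk t) ->
  exists a, alpha (modk t) = nu t * a /\
    snq t a = compl_modulus (modk t) / modk t /\
    cnq t a = sqrt (2 * modk t ^ 2 - 1) / modk t /\ dnq t a = modk t.
Proof.
  intros Ht Hw. destruct (wavelike_bounds _ Hw) as [Hk [Hs2 [Hc [Hc2 Hr]]]]. pose proof (nu_pos t Ht) as Hn.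
  set (k := modk t) in *. set (k' := compl_modulus k) in *.
  pose proof (alpha_legendre k Hw) as Ea. fold k' in Ea.
  exists (alpha k / nu t). split; [field; lra|].
  assert (Eam : amq t (alpha k / nu t) = asin (k' / k)).
  { rewrite <- jacobi_am_modk by assumption. fold k.
    replace (nu t * (alpha k / nu t)) with (alpha k) by (field; lra).
    rewrite Ea. apply jacobi_am_legendre. lra. }
  destruct (amq_spec t (alpha k / nu t) Ht) as [E1 [E2 _]]. rewrite Eam in E1, E2.
  rewrite sin_asin in E1 by lra. split; [assumption|].
  assert (Hsig : 0 < sqrt (2 * k ^ 2 - 1)) by now apply sqrt_lt_R0.
  assert (Hsig2 : sqrt (2 * k ^ 2 - 1) ^ 2 = 2 * k ^ 2 - 1) by (apply pow2_sqrt; lra).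
  split.
  - assert (Hcos : 0 <= cnq t (alpha k / nu t)).
    { rewrite E2. pose proof (asin_bound (k' / k)). apply cos_ge_0; lra. }
    pose proof (snq2_cnq2 t (alpha k / nu t) Ht) as Q. rewrite E1 in Q.
    apply Rsqr_inj; [assumption|left; now apply Rdiv_lt_0_compat|].
    rewrite !Rsqr_pow2. replace ((sqrt (2 * k ^ 2 - 1) / k) ^ 2) with (sqrt (2 * k ^ 2 - 1) ^ 2 / k ^ 2) by (field; lra).
    replace ((k' / k) ^ 2) with (k' ^ 2 / k ^ 2) in Q by (field; lra).
    rewrite Hsig2. rewrite Hc2 in Q. apply (Rplus_eq_reg_l ((1 - k ^ 2) / k ^ 2)). rewrite Q. field. lra.
  - pose proof (dnq_sqr t (alpha k / nu t) Ht) as Q. fold k in Q. rewrite E1 in Q.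
    apply Rsqr_inj; [left; now apply dnq_pos|lra|]. rewrite !Rsqr_pow2, Q.
    replace (k ^ 2 * (k' / k) ^ 2) with (k' ^ 2) by (field; lra). rewrite Hc2. ring.
Qed.

(** Since zeta is odd, [w_minus] is [w_plus] with -alpha for alpha, so both derivatives come from
    [theta_shift_exp_derive]; the constant [b] is k^2 sn cn dn at alpha. In the product the
    exponentials cancel and [theta3_product] applies. *)
Lemma w_pm_facts (k : R) : wavelike_modulus k ->
  w_plus k 0 = w_minus k 0 /\ w_plus k 0 <> 0 /\
  forall x,
    let c := jacobi_cn x k in let q := compl_modulus k ^ 2 + (2 * k ^ 2 - 1) * c ^ 2 in
    let b := k * compl_modulus k * sqrt (2 * k ^ 2 - 1) in
    is_derive (w_plus k) x (- ((2 * k ^ 2 - 1) * c * jacobi_sndn x k + b * c ^ 2) / q * w_plus k x) /\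
    is_derive (w_minus k) x (- ((2 * k ^ 2 - 1) * c * jacobi_sndn x k - b * c ^ 2) / q * w_minus k x) /\
    k ^ 2 * (w_plus k x * w_minus k x) = w_plus k 0 ^ 2 * q.
Proof.
  intros Hw. destruct (wavelike_bounds _ Hw) as [Hk [Hs2 [Hc [Hc2 Hr]]]].
  destruct (modk_surjective k Hk) as [t [Ht Ek]]. subst k. pose proof (nu_pos t Ht) as Hn.
  destruct (alpha_modk t Ht Hw) as [a [Ea [Sa [Ca Da]]]].
  set (k := modk t) in *. set (k' := compl_modulus k) in *. set (sg := sqrt (2 * k ^ 2 - 1)) in *.
  assert (Hsg : sg ^ 2 = 2 * k ^ 2 - 1) by (apply pow2_sqrt; lra).
  set (Z := Derive (theta4 cos t) a / theta4 cos t a).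
  assert (Hzeta : zeta (alpha k) k = Z / nu t).
  { unfold zeta. rewrite Ea. destruct (Theta_modk t a Ht) as [E _]. fold k in E. rewrite E.
    destruct (ex_derive_theta _ _ _ t a trig_pair_circular Ht) as [_ [_ [_ [g G]]]].
    unfold Z. rewrite (is_derive_unique _ _ _ G).
    rewrite (is_derive_unique (fun x : R => Theta x k) (nu t * a) (g / nu t)).
    - field. split; [now apply theta4_cos_neq0|lra].
    - apply (is_derive_unscale _ (theta4 cos t)); [lra|intros u; exact (proj1 (Theta_modk t u Ht))|].
      replace (nu t * a / nu t) with a by (field; lra). exact G. }
  assert (HT : forall u, Theta (nu t * u) k = theta4 cos t u) by (intros u; exact (proj1 (Theta_modk t u Ht))).
  assert (HT1 : forall u, Theta1 (nu t * u) k = theta3 cos t u) by (intros u; exact (proj2 (Theta_modk t u Ht))).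
  assert (Hp : forall v, w_plus k (nu t * v) = theta3 cos t (v + a) / theta4 cos t v * exp (- (v * Z))).
  { intros v. unfold w_plus. rewrite Hzeta, Ea.
    replace (nu t * v + nu t * a) with (nu t * (v + a)) by ring.
    rewrite HT, HT1.
    f_equal. f_equal. field. lra. }
  assert (Hm : forall v, w_minus k (nu t * v) = theta3 cos t (v + - a) / theta4 cos t v
      * exp (- (v * (Derive (theta4 cos t) (- a) / theta4 cos t (- a))))).
  { intros v. unfold w_minus. rewrite Hzeta, Ea.
    replace (nu t * v - nu t * a) with (nu t * (v + - a)) by ring.
    rewrite HT, HT1.
    rewrite Derive_theta4_odd by assumption.
    destruct (theta_even _ _ _ t a trig_pair_circular) as [_ [_ [-> _]]].
    f_equal. f_equal. unfold Z. field. split; [now apply theta4_cos_neq0|lra]. }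
  destruct (theta_even _ _ _ t a trig_pair_circular) as [_ [P3 [P4 _]]].
  assert (Hp0 : w_plus k 0 = theta3 cos t a / nul4 t).
  { rewrite <- (Rmult_0_r (nu t)), Hp, Rplus_0_l, Rmult_0_l, Ropp_0, exp_0. unfold nul4. ring. }
  assert (Hm0 : w_minus k 0 = theta3 cos t a / nul4 t).
  { rewrite <- (Rmult_0_r (nu t)), Hm, Rplus_0_l, Rmult_0_l, Ropp_0, exp_0, P3. unfold nul4. ring. }
  pose proof (nul4_neq0 t Ht) as N4. pose proof (theta3_cos_neq0 t a Ht) as T3a.
  split; [congruence|]. split.
  { rewrite Hp0. unfold Rdiv. apply Rmult_integral_contrapositive_currified; [assumption|now apply Rinv_neq_0_compat]. }
  intros x c q b. set (v := x / nu t). assert (Ex : x = nu t * v) by (unfold v; field; lra).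
  destruct (jacobi_quot_modk t v Ht) as [Ec Es]. fold k in Ec, Es. rewrite <- Ex in Ec, Es. fold c in Ec.
  destruct (quot_parity t a) as [S' [C' D']].
  pose proof (theta_shift_exp_derive t a v Ht) as DP. pose proof (theta_shift_exp_derive t (- a) v Ht) as DM.
  cbv zeta in DP, DM. rewrite S', C', D' in DM. rewrite Sa, Ca, Da in DP. rewrite Sa, Ca, Da in DM.
  fold k in DP, DM. fold k' in DP, DM. fold Z in DP. rewrite <- Hp in DP. rewrite <- Hm in DM.
  rewrite <- Ex, <- Ec in DP, DM. rewrite Es.
  assert (Hq : k' ^ 2 + k ^ 2 * c ^ 2 * (sg / k) ^ 2 = q).
  { unfold q. rewrite <- Hsg. fold k'. field. lra. }
  assert (Hq0 : 0 < q).
  { unfold q. fold k'. pose proof (pow2_ge_0 c). assert (0 < k' ^ 2) by now apply pow_lt. nra. }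
  rewrite Hq in DP, DM.
  split; [|split].
  - apply (is_derive_unscale (w_plus k) _ (nu t) x _ (Rgt_not_eq _ _ Hn) Hp) in DP.
    apply (is_derive_val _ _ _ _ DP). rewrite <- Hsg. unfold b. field. repeat split; lra.
  - apply (is_derive_unscale (w_minus k) _ (nu t) x _ (Rgt_not_eq _ _ Hn) Hm) in DM.
    apply (is_derive_val _ _ _ _ DM). rewrite <- Hsg. unfold b. field. repeat split; lra.
  - assert (Hprod : forall u, nul3 t ^ 2 * k' ^ 2 * (w_plus k (nu t * u) * w_minus k (nu t * u))
                       = theta4 cos t a ^ 2 * (k' ^ 2 + k ^ 2 * cnq t u ^ 2 * (sg / k) ^ 2)).
    { intros u. pose proof (theta4_cos_neq0 t u Ht) as T4. pose proof (theta3_product t u a Ht) as P.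
      fold k in P. fold k' in P. rewrite Ca in P.
      rewrite Hp, Hm, Derive_theta4_odd, P4 by assumption.
      replace (- (u * (- Derive (theta4 cos t) a / theta4 cos t a))) with (u * Z)
        by (unfold Z; field; now apply theta4_cos_neq0).
      change (u + - a) with (u - a). rewrite exp_Ropp.
      transitivity (nul3 t ^ 2 * k' ^ 2 * (theta3 cos t (u + a) * theta3 cos t (u - a)) / theta4 cos t u ^ 2).
      - field. split; [assumption|apply Rgt_not_eq, exp_pos].
      - rewrite P. field. split; [lra|assumption]. }
    pose proof (Hprod v) as H1. pose proof (Hprod 0) as H0. rewrite Rmult_0_r in H0.
    destruct (jacobi_quot_0 t Ht) as [_ [C0 _]]. rewrite C0 in H0.
    rewrite <- Ex, <- Ec, Hq in H1. rewrite Hm0, <- Hp0 in H0.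
    (* At x = 0 the quadratic [q] equals k^2; this is the factor k^2 in the product formula. *)
    replace (k' ^ 2 + k ^ 2 * 1 ^ 2 * (sg / k) ^ 2) with (k ^ 2) in H0.
    2:{ rewrite Hc2. transitivity (1 - k ^ 2 + sg ^ 2); [rewrite Hsg; ring|field; lra]. }
    assert (HA : nul3 t ^ 2 * k' ^ 2 <> 0).
    { apply Rgt_not_eq, Rmult_lt_0_compat; apply pow_lt; [apply nul23_pos; assumption|assumption]. }
    apply (Rmult_eq_reg_l (nul3 t ^ 2 * k' ^ 2)); [|assumption].
    transitivity (k ^ 2 * (nul3 t ^ 2 * k' ^ 2 * (w_plus k x * w_minus k x))); [ring|]. rewrite H1.
    transitivity (nul3 t ^ 2 * k' ^ 2 * (w_plus k 0 * w_plus k 0) * q); [rewrite H0; ring|ring].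
Qed.

(** * Moving frames of elastic curves *)

(** Derivatives are kept as functions, so a differential system that expresses them through its own
    unknowns gains one order at each induction step. *)
Fixpoint Ck (n : nat) (f : R -> R) : Prop :=
  match n with
  | O => True
  | S n => exists f', (forall x, is_derive f x (f' x)) /\ Ck n f'
  end.

Lemma Ck_pred (n : nat) (f : R -> R) : Ck (S n) f -> Ck n f.
Proof.
  revert f. induction n as [|n IH]; intros f; [easy|]. intros [f' [H1 H2]]. exists f'. auto.
Qed.

Lemma Ck_ext (n : nat) (f g : R -> R) : (forall x, f x = g x) -> Ck n f -> Ck n g.
Proof.
  destruct n; [easy|]. intros E [f' [H1 H2]]. exists f'. split; [|assumption].
  intros x. now apply (is_derive_ext f).
Qed.

Lemma Ck_const (n : nat) (c : R) : Ck n (fun _ => c).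
Proof.
  revert c. induction n as [|n IH]; intros c; [easy|]. exists (fun _ => 0). split; [|apply IH].
  intros x. auto_derive; [trivial|ring].
Qed.

Lemma Ck_plus (n : nat) (f g : R -> R) : Ck n f -> Ck n g -> Ck n (fun x => f x + g x).
Proof.
  revert f g. induction n as [|n IH]; intros f g; [easy|]. intros [f' [F1 F2]] [g' [G1 G2]].
  exists (fun x => f' x + g' x). split; [|now apply IH].
  intros x. apply (is_derive_plus f g); auto.
Qed.

Lemma Ck_mult (n : nat) (f g : R -> R) : Ck n f -> Ck n g -> Ck n (fun x => f x * g x).
Proof.
  revert f g. induction n as [|n IH]; intros f g; [easy|]. intros Hf Hg.
  pose proof (Ck_pred _ _ Hf) as Pf. pose proof (Ck_pred _ _ Hg) as Pg.
  destruct Hf as [f' [F1 F2]]. destruct Hg as [g' [G1 G2]].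
  exists (fun x => f' x * g x + f x * g' x). split; [|apply Ck_plus; now apply IH].
  intros x. auto_derive; [split; [exact (ex_intro _ _ (F1 x))|exact (conj (ex_intro _ _ (G1 x)) I)]|].
  rewrite (is_derive_unique (fun x : R => f x) _ _ (F1 x)), (is_derive_unique (fun x : R => g x) _ _ (G1 x)). ring.
Qed.

Lemma Ck_inv (n : nat) (f : R -> R) : (forall x, f x <> 0) -> Ck n f -> Ck n (fun x => / f x).
Proof.
  intros H0. induction n as [|n IH]; [easy|]. intros Hf. pose proof (Ck_pred _ _ Hf) as Pf.
  destruct Hf as [f' [F1 F2]]. exists (fun x => -1 * f' x * (/ f x * / f x)). split.
  - intros x. auto_derive; [exact (conj (ex_intro _ _ (F1 x)) (conj (H0 x) I))|].
    rewrite (is_derive_unique (fun x : R => f x) _ _ (F1 x)). field. apply H0.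
  - apply Ck_mult; [apply Ck_mult; [apply Ck_const|assumption]|apply Ck_mult; auto].
Qed.

Lemma Ck_Derive_n (n j : nat) (f : R -> R) :
  Ck (n + j) f -> exists g, (forall x, Derive_n f n x = g x) /\ Ck j g.
Proof.
  revert j. induction n as [|n IH]; intros j H; [now exists f|].
  replace (S n + j)%nat with (n + S j)%nat in H by lia.
  destruct (IH (S j) H) as [g [Eg [g' [G1 G2]]]]. exists g'. split; [|assumption].
  intros x. simpl. rewrite (Derive_ext _ g) by assumption. now apply is_derive_unique.
Qed.

Lemma Ck_smooth (f : R -> R) : (forall n, Ck n f) -> smooth f.
Proof.
  intros H [|n] s; [easy|]. destruct (Ck_Derive_n n 1 f (H _)) as [g [Eg [g' [G1 _]]]].
  simpl. apply (ex_derive_ext g); [now intros x|]. now exists (g' s).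
Qed.

(* Moving frame in the hyperboloid model: for a curve [X] with unit tangent [T] and normal [N] one has
   [X' = T], [T' = X + K N], [N' = - K T]; [(u, t, n)] are the products of [X], [T], [N] with a fixed
   vector of Minkowski space. *)
Definition frame_coords (K u t n : R -> R) : Prop :=
  forall s, is_derive u s (t s) /\ is_derive t s (u s + K s * n s) /\ is_derive n s (- (K s * t s)).

Lemma frame_coords_plus (K u t n u' t' n' : R -> R) :
  frame_coords K u t n -> frame_coords K u' t' n' ->
  frame_coords K (fun s => u s + u' s) (fun s => t s + t' s) (fun s => n s + n' s).
Proof.
  intros H H' s. destruct (H s) as [U [T N]]. destruct (H' s) as [U' [T' N']]. split; [|split].
  - apply (is_derive_plus u u'); assumption.
  - replace (u s + u' s + K s * (n s + n' s)) with (u s + K s * n s + (u' s + K s * n' s)) by ring.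
    apply (is_derive_plus t t'); assumption.
  - replace (- (K s * (t s + t' s))) with (- (K s * t s) + - (K s * t' s)) by ring.
    apply (is_derive_plus n n'); assumption.
Qed.

Lemma frame_coords_scal (K u t n : R -> R) (a : R) :
  frame_coords K u t n -> frame_coords K (fun s => a * u s) (fun s => a * t s) (fun s => a * n s).
Proof.
  intros H s. destruct (H s) as [U [T N]]. split; [|split].
  - apply is_derive_scal; assumption.
  - replace (a * u s + K s * (a * n s)) with (a * (u s + K s * n s)) by ring. apply is_derive_scal; assumption.
  - replace (- (K s * (a * t s))) with (a * - (K s * t s)) by ring. apply is_derive_scal; assumption.
Qed.

Definition mink (u t n u' t' n' : R) : R := - (u * u') + t * t' + n * n'.

Lemma is_derive_0_const (f : R -> R) : (forall s, is_derive f s 0) -> forall s, f s = f 0.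
Proof. intros H s. apply derive_0_const. auto. Qed.

(** The frame is Minkowski-orthonormal with X timelike, so this is the product of two fixed
    vectors. *)
Lemma frame_coords_mink (K u t n u' t' n' : R -> R) :
  frame_coords K u t n -> frame_coords K u' t' n' ->
  forall s, mink (u s) (t s) (n s) (u' s) (t' s) (n' s) = mink (u 0) (t 0) (n 0) (u' 0) (t' 0) (n' 0).
Proof.
  intros H H'. apply (is_derive_0_const (fun s => mink (u s) (t s) (n s) (u' s) (t' s) (n' s))).
  intros s. destruct (H s) as [U [T N]]. destruct (H' s) as [U' [T' N']]. unfold mink. auto_derive.
  - repeat split; eapply is_derive_ex; eassumption.
  - rewrite (is_derive_unique (fun x : R => u x) _ _ U), (is_derive_unique (fun x : R => t x) _ _ T),
      (is_derive_unique (fun x : R => n x) _ _ N), (is_derive_unique (fun x : R => u' x) _ _ U'),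
      (is_derive_unique (fun x : R => t' x) _ _ T'), (is_derive_unique (fun x : R => n' x) _ _ N'). ring.
Qed.

(** The tangent coordinate is u', and t' = u + K n determines n where K is nonzero. As n' = - K t
    fixes n up to a constant, one such point is enough. *)
Lemma frame_coords_unique_normal (K u t n u' t' n' : R -> R) :
  frame_coords K u t n -> frame_coords K u' t' n' -> (exists s, K s <> 0) ->
  (forall s, u s = u' s) -> (forall s, t s = t' s) /\ (forall s, n s = n' s).
Proof.
  intros H H' [s0 Hs0] Eu.
  assert (Et : forall s, t s = t' s).
  { intros s. destruct (H s) as [U _]. destruct (H' s) as [U' _].
    apply (is_derive_ext _ u') in U; [|assumption].
    apply is_derive_unique in U. apply is_derive_unique in U'. congruence. }
  split; [assumption|].
  assert (E0 : n s0 = n' s0).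
  { destruct (H s0) as [_ [T _]]. destruct (H' s0) as [_ [T' _]].
    apply (is_derive_ext _ t') in T; [|assumption].
    apply is_derive_unique in T. apply is_derive_unique in T'. rewrite T, Eu in T'.
    apply (Rmult_eq_reg_l (K s0)); lra. }
  assert (Hc : forall s, n s - n' s = n 0 - n' 0).
  { apply (is_derive_0_const (fun s => n s - n' s)). intros s.
    destruct (H s) as [_ [_ N]]. destruct (H' s) as [_ [_ N']].
    replace 0 with (- (K s * t s) - - (K s * t' s)) by (rewrite Et; ring).
    apply (is_derive_minus n n'); assumption. }
  intros s. pose proof (Hc s). pose proof (Hc s0). lra.
Qed.

(* [u = 1 / gamma2] and [v = gamma1 / gamma2] are the coordinates of the hyperboloid model along two fixed
   vectors, a null one and a spacelike one. *)
Lemma curve_frame_coords (K g1 g2 phi : R -> R) :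
  (forall s, 0 < g2 s) -> (forall s, is_derive g1 s (g2 s * cos (phi s))) ->
  (forall s, is_derive g2 s (g2 s * sin (phi s))) -> (forall s, is_derive phi s (K s - cos (phi s))) ->
  frame_coords K (fun s => 1 / g2 s) (fun s => - sin (phi s) / g2 s) (fun s => - cos (phi s) / g2 s) /\
  frame_coords K (fun s => g1 s / g2 s) (fun s => cos (phi s) - g1 s / g2 s * sin (phi s))
    (fun s => - sin (phi s) - g1 s / g2 s * cos (phi s)).
Proof.
  intros Hp H1 H2 Hphi.
  assert (Hs : forall s, cos (phi s) ^ 2 = 1 - sin (phi s) ^ 2).
  { intros s. pose proof (sin2_cos2 (phi s)) as E. rewrite !Rsqr_pow2 in E. lra. }
  split; intros s; pose proof (Rgt_not_eq _ _ (Hp s)) as Hn.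
  - split; [|split]; (auto_derive; [repeat split; try assumption; eapply is_derive_ex; eauto|]);
      rewrite ?(is_derive_unique (fun x : R => g1 x) _ _ (H1 s)), ?(is_derive_unique (fun x : R => g2 x) _ _ (H2 s)),
      ?(is_derive_unique (fun x : R => phi x) _ _ (Hphi s)).
    + field. assumption.
    + transitivity ((sin (phi s) ^ 2 + cos (phi s) ^ 2 - K s * cos (phi s)) / g2 s); [field; assumption|].
      rewrite Hs. field. assumption.
    + field. assumption.
  - split; [|split]; (auto_derive; [repeat split; try assumption; eapply is_derive_ex; eauto|]);
      rewrite ?(is_derive_unique (fun x : R => g1 x) _ _ (H1 s)), ?(is_derive_unique (fun x : R => g2 x) _ _ (H2 s)),
      ?(is_derive_unique (fun x : R => phi x) _ _ (Hphi s)).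
    + field. assumption.
    + transitivity (g1 s / g2 s * (sin (phi s) ^ 2 + cos (phi s) ^ 2) - K s * sin (phi s)
        - g1 s / g2 s * K s * cos (phi s)); [field; assumption|].
      rewrite Hs. field. assumption.
    + transitivity ((sin (phi s) ^ 2 + cos (phi s) ^ 2 - 1) + 0 - K s * cos (phi s) + g1 s / g2 s * K s * sin (phi s)
        - (sin (phi s) ^ 2 + cos (phi s) ^ 2 - 1)); [field; assumption|].
      rewrite Hs. field. assumption.
Qed.

(* The vector [K X - K1 T + (K^2/2) N] is constant and spacelike. [Pp] and [Pm] are the coordinates of [X]
   along the two null directions orthogonal to it; these are the [T] and [N] coordinates. *)
Definition null_tangent (r K K1 P : R) : R := (K * K1 - r / 2 * K ^ 2) / (K ^ 2 + r ^ 2) * P.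
Definition null_normal (r K K1 P : R) : R := (- r * K1 - K ^ 3 / 2) / (K ^ 2 + r ^ 2) * P.

(** [ef_energy] says that the constant vector has Minkowski square r^2, and [ef_prod] scales the two
    null vectors so that their product is -2 r^2. *)
Record elastic_frame (r : R) (K K1 Pp Pm : R -> R) : Prop := {
  ef_r : 0 < r;
  ef_K : forall s, is_derive K s (K1 s);
  ef_K1 : forall s, is_derive K1 s (K s - K s ^ 3 / 2);
  ef_energy : forall s, K1 s ^ 2 = r ^ 2 + K s ^ 2 - K s ^ 4 / 4;
  ef_Pp : forall s, is_derive Pp s (null_tangent r (K s) (K1 s) (Pp s));
  ef_Pm : forall s, is_derive Pm s (null_tangent (- r) (K s) (K1 s) (Pm s));
  ef_prod : forall s, Pp s * Pm s = K s ^ 2 + r ^ 2;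
  ef_pos : forall s, 0 < Pp s /\ 0 < Pm s;
  ef_neq0 : exists s, K s <> 0 }.

Lemma frame_coords_curvature (r : R) (K K1 Pp Pm : R -> R) :
  elastic_frame r K K1 Pp Pm -> frame_coords K K K1 (fun s => - K s ^ 2 / 2).
Proof.
  intros H s. split; [apply (ef_K _ _ _ _ _ H)|split].
  - replace (K s + K s * (- K s ^ 2 / 2)) with (K s - K s ^ 3 / 2) by field. apply (ef_K1 _ _ _ _ _ H).
  - pose proof (ef_K _ _ _ _ _ H s) as D. auto_derive; [exact (ex_intro _ _ D)|].
    rewrite (is_derive_unique (fun x : R => K x) _ _ D). field.
Qed.

(** The defects of the last two frame equations are multiples of the energy identity. The sign of r
    is left open because -r serves the second null direction. *)
Lemma frame_coords_null (r : R) (K K1 P : R -> R) :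
  r <> 0 -> (forall s, is_derive K s (K1 s)) -> (forall s, is_derive K1 s (K s - K s ^ 3 / 2)) ->
  (forall s, K1 s ^ 2 = r ^ 2 + K s ^ 2 - K s ^ 4 / 4) ->
  (forall s, is_derive P s (null_tangent r (K s) (K1 s) (P s))) ->
  frame_coords K P (fun s => null_tangent r (K s) (K1 s) (P s)) (fun s => null_normal r (K s) (K1 s) (P s)).
Proof.
  intros Hr HK HK1 HE HP s.
  assert (HD : K s ^ 2 + r ^ 2 <> 0) by (pose proof (pow2_gt_0 r Hr); pose proof (pow2_ge_0 (K s)); lra).
  assert (HD' : K s * (K s * 1) + r * (r * 1) <> 0) by (intros E; apply HD; rewrite <- E; ring).
  split; [apply HP|split]; unfold null_tangent, null_normal;
    (auto_derive; [repeat split; try assumption; eapply is_derive_ex; eauto|]);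
    rewrite (is_derive_unique (fun x : R => K x) _ _ (HK s)), (is_derive_unique (fun x : R => K1 x) _ _ (HK1 s)),
      (is_derive_unique (fun x : R => P x) _ _ (HP s)); unfold null_tangent; apply Rminus_diag_uniq.
  - transitivity (r ^ 2 * (K1 s ^ 2 - (r ^ 2 + K s ^ 2 - K s ^ 4 / 4)) / (K s ^ 2 + r ^ 2) ^ 2 * P s); [field; lra|].
    rewrite HE. field. lra.
  - transitivity (r * K s * (K1 s ^ 2 - (r ^ 2 + K s ^ 2 - K s ^ 4 / 4)) / (K s ^ 2 + r ^ 2) ^ 2 * P s); [field; lra|].
    rewrite HE. field. lra.
Qed.

(** The three minors form the cross product with the constant vector, of which a null vector
    orthogonal to it is an eigenvector with eigenvalue r up to sign. *)
Lemma null_vector_products (r K K1 P : R) :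
  r <> 0 -> K1 ^ 2 = r ^ 2 + K ^ 2 - K ^ 4 / 4 ->
  let T := null_tangent r K K1 P in let N := null_normal r K K1 P in
  mink P T N P T N = 0 /\ mink P T N K K1 (- K ^ 2 / 2) = 0 /\
  P * K1 - T * K = - r * N /\ P * (- K ^ 2 / 2) - N * K = r * T /\ T * (- K ^ 2 / 2) - N * K1 = r * P.
Proof.
  intros Hr E T N.
  assert (HD : K ^ 2 + r ^ 2 <> 0) by (pose proof (pow2_gt_0 r Hr); pose proof (pow2_ge_0 K); lra).
  unfold T, N, null_tangent, null_normal, mink. repeat split; apply Rminus_diag_uniq.
  - transitivity (P ^ 2 / (K ^ 2 + r ^ 2) * (K1 ^ 2 - (r ^ 2 + K ^ 2 - K ^ 4 / 4))); [field; assumption|rewrite E; ring].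
  - transitivity (P * K / (K ^ 2 + r ^ 2) * (K1 ^ 2 - (r ^ 2 + K ^ 2 - K ^ 4 / 4))); [field; assumption|rewrite E; ring].
  - field. assumption.
  - field. assumption.
  - transitivity (r * P / (K ^ 2 + r ^ 2) * (K1 ^ 2 - (r ^ 2 + K ^ 2 - K ^ 4 / 4))); [field; assumption|rewrite E; ring].
Qed.

(** The last three minors are multiples of K, K1 and -K^2/2: the cross product of the two null
    vectors points along the constant vector. *)
Lemma null_pair_products (r K K1 Pp Pm : R) :
  r <> 0 -> K1 ^ 2 = r ^ 2 + K ^ 2 - K ^ 4 / 4 -> Pp * Pm = K ^ 2 + r ^ 2 ->
  let Tp := null_tangent r K K1 Pp in let Np := null_normal r K K1 Pp in
  let Tm := null_tangent (- r) K K1 Pm in let Nm := null_normal (- r) K K1 Pm in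
  (Tp * Tm = K ^ 2 - K ^ 4 / 4 /\ Np * Nm = K ^ 4 / 4 - r ^ 2 /\
   Pp * Tm + Tp * Pm = 2 * K * K1 /\ Pp * Nm + Np * Pm = - K ^ 3 /\ Tp * Nm + Np * Tm = - K ^ 2 * K1) /\
  (Pp * Tm - Tp * Pm = r * K ^ 2 /\ Pp * Nm - Np * Pm = 2 * r * K1 /\ Tp * Nm - Np * Tm = 2 * r * K).
Proof.
  intros Hr E HP Tp Np Tm Nm.
  assert (HD : K ^ 2 + r ^ 2 <> 0) by (pose proof (pow2_gt_0 r Hr); pose proof (pow2_ge_0 K); lra).
  assert (HPp : Pp <> 0) by (intros H0; apply HD; rewrite <- HP, H0; ring).
  assert (HPm : Pm = (K ^ 2 + r ^ 2) / Pp) by (rewrite <- HP; field; assumption).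
  unfold Tp, Np, Tm, Nm, null_tangent, null_normal. rewrite HPm.
  assert (HD' : K ^ 2 + (- r) ^ 2 <> 0) by (replace ((- r) ^ 2) with (r ^ 2) by ring; assumption).
  repeat split; apply Rminus_diag_uniq.
  - transitivity (K ^ 2 / (K ^ 2 + r ^ 2) * (K1 ^ 2 - (r ^ 2 + K ^ 2 - K ^ 4 / 4))); [field; tauto|rewrite E; ring].
  - transitivity (- r ^ 2 / (K ^ 2 + r ^ 2) * (K1 ^ 2 - (r ^ 2 + K ^ 2 - K ^ 4 / 4))); [field; tauto|rewrite E; ring].
  - field. tauto.
  - field. tauto.
  - field. tauto.
  - field. tauto.
  - field. tauto.
  - transitivity (2 * r * K / (K ^ 2 + r ^ 2) * (K1 ^ 2 - (r ^ 2 + K ^ 2 - K ^ 4 / 4))); [field; tauto|rewrite E; ring].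
Qed.

(* [oriented] says that the null vector [A e+ + B e- + C k] equals its cross product with [A' e+ + B' e- + C' k]. *)
Definition null_coefs (A B C : R) : Prop := 0 <= A /\ 0 <= B /\ 4 * A * B = C ^ 2.
Definition oriented (r A B C A' B' C' : R) : Prop :=
  A * C' - C * A' = A / r /\ B * C' - C * B' = - B / r /\ A * B' - B * A' = C / (2 * r).

(** Coefficients by duality: null vectors are orthogonal to themselves and to the constant vector
    and have mutual product -2 r^2, so the coefficient along one is a product with the other. *)
Definition coefP (r u t n P T N : R) : R := mink u t n P T N / (- 2 * r ^ 2).
Definition coefK (r K K1 u t n : R) : R := mink u t n K K1 (- K ^ 2 / 2) / r ^ 2.

Lemma null_expansion (r K K1 Pp Pm u t n : R) :
  r <> 0 -> K1 ^ 2 = r ^ 2 + K ^ 2 - K ^ 4 / 4 -> Pp * Pm = K ^ 2 + r ^ 2 ->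
  let A := coefP r u t n Pm (null_tangent (- r) K K1 Pm) (null_normal (- r) K K1 Pm) in
  let B := coefP r u t n Pp (null_tangent r K K1 Pp) (null_normal r K K1 Pp) in
  let C := coefK r K K1 u t n in
  u = A * Pp + B * Pm + C * K /\
  4 * A * B = C ^ 2 + (u ^ 2 - t ^ 2 - n ^ 2) / r ^ 2.
Proof.
  intros Hr E HP. cbv zeta.
  destruct (null_pair_products r K K1 Pp Pm Hr E HP) as [[TT [NN [UT [UN TN]]]] _].
  set (Tp := null_tangent r K K1 Pp) in *. set (Np := null_normal r K K1 Pp) in *.
  set (Tm := null_tangent (- r) K K1 Pm) in *. set (Nm := null_normal (- r) K K1 Pm) in *.
  unfold coefP, coefK, mink. split.
  - transitivity ((- 2 * u * (Pp * Pm) + t * (Pp * Tm + Tp * Pm) + n * (Pp * Nm + Np * Pm)) / (- 2 * r ^ 2)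
      + (- (u * K) + t * K1 + n * (- K ^ 2 / 2)) / r ^ 2 * K).
    + rewrite HP, UT, UN. field. assumption.
    + field. assumption.
  - transitivity ((u ^ 2 * (Pp * Pm) + t ^ 2 * (Tp * Tm) + n ^ 2 * (Np * Nm)
      - u * t * (Pp * Tm + Tp * Pm) - u * n * (Pp * Nm + Np * Pm) + t * n * (Tp * Nm + Np * Tm)) / r ^ 4).
    + field. assumption.
    + rewrite HP, TT, NN, UT, UN, TN.
      transitivity (((- (u * K) + t * K1 + n * (- K ^ 2 / 2)) ^ 2 - t ^ 2 * (K1 ^ 2 - (r ^ 2 + K ^ 2 - K ^ 4 / 4))
        + r ^ 2 * (u ^ 2 - t ^ 2 - n ^ 2)) / r ^ 4); [field; assumption|].
      rewrite E. field. assumption.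
Qed.

(** The three hypotheses say that (u, t, n) is its own cross product with (v, tv, nv). By the
    Binet-Cauchy identity the minors of the coefficients are pairings of these minors with those of
    the basis. *)
Lemma null_orientation (r K K1 Pp Pm u t n v tv nv : R) :
  r <> 0 -> K1 ^ 2 = r ^ 2 + K ^ 2 - K ^ 4 / 4 -> Pp * Pm = K ^ 2 + r ^ 2 ->
  u * tv - t * v = - n -> u * nv - n * v = t -> t * nv - n * tv = u ->
  let Tp := null_tangent r K K1 Pp in let Np := null_normal r K K1 Pp in
  let Tm := null_tangent (- r) K K1 Pm in let Nm := null_normal (- r) K K1 Pm in
  oriented r (coefP r u t n Pm Tm Nm) (coefP r u t n Pp Tp Np) (coefK r K K1 u t n)
    (coefP r v tv nv Pm Tm Nm) (coefP r v tv nv Pp Tp Np) (coefK r K K1 v tv nv).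
Proof.
  intros Hr E HP M1 M2 M3. cbv zeta.
  destruct (null_pair_products r K K1 Pp Pm Hr E HP) as [_ [UT [UN TN]]].
  destruct (null_vector_products r K K1 Pp Hr E) as [_ [_ [X1 [X2 X3]]]].
  assert (E' : K1 ^ 2 = (- r) ^ 2 + K ^ 2 - K ^ 4 / 4) by (rewrite E; ring).
  destruct (null_vector_products (- r) K K1 Pm) as [_ [_ [Y1 [Y2 Y3]]]]; [lra|assumption|].
  set (Tp := null_tangent r K K1 Pp) in *. set (Np := null_normal r K K1 Pp) in *.
  set (Tm := null_tangent (- r) K K1 Pm) in *. set (Nm := null_normal (- r) K K1 Pm) in *.
  unfold oriented, coefP, coefK, mink. repeat split.
  - transitivity ((- (Pm * K1 - Tm * K) * (u * tv - t * v) - (Pm * (- K ^ 2 / 2) - Nm * K) * (u * nv - n * v)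
      + (Tm * (- K ^ 2 / 2) - Nm * K1) * (t * nv - n * tv)) / (- 2 * r ^ 4)); [field; assumption|].
    rewrite Y1, Y2, Y3, M1, M2, M3. field. assumption.
  - transitivity ((- (Pp * K1 - Tp * K) * (u * tv - t * v) - (Pp * (- K ^ 2 / 2) - Np * K) * (u * nv - n * v)
      + (Tp * (- K ^ 2 / 2) - Np * K1) * (t * nv - n * tv)) / (- 2 * r ^ 4)); [field; assumption|].
    rewrite X1, X2, X3, M1, M2, M3. field. assumption.
  - transitivity (((Pp * Tm - Tp * Pm) * (u * tv - t * v) + (Pp * Nm - Np * Pm) * (u * nv - n * v)
      - (Tp * Nm - Np * Tm) * (t * nv - n * tv)) / (4 * r ^ 4)); [field; assumption|].
    rewrite UT, UN, TN, M1, M2, M3. field. assumption.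
Qed.

(** Reversed Cauchy-Schwarz for null vectors in the same half of the cone, from (tT + nN)^2 + (tN -
    nT)^2 = (uP)^2. It gives the signs of the coefficients. *)
Lemma mink_null_le (u t n P T N : R) :
  0 < u -> 0 < P -> u ^ 2 = t ^ 2 + n ^ 2 -> P ^ 2 = T ^ 2 + N ^ 2 -> mink u t n P T N <= 0.
Proof.
  intros Hu HP E1 E2. unfold mink.
  assert (H : (t * T + n * N) ^ 2 <= (u * P) ^ 2).
  { replace ((u * P) ^ 2) with (u ^ 2 * P ^ 2) by ring. rewrite E1, E2.
    pose proof (pow2_ge_0 (t * N - n * T)). nra. }
  assert (HuP : 0 < u * P) by now apply Rmult_lt_0_compat.
  nra.
Qed.

(** For the converse: with cos phi = -n/u and sin phi = -t/u the first conclusion is cos^2 + sin^2 =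
    1, and the second yields gamma1' = gamma2 cos phi. *)
Lemma combination_identities (r K K1 Pp Pm A B C A' B' C' : R) :
  r <> 0 -> K1 ^ 2 = r ^ 2 + K ^ 2 - K ^ 4 / 4 -> Pp * Pm = K ^ 2 + r ^ 2 ->
  4 * A * B = C ^ 2 -> oriented r A B C A' B' C' ->
  let Tp := null_tangent r K K1 Pp in let Np := null_normal r K K1 Pp in
  let Tm := null_tangent (- r) K K1 Pm in let Nm := null_normal (- r) K K1 Pm in
  let u := A * Pp + B * Pm + C * K in let t := A * Tp + B * Tm + C * K1 in
  let n := A * Np + B * Nm + C * (- K ^ 2 / 2) in
  let v := A' * Pp + B' * Pm + C' * K in let tv := A' * Tp + B' * Tm + C' * K1 in
  u ^ 2 = t ^ 2 + n ^ 2 /\ u * tv - t * v = - n.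
Proof.
  intros Hr E HP H4 [O1 [O2 O3]]. cbv zeta.
  destruct (null_pair_products r K K1 Pp Pm Hr E HP) as [[TT [NN _]] [UT [UN TN]]].
  destruct (null_vector_products r K K1 Pp Hr E) as [X0 [X [X1 [X2 X3]]]].
  assert (E' : K1 ^ 2 = (- r) ^ 2 + K ^ 2 - K ^ 4 / 4) by (rewrite E; ring).
  destruct (null_vector_products (- r) K K1 Pm) as [Y0 [Y [Y1 [Y2 Y3]]]]; [lra|assumption|].
  set (Tp := null_tangent r K K1 Pp) in *. set (Np := null_normal r K K1 Pp) in *.
  set (Tm := null_tangent (- r) K K1 Pm) in *. set (Nm := null_normal (- r) K K1 Pm) in *.
  unfold mink in *. split.
  - apply Rminus_diag_uniq_sym.
    transitivity (A ^ 2 * (- (Pp * Pp) + Tp * Tp + Np * Np) + B ^ 2 * (- (Pm * Pm) + Tm * Tm + Nm * Nm)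
      + 2 * A * C * (- (Pp * K) + Tp * K1 + Np * (- K ^ 2 / 2)) + 2 * B * C * (- (Pm * K) + Tm * K1 + Nm * (- K ^ 2 / 2))
      + 2 * A * B * (- (Pp * Pm) + Tp * Tm + Np * Nm) + C ^ 2 * (- K ^ 2 + K1 ^ 2 + K ^ 4 / 4)); [field|].
    rewrite X0, X, Y0, Y, HP, TT, NN, E, <- H4. field.
  - transitivity ((A * B' - B * A') * (Pp * Tm - Tp * Pm) + (A * C' - C * A') * (Pp * K1 - Tp * K)
      + (B * C' - C * B') * (Pm * K1 - Tm * K)); [ring|].
    rewrite O1, O2, O3, UT, X1, Y1. field. assumption.
Qed.

Lemma combination_coefK (r K K1 Pp Pm A B C : R) :
  r <> 0 -> K1 ^ 2 = r ^ 2 + K ^ 2 - K ^ 4 / 4 ->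
  mink (A * Pp + B * Pm + C * K)
    (A * null_tangent r K K1 Pp + B * null_tangent (- r) K K1 Pm + C * K1)
    (A * null_normal r K K1 Pp + B * null_normal (- r) K K1 Pm + C * (- K ^ 2 / 2))
    K K1 (- K ^ 2 / 2) = r ^ 2 * C.
Proof.
  intros Hr E.
  destruct (null_vector_products r K K1 Pp Hr E) as [_ [X _]].
  assert (E' : K1 ^ 2 = (- r) ^ 2 + K ^ 2 - K ^ 4 / 4) by (rewrite E; ring).
  destruct (null_vector_products (- r) K K1 Pm) as [_ [Y _]]; [lra|assumption|].
  unfold mink in *.
  set (Tp := null_tangent r K K1 Pp) in *. set (Np := null_normal r K K1 Pp) in *.
  set (Tm := null_tangent (- r) K K1 Pm) in *. set (Nm := null_normal (- r) K K1 Pm) in *.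
  transitivity (A * (- (Pp * K) + Tp * K1 + Np * (- K ^ 2 / 2)) + B * (- (Pm * K) + Tm * K1 + Nm * (- K ^ 2 / 2))
    + C * (- K ^ 2 + K1 ^ 2 + K ^ 4 / 4)); [field|].
  rewrite X, Y, E. field.
Qed.

(** * Wavelike elasticae *)

Definition null_plus (k s_star s : R) : R := W2_hat k s_star s + W1_hat k s_star s.
Definition null_minus (k s_star s : R) : R := W2_hat k s_star s - W1_hat k s_star s.

Lemma mu_sqrt (k : R) : wavelike_modulus k ->
  sqrt (Rabs (mu k)) = 2 * k * compl_modulus k / (2 * k ^ 2 - 1) /\ mu k = - sqrt (Rabs (mu k)) ^ 2.
Proof.
  intros Hw. destruct (wavelike_bounds _ Hw) as [Hk [Hs2 [Hc [Hc2 _]]]].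
  assert (E : mu k = - (2 * k * compl_modulus k / (2 * k ^ 2 - 1)) ^ 2).
  { unfold mu. rewrite <- Hc2. field. lra. }
  assert (Hpos : 0 < 2 * k * compl_modulus k / (2 * k ^ 2 - 1)).
  { apply Rdiv_lt_0_compat; [|assumption]. apply Rmult_lt_0_compat; lra. }
  assert (Es : sqrt (Rabs (mu k)) = 2 * k * compl_modulus k / (2 * k ^ 2 - 1)).
  { rewrite E, Rabs_Ropp, Rabs_pos_eq by apply pow2_ge_0. apply sqrt_pow2. lra. }
  split; [assumption|]. now rewrite Es.
Qed.

Lemma is_derive_rescale (f : R -> R) (k s_star s l : R) :
  is_derive f (rescale k s_star s) l ->
  is_derive (fun s => f (rescale k s_star s)) s (l / sqrt (2 * k ^ 2 - 1)).
Proof.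
  intros H. unfold rescale in *. set (a := sqrt (2 * k ^ 2 - 1)) in *.
  auto_derive; [exact (ex_intro _ _ H)|].
  change ((s + s_star) * / a) with ((s + s_star) / a).
  rewrite (is_derive_unique (fun x : R => f x) _ _ H). unfold Rdiv. ring.
Qed.

Lemma null_pm_w (k s_star s : R) : wavelike_modulus k ->
  null_plus k s_star s = 2 * k ^ 2 / ((2 * k ^ 2 - 1) * w_plus k 0) * w_plus k (rescale k s_star s) /\
  null_minus k s_star s = 2 * k ^ 2 / ((2 * k ^ 2 - 1) * w_plus k 0) * w_minus k (rescale k s_star s).
Proof.
  intros Hw. destruct (wavelike_bounds _ Hw) as [_ [Hs2 _]]. destruct (w_pm_facts k Hw) as [E0 [N0 _]].
  unfold null_plus, null_minus, W1_hat, W2_hat, w1_hat, w2_hat. rewrite <- E0.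
  split; field; repeat split; lra.
Qed.

Lemma kappa_frame (k s_star : R) : wavelike_modulus k ->
  elastic_frame (sqrt (Rabs (mu k))) (kappa k s_star) (Derive (kappa k s_star))
    (null_plus k s_star) (null_minus k s_star).
Proof.
  intros Hw. destruct (wavelike_bounds _ Hw) as [Hk [Hs2 [Hc [Hc2 _]]]].
  destruct (w_pm_facts k Hw) as [E0 [N0 HW]]. destruct (mu_sqrt k Hw) as [Er _].
  rewrite Er. set (k' := compl_modulus k) in *. set (sg := sqrt (2 * k ^ 2 - 1)) in *.
  assert (Hsg : 0 < sg) by now apply sqrt_lt_R0.
  assert (Hsg2 : 2 * k ^ 2 - 1 = sg ^ 2) by (symmetry; apply pow2_sqrt; lra).
  rewrite Hsg2 in *.
  assert (Hk2 : k ^ 2 = 1 - k' ^ 2) by lra.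
  assert (DK : forall s, is_derive (kappa k s_star) s (- (2 * k / sg ^ 2) * jacobi_sndn (rescale k s_star s) k)).
  { intros s. destruct (is_derive_jacobi k (rescale k s_star s) Hk) as [D _].
    apply is_derive_rescale in D. apply (is_derive_scal _ _ (2 * k / sg)) in D. fold sg in D.
    replace (- (2 * k / sg ^ 2) * jacobi_sndn (rescale k s_star s) k)
      with (2 * k / sg * (- jacobi_sndn (rescale k s_star s) k / sg)) by (field; lra).
    exact D. }
  assert (EK : forall s, Derive (kappa k s_star) s = - (2 * k / sg ^ 2) * jacobi_sndn (rescale k s_star s) k).
  { intros s. now apply is_derive_unique. }
  assert (HK : forall s, kappa k s_star s = 2 * k / sg * jacobi_cn (rescale k s_star s) k) by reflexivity.
  assert (Hcp : 0 < 2 * k ^ 2 / (sg ^ 2 * w_plus k 0) * w_plus k 0).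
  { replace (2 * k ^ 2 / (sg ^ 2 * w_plus k 0) * w_plus k 0) with (2 * k ^ 2 / sg ^ 2) by (field; lra).
    apply Rdiv_lt_0_compat; [|now apply pow_lt]. assert (0 < k ^ 2) by now apply pow_lt. lra. }
  assert (Hprod : forall s, null_plus k s_star s * null_minus k s_star s
            = kappa k s_star s ^ 2 + (2 * k * k' / sg ^ 2) ^ 2).
  { intros s. destruct (null_pm_w k s_star s Hw) as [-> ->]. rewrite Hsg2, HK.
    destruct (HW (rescale k s_star s)) as [_ [_ P]].
    set (c := jacobi_cn (rescale k s_star s) k) in *.
    transitivity (4 * k ^ 2 / (sg ^ 4 * w_plus k 0 ^ 2)
      * (k ^ 2 * (w_plus k (rescale k s_star s) * w_minus k (rescale k s_star s)))); [field; lra|].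
    rewrite P. field. lra. }
  assert (Hq : forall s, 0 < kappa k s_star s ^ 2 + (2 * k * k' / sg ^ 2) ^ 2).
  { intros s. pose proof (pow2_ge_0 (kappa k s_star s)).
    assert (0 < (2 * k * k' / sg ^ 2) ^ 2); [|lra]. apply pow_lt, Rdiv_lt_0_compat; [|now apply pow_lt].
    apply Rmult_lt_0_compat; lra. }
  (* Both null directions at once: e = 1 and e = -1 are the two signs of r. *)
  assert (Hnull : forall (P w : R -> R) (e s : R), e * e = 1 ->
    (forall x, 2 * k ^ 2 / (sg ^ 2 * w_plus k 0) * w (rescale k s_star x) = P x) ->
    let c := jacobi_cn (rescale k s_star s) k in
    is_derive w (rescale k s_star s)
      (- (sg ^ 2 * c * jacobi_sndn (rescale k s_star s) k + e * (k * k' * sg) * c ^ 2)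
       / (k' ^ 2 + sg ^ 2 * c ^ 2) * w (rescale k s_star s)) ->
    is_derive P s (null_tangent (e * (2 * k * k' / sg ^ 2)) (kappa k s_star s) (Derive (kappa k s_star) s) (P s))).
  { intros P w e s He EP c D. apply (is_derive_ext _ _ _ _ EP).
    apply is_derive_rescale in D. apply (is_derive_scal _ _ (2 * k ^ 2 / (sg ^ 2 * w_plus k 0))) in D. fold sg in D.
    apply (is_derive_val _ _ _ _ D). rewrite <- EP. unfold null_tangent. rewrite EK, HK. fold c.
    assert (Hq' : 0 < k' ^ 2 + sg ^ 2 * c ^ 2).
    { pose proof (pow_lt _ 2 Hc). pose proof (pow2_ge_0 c). pose proof (pow_lt _ 2 Hsg). nra. }
    replace ((2 * k / sg * c) ^ 2 + (e * (2 * k * k' / sg ^ 2)) ^ 2)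
      with (4 * k ^ 2 / sg ^ 4 * (e * e * k' ^ 2 + sg ^ 2 * c ^ 2)) by (field; lra).
    rewrite He, Rmult_1_l. field. repeat split; lra. }
  split.
  - apply Rdiv_lt_0_compat; [|now apply pow_lt]. apply Rmult_lt_0_compat; lra.
  - intros s. rewrite EK. apply DK.
  - intros s. apply (is_derive_ext (fun s => - (2 * k / sg ^ 2) * jacobi_sndn (rescale k s_star s) k)).
    { intros x. symmetry. apply EK. }
    destruct (is_derive_jacobi k (rescale k s_star s) Hk) as [_ [D _]].
    apply is_derive_rescale in D. apply (is_derive_scal _ _ (- (2 * k / sg ^ 2))) in D. fold sg in D.
    match type of D with is_derive _ _ ?l => replace (kappa k s_star s - kappa k s_star s ^ 3 / 2) with l end; [exact D|].
    rewrite HK. set (c := jacobi_cn (rescale k s_star s) k).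
    replace (1 - 2 * k ^ 2 + 2 * k ^ 2 * c ^ 2) with (2 * k ^ 2 * c ^ 2 - sg ^ 2) by lra.
    field. lra.
  - intros s. destruct (is_derive_jacobi k (rescale k s_star s) Hk) as [_ [_ E]].
    rewrite EK, HK, Rpow_mult_distr, E. set (c := jacobi_cn (rescale k s_star s) k).
    replace (1 - k ^ 2 + k ^ 2 * c ^ 2) with (k' ^ 2 + k ^ 2 * c ^ 2) by lra.
    assert (Es2 : sg ^ 2 = k ^ 2 - k' ^ 2) by lra.
    transitivity (4 * k ^ 2 * (k' ^ 2 + (k ^ 2 - k' ^ 2) * c ^ 2 - k ^ 2 * c ^ 4) / sg ^ 4); [field; lra|].
    rewrite <- Es2. field. lra.
  - intros s. replace (2 * k * k' / sg ^ 2) with (1 * (2 * k * k' / sg ^ 2)) by ring.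
    apply (Hnull _ (w_plus k)); [ring| |].
    + intros x. destruct (null_pm_w k s_star x Hw) as [-> _]. now rewrite Hsg2.
    + destruct (HW (rescale k s_star s)) as [D _]. apply (is_derive_val _ _ _ _ D). now rewrite Rmult_1_l.
  - intros s. replace (- (2 * k * k' / sg ^ 2)) with (-1 * (2 * k * k' / sg ^ 2)) by ring.
    apply (Hnull _ (w_minus k)); [ring| |].
    + intros x. destruct (null_pm_w k s_star x Hw) as [_ ->]. now rewrite Hsg2.
    + destruct (HW (rescale k s_star s)) as [_ [D _]]. apply (is_derive_val _ _ _ _ D). unfold Rdiv. ring.
  - exact Hprod.
  - intros s. assert (Hp : 0 < null_plus k s_star s).
    { destruct (null_pm_w k s_star s Hw) as [-> _]. rewrite Hsg2.
      (* The unshifted variable is used because the normalization makes the value at x = 0 positive;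
         zeros are excluded by the product formula. *)
      apply (nonvanishing_pos (fun x => 2 * k ^ 2 / (sg ^ 2 * w_plus k 0) * w_plus k x)).
      - intros x. apply (continuous_scal_r (V := R_NormedModule)).
        destruct (HW x) as [D _]. eapply is_derive_continuous, D.
      - assumption.
      - intros u _ Hu. destruct (HW u) as [_ [_ P]].
        assert (Hw0 : w_plus k u = 0).
        { apply Rmult_integral in Hu. destruct Hu as [Hu|Hu]; [|assumption].
          exfalso. rewrite Hu, Rmult_0_l in Hcp. lra. }
        rewrite Hw0, Rmult_0_l, Rmult_0_r in P. symmetry in P. apply Rmult_integral in P.
        destruct P as [P|P]; [now apply (pow_nonzero _ 2) in N0|].
        pose proof (pow_lt _ 2 Hc). pose proof (pow2_ge_0 (jacobi_cn u k)). pose proof (pow_lt _ 2 Hsg). fold k' in P. nra. }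
    split; [assumption|]. pose proof (Hq s). rewrite <- Hprod in H. nra.
  (* There the argument of cn is 0 and cn 0 = 1. *)
  - exists (- s_star). rewrite HK. unfold rescale. rewrite Rplus_opp_l. fold sg.
    unfold Rdiv at 2. rewrite Rmult_0_l, jacobi_cn_0, Rmult_1_r by assumption.
    apply Rgt_not_eq, Rdiv_lt_0_compat; lra.
Qed.

Lemma kappa_antiperiodic (k : R) : wavelike_modulus k ->
  exists T, forall s_star s, kappa k (s_star + T) s = - kappa k s_star s.
Proof.
  intros Hw. destruct (wavelike_bounds _ Hw) as [Hk [Hs2 _]].
  destruct (jacobi_cn_antiperiodic k Hk) as [T HT].
  assert (Hsg : 0 < sqrt (2 * k ^ 2 - 1)) by now apply sqrt_lt_R0.
  exists (T * sqrt (2 * k ^ 2 - 1)). intros s_star s. unfold kappa.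
  replace (rescale k (s_star + T * sqrt (2 * k ^ 2 - 1)) s) with (rescale k s_star s + T)
    by (unfold rescale; field; lra).
  rewrite HT. ring.
Qed.

Lemma elastic_frame_Ck (r : R) (K K1 Pp Pm : R -> R) (n : nat) :
  elastic_frame r K K1 Pp Pm -> Ck n K /\ Ck n K1 /\ Ck n Pp /\ Ck n Pm.
Proof.
  intros H. pose proof (ef_r _ _ _ _ _ H) as Hr.
  induction n as [|n [IK [IK1 [IP IM]]]]; [easy|].
  assert (Hsq : forall f, Ck n f -> Ck n (fun s => f s ^ 2)).
  { intros f Hf. apply (Ck_ext n (fun s => f s * f s)); [intros; ring|]. now apply Ck_mult. }
  assert (Hnt : forall q P, q <> 0 -> Ck n P -> Ck n (fun s => null_tangent q (K s) (K1 s) (P s))).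
  { intros q P Hq HP.
    apply (Ck_ext n (fun s => (K s * K1 s + - (q / 2) * K s ^ 2) * / (K s ^ 2 + q ^ 2) * P s)).
    { intros s. unfold null_tangent, Rdiv. ring. }
    apply Ck_mult; [|assumption]. apply Ck_mult.
    - apply Ck_plus; [now apply Ck_mult|]. apply Ck_mult; [apply Ck_const|now apply Hsq].
    - apply (Ck_inv n (fun s => K s ^ 2 + q ^ 2)).
      + intros s. pose proof (pow2_ge_0 (K s)). pose proof (pow2_gt_0 q Hq). lra.
      + apply Ck_plus; [now apply Hsq|apply Ck_const]. }
  split; [|split; [|split]].
  - exists K1. split; [apply (ef_K _ _ _ _ _ H)|assumption].
  - exists (fun s => K s - K s ^ 3 / 2). split; [apply (ef_K1 _ _ _ _ _ H)|].
    apply (Ck_ext n (fun s => K s + - (1 / 2) * (K s * (K s * K s)))); [intros; field|].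
    apply Ck_plus; [assumption|]. apply Ck_mult; [apply Ck_const|]. now repeat apply Ck_mult.
  - eexists. split; [apply (ef_Pp _ _ _ _ _ H)|]. apply Hnt; [lra|assumption].
  - eexists. split; [apply (ef_Pm _ _ _ _ _ H)|]. apply Hnt; [lra|assumption].
Qed.

(** When a3 = 0 only one of A, B is nonzero and orientation requires b3 = sign(a1) / r. The other
    admissible sign of b3 is covered by negating all the b's. *)
Lemma admissible_oriented (k a1 a2 a3 b1 b2 b3 : R) :
  wavelike_modulus k -> (a1 <> 0 \/ a3 <> 0) -> admissible k a1 a2 a3 b1 b2 b3 ->
  let r := sqrt (Rabs (mu k)) in let A := (a1 + a2) / 2 in let B := (a2 - a1) / 2 in
  4 * A * B = a3 ^ 2 /\
  (oriented r A B a3 ((b1 + b2) / 2) ((b2 - b1) / 2) b3 \/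
   oriented r A B a3 ((- b1 + - b2) / 2) ((- b2 - - b1) / 2) (- b3)).
Proof.
  intros Hw Ha Hadm r A B. pose proof (ef_r _ _ _ _ _ (kappa_frame k 0 Hw)) as Hr. fold r in Hr.
  unfold A, B, oriented. destruct Hadm as [[H3 [E2 [F1 F2]]]|[H3 [E2 [F1 F3]]]]; fold r in F1 || fold r in F3.
  - fold r in F2.
    assert (Hsq : a2 ^ 2 = a1 ^ 2 + a3 ^ 2).
    { rewrite E2. apply pow2_sqrt. pose proof (pow2_ge_0 a1). pose proof (pow2_ge_0 a3). lra. }
    split; [lra|]. left. repeat split; apply Rminus_diag_uniq.
    + rewrite F1, F2. field. split; lra.
    + rewrite F1, F2. field. split; lra.
    + transitivity ((a2 ^ 2 - (a1 ^ 2 + a3 ^ 2)) / (2 * r * a3)); [rewrite F1, F2; field; split; lra|].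
      rewrite Hsq, Rminus_diag. unfold Rdiv. ring.
  - subst a3. destruct Ha as [Ha|]; [|lra].
    assert (Hb3 : b3 = 1 / r \/ b3 = - (1 / r)).
    { unfold Rabs in F3. destruct (Rcase_abs b3); lra. }
    destruct (Rlt_le_dec 0 a1) as [Hpos|Hneg].
    + rewrite Rabs_pos_eq in E2 by lra. rewrite (sign_eq_1 _ Hpos), Rmult_1_l in F1. subst a2 b1.
      split; [field|]. destruct Hb3 as [-> | ->]; [left|right]; repeat split; field; lra.
    + assert (Hneg' : a1 < 0) by lra.
      rewrite Rabs_left in E2 by lra. rewrite (sign_eq_m1 _ Hneg') in F1. subst a2 b1.
      split; [field|]. destruct Hb3 as [-> | ->]; [right|left]; repeat split; field; lra.
Qed.

(** For C <> 0 the first two orientation equations are solved for A' and B'. For C = 0 nullity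
    leaves a single nonzero coefficient, and which one it is decides the signs of a1 and b3. *)
Lemma oriented_admissible (k A B C A' B' C' : R) :
  wavelike_modulus k -> (A <> 0 \/ B <> 0) -> null_coefs A B C ->
  oriented (sqrt (Rabs (mu k))) A B C A' B' C' ->
  admissible k (A - B) (A + B) C (A' - B') (A' + B') C'.
Proof.
  intros Hw HAB [HA [HB H4]] [O1 [O2 O3]].
  pose proof (ef_r _ _ _ _ _ (kappa_frame k 0 Hw)) as Hr. set (r := sqrt (Rabs (mu k))) in *.
  unfold admissible. fold r. destruct (Req_dec C 0) as [HC|HC]; [right|left].
  - subst C. rewrite Rmult_0_l, Rminus_0_r in O1, O2.
    replace (0 / (2 * r)) with 0 in O3 by (field; lra).
    assert (HAB0 : A = 0 \/ B = 0).
    { apply Rmult_integral. lra. }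
    split; [reflexivity|]. destruct HAB0 as [-> | ->].
    + assert (HB0 : 0 < B) by (destruct HAB; [lra|lra]).
      assert (A' = 0) by (apply (Rmult_eq_reg_l B); lra).
      assert (EC : C' = - (1 / r)).
      { apply (Rmult_eq_reg_l B); [|lra]. rewrite O2. field. lra. }
      subst A' C'. rewrite Rabs_left, (sign_eq_m1 (0 - B)) by lra. rewrite Rabs_Ropp, Rabs_pos_eq.
      * repeat split; ring.
      * left. apply Rdiv_lt_0_compat; lra.
    + assert (HA0 : 0 < A) by (destruct HAB; [lra|lra]).
      assert (B' = 0) by (apply (Rmult_eq_reg_l A); lra).
      assert (EC : C' = 1 / r).
      { apply (Rmult_eq_reg_l A); [|lra]. rewrite O1. field. lra. }
      subst B' C'. rewrite Rabs_pos_eq, (sign_eq_1 (A - 0)) by lra. rewrite Rabs_pos_eq.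
      * repeat split; ring.
      * left. apply Rdiv_lt_0_compat; lra.
  - assert (EA : A' = (A * C' - A / r) / C) by (apply (Rmult_eq_reg_l C); [|assumption]; rewrite <- O1; field; assumption).
    assert (EB : B' = (B * C' + B / r) / C).
    { apply (Rmult_eq_reg_l C); [|assumption]. transitivity (B * C' - (B * C' - C * B')); [ring|]. rewrite O2. field. split; lra. }
    split; [assumption|]. split; [|split; rewrite EA, EB; field; split; lra].
    symmetry. replace ((A - B) ^ 2 + C ^ 2) with ((A + B) ^ 2) by (rewrite <- H4; ring).
    apply sqrt_pow2. lra.
Qed.

Lemma W_hat_combination (k s_star a1 a2 s : R) :
  a1 * W1_hat k s_star s + a2 * W2_hat k s_star s =
  (a1 + a2) / 2 * null_plus k s_star s + (a2 - a1) / 2 * null_minus k s_star s.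
Proof. unfold null_plus, null_minus. field. Qed.

(** * From the elastica to its representation *)

Lemma elastica_derivatives (k s_star : R) (g1 g2 phi : R -> R) :
  elastica_with k s_star g1 g2 phi ->
  (forall s, 0 < g2 s) /\ (forall s, is_derive g1 s (g2 s * cos (phi s))) /\
  (forall s, is_derive g2 s (g2 s * sin (phi s))) /\
  (forall s, is_derive phi s (kappa k s_star s - cos (phi s))).
Proof.
  intros [[Hpos [S1 [S2 _]]] [[Sphi Hphi] Hk]].
  split; [exact Hpos|]. split; [|split]; intros s; destruct (Hphi s) as [E1 E2].
  - rewrite <- E1. apply Derive_correct, (S1 1%nat).
  - rewrite <- E2. apply Derive_correct, (S2 1%nat).
  - replace (kappa k s_star s - cos (phi s)) with (Derive phi s)
      by (specialize (Hk s); unfold hyp_curvature in Hk; lra).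
    apply Derive_correct, (Sphi 1%nat).
Qed.

Lemma frame_coords_pm (k s_star : R) : wavelike_modulus k ->
  let r := sqrt (Rabs (mu k)) in let K := kappa k s_star in let K1 := Derive K in
  frame_coords K (null_plus k s_star) (fun s => null_tangent r (K s) (K1 s) (null_plus k s_star s))
    (fun s => null_normal r (K s) (K1 s) (null_plus k s_star s)) /\
  frame_coords K (null_minus k s_star) (fun s => null_tangent (- r) (K s) (K1 s) (null_minus k s_star s))
    (fun s => null_normal (- r) (K s) (K1 s) (null_minus k s_star s)).
Proof.
  intros Hw r K K1. destruct (kappa_frame k s_star Hw) as [Hr HK HK1 HE HP HM _ _ _].
  fold r K K1 in Hr, HK, HK1, HE, HP, HM.
  split; apply frame_coords_null; try assumption; [lra|lra|].
  intros s. rewrite HE. ring.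
Qed.

Lemma frame_coords_combination (k s_star A B C : R) : wavelike_modulus k ->
  let r := sqrt (Rabs (mu k)) in let K := kappa k s_star in let K1 := Derive K in
  let Pp := null_plus k s_star in let Pm := null_minus k s_star in
  frame_coords K (fun s => A * Pp s + B * Pm s + C * K s)
    (fun s => A * null_tangent r (K s) (K1 s) (Pp s) + B * null_tangent (- r) (K s) (K1 s) (Pm s) + C * K1 s)
    (fun s => A * null_normal r (K s) (K1 s) (Pp s) + B * null_normal (- r) (K s) (K1 s) (Pm s)
              + C * (- K s ^ 2 / 2)).
Proof.
  intros Hw r K K1 Pp Pm. destruct (frame_coords_pm k s_star Hw) as [HP HM].
  pose proof (frame_coords_curvature _ _ _ _ _ (kappa_frame k s_star Hw)) as HK.
  apply (frame_coords_scal _ _ _ _ A) in HP. apply (frame_coords_scal _ _ _ _ B) in HM.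
  apply (frame_coords_scal _ _ _ _ C) in HK.
  exact (frame_coords_plus _ _ _ _ _ _ _ (frame_coords_plus _ _ _ _ _ _ _ HP HM) HK).
Qed.

Lemma elastica_represented (k s_star : R) (g1 g2 phi : R -> R) :
  wavelike_modulus k -> elastica_with k s_star g1 g2 phi ->
  exists a1 a2 a3 b1 b2 b3 : R,
    admissible k a1 a2 a3 b1 b2 b3 /\ represented k s_star g1 g2 a1 a2 a3 b1 b2 b3.
Proof.
  intros Hw He. destruct (elastica_derivatives _ _ _ _ _ He) as [Hpos [D1 [D2 Dphi]]].
  destruct (curve_frame_coords _ _ _ _ Hpos D1 D2 Dphi) as [HU HV].
  destruct (frame_coords_pm k s_star Hw) as [HP HM].
  pose proof (kappa_frame k s_star Hw) as HF.
  pose proof (frame_coords_curvature _ _ _ _ _ HF) as HK.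
  destruct HF as [Hr _ _ HE _ _ HD HPpos _].
  set (r := sqrt (Rabs (mu k))) in *. set (K := kappa k s_star) in *. set (K1 := Derive K) in *.
  set (Pp := null_plus k s_star) in *. set (Pm := null_minus k s_star) in *.
  set (Tp := fun s => null_tangent r (K s) (K1 s) (Pp s)) in *. set (Np := fun s => null_normal r (K s) (K1 s) (Pp s)) in *.
  set (Tm := fun s => null_tangent (- r) (K s) (K1 s) (Pm s)) in *.
  set (Nm := fun s => null_normal (- r) (K s) (K1 s) (Pm s)) in *.
  set (u := fun s => 1 / g2 s) in *. set (t := fun s => - sin (phi s) / g2 s) in *.
  set (n := fun s => - cos (phi s) / g2 s) in *. set (v := fun s => g1 s / g2 s) in *.
  set (tv := fun s => cos (phi s) - g1 s / g2 s * sin (phi s)) in *.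
  set (nv := fun s => - sin (phi s) - g1 s / g2 s * cos (phi s)) in *.
  assert (Hr0 : r <> 0) by lra.
  (* The coefficients are products of fixed vectors up to a factor, hence constant; their values at
     0 are the witnesses. *)
  assert (Hcoef : forall u t n, frame_coords K u t n ->
    exists A B C, forall s, coefP r (u s) (t s) (n s) (Pm s) (Tm s) (Nm s) = A /\
      coefP r (u s) (t s) (n s) (Pp s) (Tp s) (Np s) = B /\ coefK r (K s) (K1 s) (u s) (t s) (n s) = C).
  { intros u0 t0 n0 H0. unfold coefP, coefK. do 3 eexists. intros s.
    rewrite (frame_coords_mink _ _ _ _ _ _ _ H0 HM s), (frame_coords_mink _ _ _ _ _ _ _ H0 HP s),
      (frame_coords_mink _ _ _ _ _ _ _ H0 HK s). repeat split. }
  destruct (Hcoef _ _ _ HU) as [A [B [C HA]]]. destruct (Hcoef _ _ _ HV) as [A' [B' [C' HA']]].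
  assert (EU : forall s, u s = A * Pp s + B * Pm s + C * K s).
  { intros s. destruct (null_expansion r (K s) (K1 s) (Pp s) (Pm s) (u s) (t s) (n s) Hr0 (HE s) (HD s)) as [E _].
    destruct (HA s) as [<- [<- <-]]. exact E. }
  assert (EV : forall s, v s = A' * Pp s + B' * Pm s + C' * K s).
  { intros s. destruct (null_expansion r (K s) (K1 s) (Pp s) (Pm s) (v s) (tv s) (nv s) Hr0 (HE s) (HD s)) as [E _].
    destruct (HA' s) as [<- [<- <-]]. exact E. }
  assert (Hg : 0 < g2 0) by apply Hpos.
  assert (Hu0 : 0 < u 0) by (apply Rdiv_lt_0_compat; lra).
  assert (Hsc : cos (phi 0) ^ 2 = 1 - sin (phi 0) ^ 2).
  { pose proof (sin2_cos2 (phi 0)) as E. rewrite !Rsqr_pow2 in E. lra. }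
  assert (Hnull : u 0 ^ 2 = t 0 ^ 2 + n 0 ^ 2).
  { unfold u, t, n. apply Rminus_diag_uniq.
    transitivity ((1 - sin (phi 0) ^ 2 - cos (phi 0) ^ 2) / g2 0 ^ 2); [field; lra|rewrite Hsc; field; lra]. }
  assert (Hor : oriented r A B C A' B' C').
  { destruct (HA 0) as [<- [<- <-]]. destruct (HA' 0) as [<- [<- <-]].
    apply (null_orientation r (K 0) (K1 0) (Pp 0) (Pm 0)); auto; unfold u, t, n, v, tv, nv.
    - field. lra.
    - field. lra.
    - transitivity ((sin (phi 0) ^ 2 + cos (phi 0) ^ 2) / g2 0); [field; lra|rewrite Hsc; field; lra]. }
  assert (Hnc : null_coefs A B C).
  { destruct (null_expansion r (K 0) (K1 0) (Pp 0) (Pm 0) (u 0) (t 0) (n 0) Hr0 (HE 0) (HD 0)) as [_ E].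
    destruct (HPpos 0) as [Pp0 Pm0].
    destruct (null_vector_products r (K 0) (K1 0) (Pp 0) Hr0 (HE 0)) as [Np0 _].
    destruct (null_vector_products (- r) (K 0) (K1 0) (Pm 0)) as [Nm0 _]; [lra|rewrite HE; ring|].
    unfold mink in Np0, Nm0.
    assert (Hneg : 0 < 2 * r ^ 2) by (pose proof (pow_lt _ 2 Hr); lra).
    assert (Hdiv : forall m, m <= 0 -> 0 <= m / (- 2 * r ^ 2)).
    { intros m Hm. replace (m / (- 2 * r ^ 2)) with (- m / (2 * r ^ 2)) by (field; lra).
      apply Rdiv_le_0_compat; lra. }
    destruct (HA 0) as [EA [EB EC]]. rewrite <- EA, <- EB, <- EC. repeat split.
    - apply Hdiv, mink_null_le; auto. unfold Tm, Nm. lra.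
    - apply Hdiv, mink_null_le; auto. unfold Tp, Np. lra.
    - unfold Tp, Np, Tm, Nm. rewrite E, Hnull. field. lra. }
  (* If both vanished, nullity would give C = 0 and then 1/gamma2 = 0. *)
  assert (HAB : A <> 0 \/ B <> 0).
  { destruct (Req_dec A 0) as [EA|]; [|now left]. destruct (Req_dec B 0) as [EB|]; [|now right].
    exfalso. destruct Hnc as [_ [_ H4]]. specialize (EU 0). subst A B.
    rewrite Rmult_0_r in H4. assert (C = 0) by nra. subst C. lra. }
  exists (A - B), (A + B), C, (A' - B'), (A' + B'), C'. split; [now apply oriented_admissible|].
  intros s. unfold denom. rewrite !W_hat_combination. fold Pp Pm K.
  replace ((A - B + (A + B)) / 2) with A by field. replace ((A + B - (A - B)) / 2) with B by field.
  replace ((A' - B' + (A' + B')) / 2) with A' by field. replace ((A' + B' - (A' - B')) / 2) with B' by field.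
  rewrite <- EU, <- EV. specialize (Hpos s). unfold u, v.
  split; [apply Rgt_not_eq, Rdiv_lt_0_compat; lra|]. split; field; lra.
Qed.

(** * The identities for the coefficients *)

Lemma inv2_mul_solve (m11 m12 m21 m22 x1 x2 c p1 p2 d q1 q2 : R) :
  det2 m11 m12 m21 m22 <> 0 ->
  m11 * x1 + m12 * x2 = c * p1 + d * q1 -> m21 * x1 + m22 * x2 = c * p2 + d * q2 ->
  x1 = c * fst (inv2_mul m11 m12 m21 m22 p1 p2) + d * fst (inv2_mul m11 m12 m21 m22 q1 q2) /\
  x2 = c * snd (inv2_mul m11 m12 m21 m22 p1 p2) + d * snd (inv2_mul m11 m12 m21 m22 q1 q2).
Proof.
  intros Hd E1 E2. unfold inv2_mul. simpl. split.
  - transitivity ((m22 * (c * p1 + d * q1) - m12 * (c * p2 + d * q2)) / det2 m11 m12 m21 m22).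
    + rewrite <- E1, <- E2. unfold det2 in *. field. assumption.
    + field. assumption.
  - transitivity ((m11 * (c * p2 + d * q2) - m21 * (c * p1 + d * q1)) / det2 m11 m12 m21 m22).
    + rewrite <- E1, <- E2. unfold det2 in *. field. assumption.
    + field. assumption.
Qed.

Lemma W_quotient (k s_star s : R) : wavelike_modulus k ->
  W1 k s_star s = W1_hat k s_star s / kappa k s_star s /\ W2 k s_star s = W2_hat k s_star s / kappa k s_star s.
Proof.
  intros Hw. destruct (wavelike_bounds k Hw) as [Hk [Hs2 _]].
  assert (Hsg : 0 < sqrt (2 * k ^ 2 - 1)) by now apply sqrt_lt_R0.
  assert (G : forall w c, 1 / sqrt (2 * k ^ 2 - 1) * (w / c)
    = 2 * k / (2 * k ^ 2 - 1) * w / (2 * k / sqrt (2 * k ^ 2 - 1) * c)).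
  { assert (Hsg2 : sqrt (2 * k ^ 2 - 1) ^ 2 = 2 * k ^ 2 - 1) by (apply pow2_sqrt; lra).
    intros w c. set (sg := sqrt (2 * k ^ 2 - 1)) in *. rewrite <- Hsg2.
    (* The inverse of c stays opaque, so the identity also holds at zeros of kappa with total
       division; [W_derivatives] rewrites the function at all points. *)
    unfold Rdiv. rewrite (Rinv_mult _ c). set (ic := / c). field. lra. }
  split; apply G.
Qed.

Lemma W_derivatives (k s_star s : R) : wavelike_modulus k -> kappa k s_star s <> 0 ->
  let r := sqrt (Rabs (mu k)) in let K := kappa k s_star s in let K1 := Derive (kappa k s_star) s in
  let Pp := null_plus k s_star s in let Pm := null_minus k s_star s in
  let Tp := null_tangent r K K1 Pp in let Tm := null_tangent (- r) K K1 Pm in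
  Derive (W1 k s_star) s = ((Tp - Tm) / 2 * K - (Pp - Pm) / 2 * K1) / K ^ 2 /\
  Derive (W2 k s_star) s = ((Tp + Tm) / 2 * K - (Pp + Pm) / 2 * K1) / K ^ 2.
Proof.
  intros Hw HK0 r K K1 Pp Pm Tp Tm.
  pose proof (kappa_frame k s_star Hw) as HF.
  pose proof (ef_K _ _ _ _ _ HF s) as DK. pose proof (ef_Pp _ _ _ _ _ HF s) as DP. pose proof (ef_Pm _ _ _ _ _ HF s) as DM.
  fold K K1 r in DK, DP, DM. fold Pp in DP. fold Pm in DM. fold Tp in DP. fold Tm in DM.
  assert (EW1 : forall x, (null_plus k s_star x + -1 * null_minus k s_star x) / 2 / kappa k s_star x = W1 k s_star x).
  { intros x. destruct (W_quotient k s_star x Hw) as [-> _]. unfold null_plus, null_minus, Rdiv.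
    set (i := / kappa k s_star x). field. }
  assert (EW2 : forall x, (null_plus k s_star x + null_minus k s_star x) / 2 / kappa k s_star x = W2 k s_star x).
  { intros x. destruct (W_quotient k s_star x Hw) as [_ ->]. unfold null_plus, null_minus, Rdiv.
    set (i := / kappa k s_star x). field. }
  split; apply is_derive_unique.
  - apply (is_derive_ext _ _ _ _ EW1).
    auto_derive; [repeat split; try assumption; eapply is_derive_ex; eassumption|].
    rewrite (is_derive_unique (fun x : R => kappa k s_star x) _ _ DK),
      (is_derive_unique (fun x : R => null_plus k s_star x) _ _ DP),
      (is_derive_unique (fun x : R => null_minus k s_star x) _ _ DM).
    fold K Pp Pm. field. assumption.
  - apply (is_derive_ext _ _ _ _ EW2).
    auto_derive; [repeat split; try assumption; eapply is_derive_ex; eassumption|].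
    rewrite (is_derive_unique (fun x : R => kappa k s_star x) _ _ DK),
      (is_derive_unique (fun x : R => null_plus k s_star x) _ _ DP),
      (is_derive_unique (fun x : R => null_minus k s_star x) _ _ DM).
    fold K Pp Pm. field. assumption.
Qed.

(** The coordinates 1/gamma2 and gamma1/gamma2 have tangent and normal parts computed once from phi
    and once from the representation, and the two agree. Products with the constant vector give the
    formulas with a3; inserting these, the formulas with xi^1, xi^3 are Cramer's rule. *)
Lemma elastica_identities (k s_star : R) (g1 g2 phi : R -> R) (a1 a2 a3 b1 b2 b3 : R) :
  wavelike_modulus k -> elastica_with k s_star g1 g2 phi ->
  represented k s_star g1 g2 a1 a2 a3 b1 b2 b3 ->
  (forall s : R, kappa k s_star s <> 0 ->
     wronskian k s_star s <> 0 /\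
     (g2 s * a1, g2 s * a2) = xi1 k s_star phi s /\
     (g2 s * b1, g2 s * b2) =
       (g1 s * fst (xi1 k s_star phi s) + g2 s * fst (xi3 k s_star phi s),
        g1 s * snd (xi1 k s_star phi s) + g2 s * snd (xi3 k s_star phi s))) /\
  (forall s : R,
     a3 * g1 s = b3 + 1 / (2 * mu k) *
       (kappa k s_star s ^ 2 * sin (phi s) + 2 * Derive (kappa k s_star) s * cos (phi s)) /\
     a3 * g2 s = kappa k s_star s / mu k + 1 / (2 * mu k) *
       (2 * Derive (kappa k s_star) s * sin (phi s) - kappa k s_star s ^ 2 * cos (phi s))).
Proof.
  intros Hw He Hrep. destruct (elastica_derivatives _ _ _ _ _ He) as [Hpos [D1 [D2 Dphi]]].
  destruct (curve_frame_coords _ _ _ _ Hpos D1 D2 Dphi) as [HU HV].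
  destruct (mu_sqrt k Hw) as [_ Hmu].
  pose proof (kappa_frame k s_star Hw) as HF.
  pose proof (frame_coords_combination k s_star ((a1 + a2) / 2) ((a2 - a1) / 2) a3 Hw) as CU.
  pose proof (frame_coords_combination k s_star ((b1 + b2) / 2) ((b2 - b1) / 2) b3 Hw) as CV.
  cbv zeta in CU, CV. destruct HF as [Hr _ _ HE _ _ HD _ HK0].
  assert (Hg : forall s, g2 s <> 0) by (intros s; apply Rgt_not_eq, Hpos).
  assert (EU : forall s, 1 / g2 s = (a1 + a2) / 2 * null_plus k s_star s + (a2 - a1) / 2 * null_minus k s_star s
                          + a3 * kappa k s_star s).
  { intros s. destruct (Hrep s) as [Hd [_ E2]]. rewrite <- W_hat_combination. fold (denom k s_star a1 a2 a3 s).
    rewrite E2. field. assumption. }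
  assert (EV : forall s, g1 s / g2 s = (b1 + b2) / 2 * null_plus k s_star s + (b2 - b1) / 2 * null_minus k s_star s
                          + b3 * kappa k s_star s).
  { intros s. destruct (Hrep s) as [Hd [E1 E2]]. rewrite <- W_hat_combination.
    rewrite E1, E2. field. assumption. }
  destruct (frame_coords_unique_normal _ _ _ _ _ _ _ HU CU HK0 EU) as [ET EN].
  destruct (frame_coords_unique_normal _ _ _ _ _ _ _ HV CV HK0 EV) as [ETV ENV].
  set (r := sqrt (Rabs (mu k))) in *. assert (Hr0 : r <> 0) by lra.
  assert (HA3 : forall s, a3 * g2 s = (- kappa k s_star s - sin (phi s) * Derive (kappa k s_star) s
                            + cos (phi s) * kappa k s_star s ^ 2 / 2) / r ^ 2).
  { intros s. pose proof (combination_coefK r (kappa k s_star s) (Derive (kappa k s_star) s)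
      (null_plus k s_star s) (null_minus k s_star s) ((a1 + a2) / 2) ((a2 - a1) / 2) a3 Hr0 (HE s)) as E.
    rewrite <- EU, <- ET, <- EN in E. unfold mink in E.
    apply (Rmult_eq_reg_l (r ^ 2)); [|now apply pow_nonzero].
    rewrite <- Rmult_assoc, <- E. field. auto. }
  assert (HB3 : forall s, a3 * g1 s - b3 = - (cos (phi s) * Derive (kappa k s_star) s
                            + sin (phi s) * kappa k s_star s ^ 2 / 2) / r ^ 2).
  { intros s. pose proof (combination_coefK r (kappa k s_star s) (Derive (kappa k s_star) s)
      (null_plus k s_star s) (null_minus k s_star s) ((b1 + b2) / 2) ((b2 - b1) / 2) b3 Hr0 (HE s)) as E.
    rewrite <- EV, <- ETV, <- ENV in E. unfold mink in E.
    replace (a3 * g1 s) with (a3 * g2 s * (g1 s / g2 s)) by (field; auto). rewrite HA3.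
    apply (Rmult_eq_reg_l (r ^ 2)); [|now apply pow_nonzero].
    rewrite Rmult_minus_distr_l, <- E. field. auto. }
  assert (HA3' : forall s, a3 * g2 s = kappa k s_star s / mu k + 1 / (2 * mu k) *
       (2 * Derive (kappa k s_star) s * sin (phi s) - kappa k s_star s ^ 2 * cos (phi s))).
  { intros s. rewrite HA3, Hmu. fold r. field. assumption. }
  assert (HB3' : forall s, a3 * g1 s = b3 + 1 / (2 * mu k) *
       (kappa k s_star s ^ 2 * sin (phi s) + 2 * Derive (kappa k s_star) s * cos (phi s))).
  { intros s. transitivity (b3 + (a3 * g1 s - b3)); [ring|]. rewrite HB3, Hmu. fold r. field. assumption. }
  split; [|split; auto].
  intros s HKs. specialize (EU s). specialize (EV s). specialize (ET s). specialize (ETV s).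
  specialize (HA3' s). specialize (HB3' s). specialize (HD s). specialize (HE s). specialize (Hg s).
  destruct (W_quotient k s_star s Hw) as [EW1 EW2].
  destruct (W_derivatives k s_star s Hw HKs) as [DW1 DW2]. fold r in DW1, DW2.
  destruct (null_pair_products r _ _ _ _ Hr0 HE HD) as [_ [UT _]].
  (* The minor of the two null coordinates is r kappa^2, and division of both functions by kappa
     leaves a constant. *)
  assert (Hdet : wronskian k s_star s = r / 2).
  { unfold wronskian, det2. rewrite EW1, EW2, DW1, DW2.
    transitivity ((null_plus k s_star s * null_tangent (- r) (kappa k s_star s) (Derive (kappa k s_star) s) (null_minus k s_star s)
      - null_tangent r (kappa k s_star s) (Derive (kappa k s_star) s) (null_plus k s_star s) * null_minus k s_star s)
      / (2 * kappa k s_star s ^ 2)).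
    - unfold null_plus, null_minus.
      set (Tp := null_tangent r _ _ _). set (Tm := null_tangent (- r) _ _ _). field. assumption.
    - rewrite UT. field. assumption. }
  assert (Hdet0 : wronskian k s_star s <> 0) by (rewrite Hdet; lra).
  split; [assumption|].
  set (K := kappa k s_star s) in *. set (K1 := Derive (kappa k s_star) s) in *.
  set (Tp := null_tangent r K K1 (null_plus k s_star s)) in *.
  set (Tm := null_tangent (- r) K K1 (null_minus k s_star s)) in *.
  assert (HWa : forall x1 x2, W1 k s_star s * x1 + W2 k s_star s * x2 =
    ((x1 + x2) / 2 * null_plus k s_star s + (x2 - x1) / 2 * null_minus k s_star s) / K).
  { intros x1 x2. rewrite EW1, EW2. unfold null_plus, null_minus. field. assumption. }
  assert (HWb : forall x1 x2, Derive (W1 k s_star) s * x1 + Derive (W2 k s_star) s * x2 =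
    (((x1 + x2) / 2 * Tp + (x2 - x1) / 2 * Tm) * K
     - ((x1 + x2) / 2 * null_plus k s_star s + (x2 - x1) / 2 * null_minus k s_star s) * K1) / K ^ 2).
  { intros x1 x2. rewrite DW1, DW2. field. assumption. }
  set (P1 := 1 / K - K / mu k - K1 / mu k * sin (phi s) + K ^ 2 / (2 * mu k) * cos (phi s)).
  set (P2 := - (1 / K * sin (phi s)) - K1 / K ^ 2).
  set (Q1 := K ^ 2 / (2 * mu k) * sin (phi s) + K1 / mu k * cos (phi s)).
  set (Q2 := 1 / K * cos (phi s)).
  assert (Hmu0 : mu k <> 0) by (rewrite Hmu; pose proof (pow_lt _ 2 Hr); lra).
  (* The formulas for a3 gamma2 and a3 gamma1 collapse the first entries of the two columns; the
     term with a3 is the kappa part of the representation, moved to the other side. *)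
  assert (EP1 : P1 = 1 / K - a3 * g2 s) by (rewrite HA3'; unfold P1; field; auto).
  assert (EQ1 : Q1 = a3 * g1 s - b3) by (rewrite HB3'; unfold Q1; field; auto).
  assert (Scale : forall x1 x2 z y zt,
    z = (x1 + x2) / 2 * null_plus k s_star s + (x2 - x1) / 2 * null_minus k s_star s + y * K ->
    zt = (x1 + x2) / 2 * Tp + (x2 - x1) / 2 * Tm + y * K1 ->
    W1 k s_star s * (g2 s * x1) + W2 k s_star s * (g2 s * x2) = g2 s * (z / K - y) /\
    Derive (W1 k s_star) s * (g2 s * x1) + Derive (W2 k s_star) s * (g2 s * x2) = g2 s * (zt * K - z * K1) / K ^ 2).
  { intros x1 x2 z y zt -> ->. split.
    - transitivity (g2 s * (W1 k s_star s * x1 + W2 k s_star s * x2)); [ring|]. rewrite HWa. field. assumption.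
    - transitivity (g2 s * (Derive (W1 k s_star) s * x1 + Derive (W2 k s_star) s * x2)); [ring|].
      rewrite HWb. field. assumption. }
  destruct (Scale a1 a2 _ a3 _ EU ET) as [SA1 SA2].
  destruct (Scale b1 b2 _ b3 _ EV ETV) as [SB1 SB2].
  unfold xi1, xi3, W_inv_mul. fold K K1 P1 P2 Q1 Q2. split.
  - destruct (inv2_mul_solve _ _ _ _ (g2 s * a1) (g2 s * a2) 1 P1 P2 0 0 0 Hdet0) as [X1 X2].
    + rewrite SA1, EP1. field. auto.
    + rewrite SA2. unfold P2. field. auto.
    + rewrite Rmult_1_l, Rmult_0_l, Rplus_0_r in X1, X2. rewrite X1, X2. symmetry. apply surjective_pairing.
  - destruct (inv2_mul_solve _ _ _ _ (g2 s * b1) (g2 s * b2) (g1 s) P1 P2 (g2 s) Q1 Q2 Hdet0) as [X1 X2].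
    + rewrite SB1, EP1, EQ1. field. auto.
    + rewrite SB2. unfold P2, Q2. field. auto.
    + now rewrite X1, X2.
Qed.

(** * From the representation to the elastica *)

Lemma oriented_elastica (k s_star : R) (g1 g2 : R -> R) (a1 a2 a3 b1 b2 b3 : R) :
  wavelike_modulus k -> (forall s, 0 < g2 s) ->
  4 * ((a1 + a2) / 2) * ((a2 - a1) / 2) = a3 ^ 2 ->
  oriented (sqrt (Rabs (mu k))) ((a1 + a2) / 2) ((a2 - a1) / 2) a3 ((b1 + b2) / 2) ((b2 - b1) / 2) b3 ->
  represented k s_star g1 g2 a1 a2 a3 b1 b2 b3 ->
  exists phi, elastica_with k s_star g1 g2 phi.
Proof.
  intros Hw Hpos H4 Hor Hrep.
  pose proof (kappa_frame k s_star Hw) as HF.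
  pose proof (frame_coords_combination k s_star ((a1 + a2) / 2) ((a2 - a1) / 2) a3 Hw) as CU.
  pose proof (frame_coords_combination k s_star ((b1 + b2) / 2) ((b2 - b1) / 2) b3 Hw) as CV.
  cbv zeta in CU, CV.
  assert (HCk := fun n => elastic_frame_Ck _ _ _ _ _ n HF).
  destruct HF as [Hr HKd _ HE _ _ HD _ HK0].
  set (r := sqrt (Rabs (mu k))) in *. assert (Hr0 : r <> 0) by lra.
  set (K := kappa k s_star) in *. set (K1 := Derive K) in *.
  set (Pp := null_plus k s_star) in *. set (Pm := null_minus k s_star) in *.
  set (u := fun s => (a1 + a2) / 2 * Pp s + (a2 - a1) / 2 * Pm s + a3 * K s) in *.
  set (v := fun s => (b1 + b2) / 2 * Pp s + (b2 - b1) / 2 * Pm s + b3 * K s) in *.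
  match type of CU with frame_coords _ _ ?t ?n => set (tu := t) in *; set (nu := n) in * end.
  match type of CV with frame_coords _ _ ?t ?n => set (tv := t) in *; set (nv := n) in * end.
  assert (Hid : forall s, u s ^ 2 = tu s ^ 2 + nu s ^ 2 /\ u s * tv s - tu s * v s = - nu s).
  { intros s. apply (combination_identities r (K s) (K1 s) (Pp s) (Pm s)); auto. }
  assert (Eden : forall s, denom k s_star a1 a2 a3 s = u s).
  { intros s. unfold denom. now rewrite W_hat_combination. }
  assert (Eg2 : forall s, 1 / u s = g2 s).
  { intros s. destruct (Hrep s) as [_ [_ ->]]. now rewrite Eden. }
  assert (Hu0 : forall s, u s <> 0).
  { intros s. rewrite <- Eden. apply (Hrep s). }
  assert (Eg1 : forall s, v s / u s = g1 s).
  { intros s. destruct (Hrep s) as [_ [-> _]]. now rewrite Eden, W_hat_combination. }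
  (* Cosine and sine of the future angle, as prescribed by the frame coordinates of 1/gamma2 in
     [curve_frame_coords]. *)
  set (c := fun s => - nu s / u s). set (sn := fun s => - tu s / u s).
  assert (Hcs : forall s, c s ^ 2 + sn s ^ 2 = 1).
  { intros s. unfold c, sn. transitivity ((tu s ^ 2 + nu s ^ 2) / u s ^ 2); [field; auto|].
    destruct (Hid s) as [<- _]. field. auto. }
  assert (Dg1 : forall s, is_derive g1 s (g2 s * c s)).
  { intros s. apply (is_derive_ext _ _ _ _ Eg1). destruct (CU s) as [U _]. destruct (CV s) as [V _].
    pose proof (is_derive_scal_div 1 _ _ s _ _ V U (Hu0 s)) as D.
    apply (is_derive_ext _ (fun x => v x / u x)) in D; [|intros x; apply Rmult_1_l].
    replace (g2 s * c s) with (1 * ((tv s * u s - v s * tu s) / u s ^ 2)); [exact D|].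
    rewrite <- Eg2. unfold c. transitivity ((u s * tv s - tu s * v s) / u s ^ 2); [field; auto|].
    destruct (Hid s) as [_ ->]. field. auto. }
  assert (Dg2 : forall s, is_derive g2 s (g2 s * sn s)).
  { intros s. apply (is_derive_ext _ _ _ _ Eg2). destruct (CU s) as [U _].
    rewrite <- Eg2. unfold sn. auto_derive; [exact (conj (ex_intro _ _ U) (conj (Hu0 s) I))|].
    rewrite (is_derive_unique (fun x : R => u x) _ _ U). field. auto. }
  assert (Dsn : forall s, is_derive sn s ((K s - c s) * c s)).
  { intros s. destruct (CU s) as [U [T N]]. unfold sn.
    auto_derive; [exact (conj (ex_intro _ _ T) (conj (ex_intro _ _ U) (conj (Hu0 s) I)))|].
    rewrite (is_derive_unique (fun x : R => u x) _ _ U), (is_derive_unique (fun x : R => tu x) _ _ T).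
    unfold c. apply Rminus_diag_uniq.
    transitivity ((tu s ^ 2 + nu s ^ 2 - u s ^ 2) / u s ^ 2); [field; auto|].
    destruct (Hid s) as [-> _]. unfold Rdiv. ring. }
  assert (Dc : forall s, is_derive c s (- ((K s - c s) * sn s))).
  { intros s. destruct (CU s) as [U [T N]]. unfold c.
    auto_derive; [exact (conj (ex_intro _ _ N) (conj (ex_intro _ _ U) (conj (Hu0 s) I)))|].
    rewrite (is_derive_unique (fun x : R => u x) _ _ U), (is_derive_unique (fun x : R => nu x) _ _ N).
    unfold sn. field. auto. }
  (* The arccosine fixes the initial angle up to sign, and the sign is chosen to match the sine. *)
  assert (Hphi0 : exists p0, cos p0 = c 0 /\ sin p0 = sn 0).
  { specialize (Hcs 0). assert (Hc1 : -1 <= c 0 <= 1) by (pose proof (pow2_ge_0 (sn 0)); nra).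
    assert (Hs : sin (acos (c 0)) ^ 2 = sn 0 ^ 2).
    { pose proof (sin2_cos2 (acos (c 0))) as E. rewrite !Rsqr_pow2, cos_acos in E by assumption. lra. }
    rewrite <- !Rsqr_pow2 in Hs. apply Rsqr_eq in Hs. destruct Hs as [Hs|Hs].
    - exists (acos (c 0)). now rewrite cos_acos.
    - exists (- acos (c 0)). rewrite cos_neg, sin_neg, cos_acos by assumption. split; [reflexivity|lra]. }
  destruct Hphi0 as [p0 [Hp0c Hp0s]].
  (* The required speed kappa - cos phi is already known through c, so phi can be a primitive;
     [rotation_unique] then identifies its sine and cosine. *)
  set (w := fun s => K s - c s).
  assert (Hwc : forall s, continuous w s).
  { intros s. apply (continuous_minus (V := R_NormedModule) K c).
    - eapply is_derive_continuous, HKd.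
    - eapply is_derive_continuous, Dc. }
  set (phi := fun s => p0 + RInt (fun z => 1 * w z) 0 s).
  assert (Dphi : forall s, is_derive phi s (w s)).
  { intros s. pose proof (is_derive_RInt_scal 1 w s Hwc) as D. rewrite Rmult_1_l in D.
    replace (w s) with (0 + w s) by ring.
    apply (is_derive_plus (fun _ => p0) (fun s => RInt (fun z => 1 * w z) 0 s)); [|exact D].
    auto_derive; [trivial|ring]. }
  assert (Hphi : forall s, sn s = sin (phi s) /\ c s = cos (phi s)).
  { intros s. apply (rotation_unique sn c phi w).
    - intros x _. exact (conj (Dsn x) (conj (Dc x) (Dphi x))).
    - unfold phi. rewrite (RInt_point (V := R_CompleteNormedModule)). change (zero : R) with 0.
      now rewrite Rplus_0_r.
    - unfold phi. rewrite (RInt_point (V := R_CompleteNormedModule)). change (zero : R) with 0.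
      now rewrite Rplus_0_r. }
  assert (Hlin : forall n x y z, Ck n (fun s => x * Pp s + y * Pm s + z * K s)).
  { intros n x y z. destruct (HCk n) as [CK [_ [CP CM]]].
    apply Ck_plus; [apply Ck_plus|]; apply Ck_mult; auto using Ck_const. }
  assert (Hg2k : forall n, Ck n g2).
  { intros n. apply (Ck_ext n (fun s => / u s)); [intros s; rewrite <- Eg2; unfold Rdiv; ring|].
    apply Ck_inv; [assumption|apply Hlin]. }
  assert (Hg1k : forall n, Ck n g1).
  { intros n. apply (Ck_ext n (fun s => v s * / u s)); [assumption|].
    apply Ck_mult; [apply Hlin|]. apply Ck_inv; [assumption|apply Hlin]. }
  (* The frame equations raise the order of all three coordinates together. *)
  assert (Htriple : forall n, Ck n u /\ Ck n tu /\ Ck n nu).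
  { induction n as [|n [IU [IT IN]]]; [easy|]. destruct (HCk n) as [CK _].
    split; [|split].
    - exists tu. split; [intros s; apply (CU s)|assumption].
    - exists (fun s => u s + K s * nu s). split; [intros s; apply (CU s)|].
      apply Ck_plus; [assumption|now apply Ck_mult].
    - exists (fun s => -1 * (K s * tu s)). split.
      + intros s. replace (-1 * (K s * tu s)) with (- (K s * tu s)) by ring. apply (CU s).
      + apply Ck_mult; [apply Ck_const|now apply Ck_mult]. }
  assert (Hphik : forall n, Ck n phi).
  { intros [|n]; [easy|]. exists w. split; [assumption|]. destruct (HCk n) as [CK _].
    destruct (Htriple n) as [CU' [_ CN]].
    apply (Ck_ext n (fun s => K s + nu s * / u s)).
    - intros s. unfold w, c, Rdiv. ring.
    - apply Ck_plus; [assumption|]. apply Ck_mult; [assumption|now apply Ck_inv]. }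
  exists phi. split; [|split; [split|]].
  - split; [exact Hpos|]. split; [now apply Ck_smooth|]. split; [now apply Ck_smooth|].
    intros s. rewrite (is_derive_unique _ _ _ (Dg1 s)), (is_derive_unique _ _ _ (Dg2 s)).
    transitivity (g2 s ^ 2 * (c s ^ 2 + sn s ^ 2)); [ring|]. rewrite Hcs. ring.
  - now apply Ck_smooth.
  - intros s. destruct (Hphi s) as [<- <-]. split; now apply is_derive_unique.
  - intros s. unfold hyp_curvature. rewrite (is_derive_unique _ _ _ (Dphi s)).
    destruct (Hphi s) as [_ <-]. unfold w. fold K. ring.
Qed.

(** The reflection in the vertical axis replaces phi by pi - phi and negates the curvature; the
    shift of s_* by T absorbs the sign. *)
Lemma elastica_reflection (k s_star T : R) (g1 g2 phi : R -> R) :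
  (forall s_star s, kappa k (s_star + T) s = - kappa k s_star s) ->
  elastica_with k s_star (fun s => - g1 s) g2 phi ->
  elastica_with k (s_star + T) g1 g2 (fun s => PI - phi s).
Proof.
  intros HT [[Hpos [S1 [S2 Har]]] [[Sphi Hphi] Hk]].
  assert (Hsm : forall f, smooth (fun s => - f s) -> smooth f).
  { intros f Hf n s. apply (ex_derive_n_ext (fun s => - - f s)); [intros x; apply Ropp_involutive|].
    now apply ex_derive_n_opp. }
  assert (Eopp : forall s, Derive g1 s = - Derive (fun s => - g1 s) s).
  { intros s. rewrite Derive_opp. ring. }
  split; [|split; [split|]].
  - split; [exact Hpos|]. split; [now apply Hsm|]. split; [exact S2|].
    intros s. rewrite <- Har, Eopp. ring.
  - intros n s. apply (ex_derive_n_minus (fun _ => PI) phi).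
    + apply filter_forall. intros x j _. destruct j as [|j]; [easy|]. apply ex_derive_n_const.
    + apply filter_forall. intros x j _. apply Sphi.
  - intros s. destruct (Hphi s) as [E1 E2]. rewrite Eopp, E1, E2.
    rewrite cos_minus, sin_minus, cos_PI, sin_PI. split; ring.
  - intros s. rewrite HT, <- Hk. unfold hyp_curvature.
    rewrite Derive_minus, Derive_const; [|apply ex_derive_const|apply (Sphi 1%nat)].
    rewrite cos_minus, cos_PI, sin_PI. ring.
Qed.

(* For [a3 = 0] both signs of [b3] are admissible. The unoriented one yields the mirror image of an
   elastica, with curvature [- kappa], which is [kappa] shifted by half a period. *)
Lemma represented_elastica (k s_star : R) (g1 g2 : R -> R) (a1 a2 a3 b1 b2 b3 : R) :
  wavelike_modulus k -> (forall s, 0 < g2 s) -> admissible k a1 a2 a3 b1 b2 b3 ->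
  represented k s_star g1 g2 a1 a2 a3 b1 b2 b3 -> wavelike_elastica g1 g2.
Proof.
  intros Hw Hpos Hadm Hrep.
  (* Otherwise a2 would vanish too, and with it the denominator. *)
  assert (Ha : a1 <> 0 \/ a3 <> 0).
  { destruct (Req_dec a1 0) as [E1|]; [|now left]. destruct (Req_dec a3 0) as [E3|]; [|now right].
    exfalso. destruct (Hrep 0) as [Hd _]. apply Hd. unfold denom. subst a1 a3.
    destruct Hadm as [[H3 _]|[_ [E2 _]]]; [lra|]. rewrite E2, Rabs_R0. ring. }
  destruct (admissible_oriented _ _ _ _ _ _ _ Hw Ha Hadm) as [H4 [Hor|Hor]].
  - exists k, s_star. split; [assumption|]. eapply oriented_elastica; eassumption.
  - destruct (kappa_antiperiodic k Hw) as [T HT].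
    destruct (oriented_elastica k s_star (fun s => - g1 s) g2 a1 a2 a3 (- b1) (- b2) (- b3) Hw Hpos H4 Hor)
      as [phi Hphi].
    + intros s. destruct (Hrep s) as [Hd [E1 E2]]. split; [assumption|]. split; [|assumption].
      rewrite E1. field. assumption.
    + exists k, (s_star + T). split; [assumption|]. exists (fun s => PI - phi s). now apply elastica_reflection.
Qed.

Theorem theorem5 (gamma1 gamma2 : R -> R)
    (Hgamma : forall s : R, in_H (gamma1 s) (gamma2 s)) :
  (wavelike_elastica gamma1 gamma2 <->
   exists k s_star : R, wavelike_modulus k /\
     exists a1 a2 a3 b1 b2 b3 : R,
       admissible k a1 a2 a3 b1 b2 b3 /\
       represented k s_star gamma1 gamma2 a1 a2 a3 b1 b2 b3)
  /\
  (forall (k s_star : R) (phi : R -> R),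
     wavelike_modulus k ->
     elastica_with k s_star gamma1 gamma2 phi ->
     (exists a1 a2 a3 b1 b2 b3 : R,
        admissible k a1 a2 a3 b1 b2 b3 /\
        represented k s_star gamma1 gamma2 a1 a2 a3 b1 b2 b3)
     /\
     (forall a1 a2 a3 b1 b2 b3 : R,
        admissible k a1 a2 a3 b1 b2 b3 ->
        represented k s_star gamma1 gamma2 a1 a2 a3 b1 b2 b3 ->
        (forall s : R, kappa k s_star s <> 0 ->
           wronskian k s_star s <> 0 /\
           (gamma2 s * a1, gamma2 s * a2) = xi1 k s_star phi s /\
           (gamma2 s * b1, gamma2 s * b2) =
             (gamma1 s * fst (xi1 k s_star phi s) + gamma2 s * fst (xi3 k s_star phi s),
              gamma1 s * snd (xi1 k s_star phi s) + gamma2 s * snd (xi3 k s_star phi s)))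
        /\
        (forall s : R,
           a3 * gamma1 s =
             b3 + 1 / (2 * mu k) *
               (kappa k s_star s ^ 2 * sin (phi s)
                + 2 * Derive (kappa k s_star) s * cos (phi s)) /\
           a3 * gamma2 s =
             kappa k s_star s / mu k
             + 1 / (2 * mu k) *
               (2 * Derive (kappa k s_star) s * sin (phi s)
                - kappa k s_star s ^ 2 * cos (phi s))))).
Proof.
  split.
  - split.
    + intros [k [s_star [Hw [phi He]]]]. exists k, s_star. split; [assumption|].
      eapply elastica_represented; eassumption.
    + intros [k [s_star [Hw [a1 [a2 [a3 [b1 [b2 [b3 [Hadm Hrep]]]]]]]]]].
      eapply represented_elastica; [exact Hw|exact Hgamma|exact Hadm|exact Hrep].
  - intros k s_star phi Hw He. split; [eapply elastica_represented; eassumption|].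
    intros a1 a2 a3 b1 b2 b3 _ Hrep. exact (elastica_identities _ _ _ _ _ _ _ _ _ _ _ Hw He Hrep).
Qed.
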